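(* Let $\mathscr D\subset\mathbb T$ be a set whose boundary has Lebesgue measure zero and with $|\mathscr D|>0$, and let $\varphi\in\mathscr B(\mathbb T)$. For each $q\in\mathbb N$ let $p=p_q$ be chosen uniformly at random from $P_q(\mathscr D)=\{p\in\mathbb Z_q^\times : p/q \bmod 1\in\mathscr D\}$. Then the following convergences in distribution hold: (1) as $q\to\infty$ through integers with $q\equiv 0\bmod 4$ and $q$ not a perfect square: $\big(\frac{g_1(p,q)}{\sqrt q},\frac{g_\varphi(p,q)}{g_1(p,q)}\big)\xrightarrow{d}(X,G^+_\varphi)$; (2) as $q\to\infty$ through integers with $q\equiv 0\bmod 4$ and $q$ a perfect square: $\big(\frac{g_1(p,q)}{\sqrt q},\frac{g_\varphi(p,q)}{g_1(p,q)}\big)\xrightarrow{d}(Z,G^+_\varphi)$; (3) as $q\to\infty$ through odd integers that are not perfect squares: $\big(\frac{g_1(p,q)}{\epsilon_q\sqrt q},\frac{g_\varphi(p,q)}{g_1(p,q)}\big)\xrightarrow{d}(Y,G_\varphi)$; (4) as $q\to\infty$ through odd perfect squares: $\frac{g_\varphi(p,q)}{\epsilon_q\sqrt q}\xrightarrow{d}G_\varphi$; (5) as $q\to\infty$ through integers with $q\equiv 2\bmod 4$ and $q/2$ not a perfect square: $\big(\frac{g_1(2p,q/2)}{\epsilon_{q/2}\sqrt{q/2}},\frac{g_\varphi(p,q)}{2g_1(2p,q/2)}\big)\xrightarrow{d}(Y,G^-_\varphi)$; (6) as $q\to\infty$ through integers with $q\equiv 2\bmod 4$ and $q/2$ a perfect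 square: $\frac{g_\varphi(p,q)}{\epsilon_{q/2}\sqrt{2q}}\xrightarrow{d}G^-_\varphi$.
   Context: $\mathbb T=\mathbb R/\mathbb Z$ with Lebesgue measure $|\cdot|$. For $q\in\mathbb N$, $\mathbb Z_q^\times=\{p\in\{1,\dots,q\}:\gcd(p,q)=1\}$. $e(x)=e^{2\pi i x}$, $e_q(x)=e^{2\pi i x/q}$. For a function $\varphi:\mathbb T\to\mathbb C$ (i.e. 1-periodic on $\mathbb R$) and integers $q\ge1$, $p$, the incomplete Gauss sum is $g_\varphi(p,q)=\sum_{h=0}^{q-1}\varphi(h/q)\,e_q(ph^2)$; $g_1$ denotes the case $\varphi\equiv1$ (classical Gauss sum). $\widehat\varphi_k=\int_0^1\varphi(x)e(-kx)\,dx$ are the Fourier coefficients, and $\mathscr B(\mathbb T)=\{\varphi:\sum_{k\in\mathbb Z}k^2|\widehat\varphi_k|<\infty\}$ (such $\varphi$ equal their Fourier series). For an integer $a$, $\epsilon_a=1$ if $a\equiv1\bmod4$ and $\epsilon_a=i$ if $a\equiv 3\bmod 4$. Random variables: $X$ is uniform on $\{\pm1\pm i\}$; $Y$ is uniform on $\{\pm1\}$; $Z$ is uniform on $\{1+i,1-i\}$; with $x$ uniformly distributed on $\mathbb T$, $G^+_\varphi=\sum_{n\in\mathbb Z}\widehat\varphi_{2n}e(n^2x)$, $G_\varphi=\sum_{n\in\mathbb Z}\widehat\varphi_{n}e(n^2x)$, $G^-_\varphi=\sum_{n\in 2\mathbb Z+1}\widehat\varphi_{n}e(n^2x)$. In each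 limiting pair the two components are independent (e.g. $(X,G^+_\varphi)$ has the product law of $X$ and $G^+_\varphi$). *)

(* Defs.v *)
From HB Require Import structures.
From mathcomp Require Import all_boot all_order all_algebra.
From mathcomp Require Import all_classical all_reals all_analysis.
From mathcomp Require Import complex.
Set Implicit Arguments. Unset Strict Implicit. Unset Printing Implicit Defensive.
Import Order.TTheory GRing.Theory Num.Theory.
Import numFieldNormedType.Exports.
Local Open Scope classical_set_scope.
Local Open Scope ring_scope.
Local Open Scope complex_scope.

Section Defs.
Variable R : realType.

Definition ee (x : R) : R[i] := (cos (2 * pi * x)) +i* (sin (2 * pi * x)).

Definition cabs (z : R[i]) : R := Num.sqrt (complex.Re z ^+ 2 + complex.Im z ^+ 2).

Definition toR2 (z : R[i]) : R * R := (complex.Re z, complex.Im z).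

Definition cintT (f : R -> R[i]) : R[i] :=
  (Rintegral lebesgue_measure `[0, 1[ (fun x => complex.Re (f x)))
  +i* (Rintegral lebesgue_measure `[0, 1[ (fun x => complex.Im (f x))).

Definition fcoef (phi : R -> R[i]) (k : int) : R[i] :=
  cintT (fun x => phi x * ee (- (k%:~R) * x)).

Definition symsum (a : int -> R[i]) (N : nat) : R[i] :=
  \sum_(k < (2 * N).+1) a (k%:Z - N%:Z).

Definition ccvg (u : nat -> R[i]) (l : R[i]) : Prop :=
  (fun n => complex.Re (u n)) @ \oo --> complex.Re l /\ (fun n => complex.Im (u n)) @ \oo --> complex.Im l.

Definition sumZ (a : int -> R[i]) : R[i] :=
  (limn (fun N => complex.Re (symsum a N))) +i* (limn (fun N => complex.Im (symsum a N))).

Definition in_B (phi : R -> R[i]) : Prop :=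
  [/\ (forall x, phi (x + 1) = phi x),
      lebesgue_measure.-integrable `[0, 1[ (fun x => (complex.Re (phi x))%:E),
      lebesgue_measure.-integrable `[0, 1[ (fun x => (complex.Im (phi x))%:E),
      cvgn (series (fun n : nat =>
         (n%:R ^+ 2) * (cabs (fcoef phi n%:Z) + cabs (fcoef phi (- n%:Z)))))
    & forall x, ccvg (symsum (fun k => fcoef phi k * ee (k%:~R * x))) (phi x)].

Definition Gplus (phi : R -> R[i]) (x : R) : R[i] :=
  sumZ (fun n => fcoef phi (2 * n) * ee ((n * n)%:~R * x)).
Definition Gfull (phi : R -> R[i]) (x : R) : R[i] :=
  sumZ (fun n => fcoef phi n * ee ((n * n)%:~R * x)).
Definition Gminus (phi : R -> R[i]) (x : R) : R[i] :=
  sumZ (fun n => if odd `|n|%N then fcoef phi n * ee ((n * n)%:~R * x) else 0).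

Definition gsum (phi : R -> R[i]) (p : int) (q : nat) : R[i] :=
  \sum_(h < q) phi (h%:R / q%:R) * ee ((p * (h%:Z * h%:Z))%:~R / q%:R).
Definition g1 (p : int) (q : nat) : R[i] := gsum (fun _ => 1) p q.

Definition epsq (a : nat) : R[i] := if (a %% 4 == 1)%N then 1 else 'i.
Definition csqrt (n : nat) : R[i] := (Num.sqrt (n%:R : R))%:C.

Definition boundary (D : set R) : set R := closure D `\` interior D.

(* p in P_q(D) = { p in Z_q^x : p/q mod 1 in D }  (D is a 1-periodic set) *)
Definition inP (D : set R) (q p : nat) : bool :=
  [&& (1 <= p <= q)%N, coprime p q & `[< D (p%:R / q%:R) >]].

Definition unif_mean {T : Type} (D : set R) (q : nat) (F : nat -> T) (f : T -> R) : R :=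
  (\sum_(p < q.+1 | inP D q p) f (F p)) / (\sum_(p < q.+1 | inP D q p) 1).

Definition cvg_along (S : nat -> Prop) (u : nat -> R) (l : R) : Prop :=
  forall eps : R, 0 < eps ->
    exists N : nat, forall q : nat, (N <= q)%N -> S q -> `|u q - l| < eps.

Definition bounded_fun {T : Type} (f : T -> R) : Prop :=
  exists M : R, forall t, `|f t| <= M.

(* convergence in distribution, along S, of the random variable F q p_q
   (p_q uniform on P_q(D)) to the law whose expectation functional is E:
   E_q[f] --> E[f] for every bounded continuous test function f *)
Definition conv_dist {T : topologicalType} (S : nat -> Prop) (D : set R)
    (F : nat -> nat -> T) (E : (T -> R) -> R) : Prop :=
  forall f : T -> R, continuous f -> bounded_fun f ->
    cvg_along S (fun q => unif_mean D q (F q) f) (E f).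

(* expectation of f(W, G(x)) with W uniform on the finite list vals,
   x uniform on T, W and x independent *)
Definition E_pair (vals : seq R[i]) (G : R -> R[i])
    (f : (R * R) * (R * R) -> R) : R :=
  (size vals)%:R^-1 *
    \sum_(s <- vals) Rintegral lebesgue_measure `[0, 1[ (fun x => f (toR2 s, toR2 (G x))).

Definition E_single (G : R -> R[i]) (f : R * R -> R) : R :=
  Rintegral lebesgue_measure `[0, 1[ (fun x => f (toR2 (G x))).

Definition valsX : seq R[i] := [:: 1 +i* 1; 1 -i* 1; (-1) +i* 1; (-1) -i* 1].
Definition valsY : seq R[i] := [:: 1; -1].
Definition valsZ : seq R[i] := [:: 1 +i* 1; 1 -i* 1].

End Defs.

Definition is_square (n : nat) : Prop := exists m : nat, n = (m * m)%N.

(* Main.v *)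
(** Completing the square turns [g_phi(p,q) / g_1(p,q)] into the value of the
    theta-like series [G] at the point [b * pbar / q], where [pbar] is the
    inverse of [p] modulo [q] and [b] is fixed by [q mod 4].  The normalised
    Gauss sum takes values in a finite set.  Everything therefore reduces to the
    joint equidistribution of [(p/q, b * pbar / q)], weighted by the quadratic
    characters carried by the Gauss sum, that is, to a bound [o(phi(q))] for
    twisted Kloosterman sums.

    Weil's bound is not needed.  By [|S(mu, n/u)| = |S(m,n)|] for units [u], the
    fourth moment of [S] controls [phi(q) |S(m,n)|^4], and after scaling the
    moment counts the solutions of [(x+y)(x-1)(y-1) = 0] modulo [q].

    That the weights are characters follows from Galois conjugation of
    identities between Gauss sums, with no reciprocity law; that they have
    mean 0 when [q] is not a square follows from the irrationality of [sqrt q],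
    since the sum of [g_1(p,q)] over the units [p] is rational. *)

Require Import Defs.
From HB Require Import structures.
From mathcomp Require Import all_boot all_order all_algebra all_fingroup all_solvable all_field.
From mathcomp Require Import all_classical all_reals all_analysis.
From mathcomp Require Import measurable_realfun.
From mathcomp Require Import complex.
From mathcomp Require Import ring lra.
From mathcomp Require Import zify.
Import Order.TTheory GRing.Theory Num.Theory.
Import numFieldNormedType.Exports.
Local Open Scope ring_scope.
Set Implicit Arguments. Unset Strict Implicit. Unset Printing Implicit Defensive.

(** * Additive characters modulo q *)

(** Parseval for S itself would only give |S| <= q up to a constant; the fourth power is the first
    to save a power of q. The counting works for every q because, when three residues multiply to 0,
    one of them shares with q a divisor of size at least q^(1/3). The outcome |S| << q^(11/12 +
    epsilon) is compared with phi(q) through q <= tau(q) phi(q) and tau(q) << q^epsilon.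

    A sign of a Gauss sum is determined only for square moduli. In general Schur's trace argument
    gives the parts of the normalised sum modulo 2, which places it among +-1, +-i or among +-1 +-i;
    a weight that is a character up to a global sign serves as well as a character, since only
    absolute values of exponential sums enter.

    Independence of the limit pair is orthogonality of signs: a function of one or two signs expands
    in characters of the signs, and each nontrivial one is a weight of mean 0. The indicator of D is
    squeezed between Lipschitz functions whose gap concentrates on the boundary. *)

Section UnitCircle.
Variable R : realType.
Local Notation C := R[i].
Local Notation ee := (@ee R).
Implicit Types x y : R.

Lemma ee0 : ee 0 = 1.
Proof. by rewrite /ee mulr0 cos0 sin0. Qed.

Lemma eeD x y : ee (x + y) = ee x * ee y.
Proof.
by rewrite /ee mulrDr cosD sinD; apply/eqP; rewrite eq_complex /= eqxx addrC eqxx.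
Qed.

Lemma ee_conj x : (ee x)^* = ee (- x).
Proof. by rewrite /ee mulrN cosN sinN. Qed.

Lemma eeNK x : ee x * ee (- x) = 1.
Proof. by rewrite -eeD subrr ee0. Qed.

Lemma ee_norm x : `|ee x| = 1.
Proof. by apply/eqP; rewrite -(@eqrXn2 _ 2) // normCK ee_conj eeNK expr1n. Qed.

Lemma eeMn n x : ee (n%:R * x) = ee x ^+ n.
Proof.
elim: n => [|n IHn]; first by rewrite mul0r ee0 expr0.
by rewrite exprS -IHn -eeD -{2}[x]mul1r -mulrDl nat1r.
Qed.

Lemma ee1 : ee 1 = 1.
Proof. by rewrite /ee mulr1 mulr_natl cos2pi sin2pi. Qed.

Lemma ee_nat n : ee n%:R = 1.
Proof. by rewrite -[n%:R]mulr1 eeMn ee1 expr1n. Qed.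

Lemma ee_int (k : int) : ee k%:~R = 1.
Proof.
case: k => n; first by rewrite -pmulrn ee_nat.
by rewrite NegzE mulrNz -[LHS]mul1r -{1}(ee_nat n.+1) eeNK.
Qed.

Lemma ee_eq1 x : ee x = 1 -> exists k : int, x = k%:~R.
Proof.
move=> ex1; exists (Num.floor x); apply/eqP; rewrite -subr_eq0; apply/negPn/negP => y_neq0.
set y := x - _ in y_neq0.
have y_ge0 : 0 <= y by rewrite subr_ge0 floor_le_tmp.
have y_lt1 : y < 1 by rewrite ltrBlDl -intrD1 floorD1_gt.
have y_gt0 : 0 < y by rewrite lt_neqAle eq_sym y_neq0.
have : ee y = 1 by rewrite eeD ex1 -mulrNz ee_int mulr1.
rewrite /ee => -[]; rewrite -mulrA mulr_natl cos_mulr2n => c1 _.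
(* By the double angle formula, cos (2 pi y) = 1 makes sin (pi y) vanish, whereas the sine is
   positive on (0, pi). *)
have s0 : sin (pi * y) ^+ 2 = 0 by move: (cos2Dsin2 (pi * y)); lra.
have : 0 < sin (pi * y).
  by apply: sin_gt0_pi; rewrite mulr_gt0 ?pi_gt0 //= gtr_pMr ?pi_gt0.
by move/eqP: s0; rewrite sqrf_eq0 => /eqP ->; rewrite ltxx.
Qed.

(** Defined on [int], not on ['Z_q]: sums with moduli r and 2r, or m and m^2, are compared through
    [chi_scale]. *)
Definition chi (q : nat) (a : int) : C := ee (a%:~R / q%:R).

Lemma chi0 q : chi q 0 = 1. Proof. by rewrite /chi mul0r ee0. Qed.

Lemma chiD q a b : chi q (a + b) = chi q a * chi q b.
Proof. by rewrite /chi intrD mulrDl eeD. Qed.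

Lemma chi_conj q a : (chi q a)^* = chi q (- a).
Proof. by rewrite /chi ee_conj mulrNz mulNr. Qed.

Lemma chiMn q n a : chi q (n%:Z * a) = chi q a ^+ n.
Proof. by rewrite /chi intrM -mulrA -pmulrn eeMn. Qed.

Lemma chi_mull q a : (0 < q)%N -> chi q (q%:Z * a) = 1.
Proof.
move=> q_gt0; rewrite /chi intrM -pmulrn mulrAC divff ?mul1r ?ee_int //.
by rewrite pnatr_eq0 -lt0n.
Qed.

Lemma chi_dvd q a : (0 < q)%N -> (q %| a)%Z -> chi q a = 1.
Proof. by move=> q_gt0 /dvdzP[b ->]; rewrite mulrC chi_mull. Qed.

Lemma chi_eqmod q a b : (0 < q)%N -> (q %| a - b)%Z -> chi q a = chi q b.
Proof. by move=> q_gt0 dv; rewrite -[a](subrK b) chiD chi_dvd ?mul1r. Qed.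

Lemma chi_eq1 q a : (0 < q)%N -> chi q a = 1 -> (q %| a)%Z.
Proof.
move=> q_gt0 /ee_eq1[k kE]; apply/dvdzP; exists k.
have q_neq0 : (q%:R : R) != 0 by rewrite pnatr_eq0 -lt0n.
apply/eqP; rewrite -(eqr_int R) intrM -pmulrn -kE divfK //.
Qed.

Lemma chi_scale q k a : (0 < k)%N -> chi (q * k) (a * k%:Z) = chi q a.
Proof.
move=> k_gt0; rewrite /chi natrM intrM -pmulrn; congr ee.
have k_neq0 : (k%:R : R) != 0 by rewrite pnatr_eq0 -lt0n.
by rewrite invfM mulrACA divff // mulr1.
Qed.

Lemma chi_prim q : (0 < q)%N -> q.-primitive_root (chi q 1).
Proof.
move=> q_gt0; apply/andP; split=> //; apply/forallP => i; apply/eqP; apply/idP/idP.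
  move=> /unity_rootP; rewrite -chiMn mulr1 => /(chi_eq1 q_gt0).
  by move=> qi; have /= := dvdn_leq (ltn0Sn i) qi => qi'; apply/eqP/anti_leq; rewrite ltn_ord.
by move=> /eqP ->; apply/unity_rootP; rewrite -chiMn chi_mull.
Qed.

Lemma chi_nat q n : chi q n%:Z = chi q 1 ^+ n.
Proof. by rewrite -chiMn mulr1. Qed.

Lemma sum_shift (V : nmodType) q (F : int -> V) (s : int) : (0 < q)%N ->
  (forall a, F (a + q%:Z) = F a) -> \sum_(h < q) F (h%:Z + s) = \sum_(h < q) F h%:Z.
Proof.
move=> q_gt0 Fq.
(* A unit shift moves one end of the range to the other; a negative shift is undone by a positive
   one. *)
have up (t : int) : \sum_(h < q) F (h%:Z + (t + 1)) = \sum_(h < q) F (h%:Z + t).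
  case: q q_gt0 Fq => // q _ Fq; rewrite [LHS]big_ord_recr [RHS]big_ord_recl /=.
  rewrite addrC; congr (_ + _); last by apply: eq_bigr => i _; congr F; rewrite /bump /=; lia.
  by rewrite -[RHS]Fq; congr F; lia.
have upn (n : nat) (t : int) : \sum_(h < q) F (h%:Z + (t + n%:Z)) = \sum_(h < q) F (h%:Z + t).
  elim: n t => [|n IHn] t; first by rewrite addr0.
  by rewrite -(IHn t) -[RHS]up; apply: eq_bigr => i _; congr F; lia.
case: s => n.
  by rewrite -[Posz n]add0r upn; under eq_bigr do rewrite addr0.
rewrite -(upn n.+1 (Negz n)) NegzE addNr.
by under eq_bigr do rewrite addr0.
Qed.

(** Shifting h by one multiplies the sum by [chi q a], so the sum vanishes unless that factor is
    1. *)
Lemma sum_chi q a : (0 < q)%N ->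
  \sum_(h < q) chi q (h%:Z * a) = if (q %| a)%Z then q%:R else 0.
Proof.
move=> q_gt0; case: ifP => [dv|ndv].
  rewrite (eq_bigr (fun=> 1)); last by move=> h _; rewrite chi_dvd // dvdz_mull.
  by rewrite sumr_const card_ord.
have S_shift : chi q a * \sum_(h < q) chi q (h%:Z * a) = \sum_(h < q) chi q (h%:Z * a).
  rewrite -[RHS](@sum_shift _ q (fun h => chi q (h * a)) 1) //; last first.
    by move=> b; rewrite mulrDl chiD chi_mull ?mulr1.
  by rewrite mulr_sumr; apply: eq_bigr => h _; rewrite -chiD; congr chi; ring.
apply/eqP; apply: contraFT ndv => S_neq0; apply: chi_eq1 => //.
by apply: (mulIf S_neq0); rewrite S_shift mul1r.
Qed.

Lemma sum_chi_shift q a b : (0 < q)%N ->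
  \sum_(h < q) chi q (a * (h%:Z + b) ^+ 2) = \sum_(h < q) chi q (a * h%:Z ^+ 2).
Proof.
move=> q_gt0; apply: (@sum_shift _ q (fun h => chi q (a * h ^+ 2))) => // h.
have -> : a * (h + q%:Z) ^+ 2 = a * h ^+ 2 + q%:Z * (a * (2 * h + q%:Z)) by ring.
by rewrite chiD chi_mull // mulr1.
Qed.

End UnitCircle.

(** * The divisor bound *)

Section DivisorBound.
Local Open Scope nat_scope.

Definition tau n := size (divisors n).

(** A divisor d is recovered from the exponent of gcd(d, p^a) and from the cofactor d / gcd(d, p^a),
    which divides m. *)
Lemma tau_pfactorM p a m : prime p -> 0 < m -> tau (p ^ a * m) <= a.+1 * tau m.
Proof.
move=> p_pr m_gt0; have pa_gt0 : 0 < p ^ a by rewrite expn_gt0 prime_gt0.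
rewrite /tau -[a.+1](size_iota 0) -(size_allpairs (fun i d => p ^ i * d)).
apply: uniq_leq_size (divisors_uniq _) _ => d.
rewrite -dvdn_divisors ?muln_gt0 ?pa_gt0 // => d_dv.
have d_gt0 : 0 < d by apply: dvdn_gt0 d_dv; rewrite muln_gt0 pa_gt0.
have /(dvdn_pfactor _ _ p_pr) [i le_ia gE] := dvdn_gcdr d (p ^ a).
apply/allpairsP; exists (i, d %/ gcdn d (p ^ a)); split; rewrite ?mem_iota //=.
- rewrite -dvdn_divisors // -(@Gauss_dvdr _ (p ^ a %/ gcdn d (p ^ a))).
    by rewrite -(@dvdn_pmul2l (gcdn d (p ^ a))) ?gcdn_gt0 ?d_gt0 // mulnA ![gcdn _ _ * _]mulnC
      !divnK ?dvdn_gcdl ?dvdn_gcdr.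
  rewrite /coprime -(@eqn_pmul2r (gcdn d (p ^ a))) ?gcdn_gt0 ?d_gt0 //.
  by rewrite muln_gcdl !divnK ?dvdn_gcdl ?dvdn_gcdr // mul1n.
- by rewrite -gE mulnC divnK ?dvdn_gcdl.
Qed.

(** Bounds the local factor of tau(n)^k at a small prime: with t = (a+1) %/ k one has a + 1 <= k 2^t
    and k t <= a + 1. *)
Lemma expn_succ_le k a : 0 < k -> a.+1 ^ k <= 2 * k ^ k * 2 ^ a.
Proof.
move=> k_gt0; set t := a.+1 %/ k.
have le1 : a.+1 <= k * 2 ^ t.
  rewrite (leq_trans (ltnW (ltn_ceil a.+1 k_gt0))) // mulnC leq_mul2l.
  by rewrite ltn_expl ?orbT.
apply: leq_trans (_ : (k * 2 ^ t) ^ k <= _); first by rewrite leq_exp2r.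
rewrite expnMn -expnM mulnAC -expnS mulnC leq_mul2r leq_exp2l //.
by rewrite leq_trunc_div orbT.
Qed.

(** The bound tau(n) << n^(1/k), one prime power p^a at a time. If p >= 2^k, then (a+1)^k <= 2^(a k)
    <= p^a costs nothing; each of the at most 2^k smaller primes, counted by [w], costs a factor
    [C0]. *)
Lemma tau_exp_le k : 0 < k -> exists C, forall n, 0 < n -> tau n ^ k <= C * n.
Proof.
move=> k_gt0; pose C0 := 2 * k ^ k; pose B := 2 ^ k.
have C0_gt0 : 0 < C0 by rewrite muln_gt0 expn_gt0 k_gt0.
exists (C0 ^ B).
pose w n := #|[pred i : 'I_B | (i : nat) \in primes n]|.
suff tauw n : 0 < n -> tau n ^ k <= C0 ^ w n * n.
  move=> n n_gt0; apply: leq_trans (tauw n n_gt0) _.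
  rewrite leq_mul2r leq_pexp2l ?orbT //.
  by apply: leq_trans (max_card _) _; rewrite card_ord.
elim/ltn_ind: n => n IHn n_gt0.
have [n_le1|n_gt1] := leqP n 1.
  have -> : n = 1 by apply/eqP; rewrite eqn_leq n_le1.
  by rewrite muln1 /tau /= exp1n expn_gt0 C0_gt0.
set p := pdiv n; have p_pr : prime p by apply: pdiv_prime.
have [m co_pm] := pfactor_coprime p_pr n_gt0.
set a := logn p n => nE.
have a_gt0 : 0 < a by rewrite logn_gt0 mem_primes p_pr n_gt0 pdiv_dvd.
have m_gt0 : 0 < m by move: n_gt0; rewrite nE; case: (m).
have m_lt : m < n.
  by rewrite nE -{1}[m]muln1 ltn_pmul2l // -(expn0 p) ltn_exp2l // prime_gt1.
rewrite nE mulnC.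
apply: leq_trans (_ : (a.+1 * tau m) ^ k <= _).
  by rewrite leq_exp2r //; apply: tau_pfactorM.
rewrite expnMn.
have pNm : p \notin primes m.
  by rewrite mem_primes p_pr m_gt0 /= -prime_coprime.
have wE i : (i \in primes (p ^ a * m)) = (i == p) || (i \in primes m).
  rewrite primesM ?expn_gt0 ?(prime_gt0 p_pr) //.
  by rewrite primesX // primes_prime // inE.
have [p_lt|p_ge] := ltnP p B.
  have -> : w (p ^ a * m) = (w m).+1.
    rewrite /w (cardD1 (Ordinal p_lt)) inE /= wE eqxx /= add1n; congr _.+1.
    apply: eq_card => i; rewrite !inE wE -val_eqE /=.
    by case: eqP => //= ->; rewrite (negPf pNm).
  rewrite expnS mulnACA; apply: leq_mul (IHn _ m_lt m_gt0).
  apply: leq_trans (expn_succ_le a k_gt0) _.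
  by rewrite leq_mul2l leq_exp2r ?prime_gt1 ?orbT.
have -> : w (p ^ a * m) = w m.
  apply: eq_card => i; rewrite !inE wE; case: eqP => //= iE.
  by move: (ltn_ord i); rewrite iE ltnNge p_ge.
rewrite mulnCA; apply: leq_mul (IHn _ m_lt m_gt0).
apply: leq_trans (_ : (2 ^ a) ^ k <= _); first by rewrite leq_exp2r // ltn_expl.
by rewrite -expnM mulnC expnM leq_exp2r.
Qed.

Lemma totient_dvd_le d n : 0 < n -> d %| n -> totient d <= totient n.
Proof.
move=> n_gt0 d_dv; have d_gt0 := dvdn_gt0 n_gt0 d_dv.
rewrite !totientE // [leqRHS](bigID (fun p => p \in primes d)) /= -[X in _ <= X * _]big_filter.
have -> : [seq p <- primes n | p \in primes d] = primes d.
  apply: (irr_sorted_eq ltn_trans ltnn) => [||p].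
  - by apply: sorted_filter (sorted_primes n) => //; exact: ltn_trans.
  - exact: sorted_primes.
  - rewrite mem_filter andb_idr // !mem_primes => /and3P[-> _ /dvdn_trans->] //.
    by rewrite n_gt0.
rewrite -[leqLHS]muln1 leq_mul //.
  rewrite [leqLHS]big_seq [leqRHS]big_seq; apply: leq_prod => p pd.
  rewrite leq_mul2l leq_exp2l ?orbT; last first.
    by move: pd; rewrite mem_primes => /andP[/prime_gt1].
  by rewrite -!subn1 leq_sub2r ?orbT // dvdn_leq_log.
rewrite big_seq_cond; apply: prodn_cond_gt0 => p /andP[].
rewrite mem_primes => /andP[p_pr _] _.
by rewrite muln_gt0 expn_gt0 -subn1 subn_gt0 prime_gt1 ?prime_gt0.
Qed.

(** In n = sum of phi(d) over d | n each term is at most phi(n). So crude a lower bound for phi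
    suffices because powers of tau are absorbed anyway. *)
Lemma tau_totient_ge n : 0 < n -> n <= tau n * totient n.
Proof.
move=> n_gt0; rewrite -{1}(sum_totient_dvd n).
rewrite -(big_mkord (fun d => d %| n)).
apply: leq_trans (_ : \sum_(0 <= d < n.+1 | d %| n) totient n <= _).
  by apply: leq_sum => d; apply: totient_dvd_le.
rewrite big_const_seq iter_addn_0 mulnC leq_mul2r; apply/orP; right.
rewrite -size_filter; apply: uniq_leq_size.
  by rewrite filter_uniq ?iota_uniq.
by move=> d; rewrite mem_filter -dvdn_divisors // => /andP[].
Qed.

End DivisorBound.

(** * Twisted Kloosterman sums *)

Section KloostermanMoment.
Variables (A : finComUnitRingType) (C : numClosedFieldType) (psi : A -> C).
Hypothesis psiD : forall a b, psi (a + b) = psi a * psi b.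
Hypothesis psi_conj : forall a, (psi a)^* = psi (- a).
Hypothesis psi_orth : forall a, \sum_x psi (x * a) = if a == 0 then #|A|%:R else 0.

(** Orthogonality in m and in n leaves only the pairs (i, j) on which both [al] and [be] agree, each
    worth at most |A|^2. The index type is abstract because the fourth moment takes pairs of units
    as indices. *)
Lemma parseval_le (I : finType) (P : pred I) (al be : I -> A) (w : I -> C) :
  (forall i, `|w i| <= 1) ->
  \sum_m \sum_n `|\sum_(i | P i) w i * psi (m * al i + n * be i)| ^+ 2
  <= (#|A| ^ 2 * #|[set ij : I * I | [&& P ij.1, P ij.2, al ij.1 == al ij.2
                                        & be ij.1 == be ij.2]]|)%:R.
Proof.
move=> w_le1.
have sqE m n : `|\sum_(i | P i) w i * psi (m * al i + n * be i)| ^+ 2 =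
    \sum_(i | P i) \sum_(j | P j) w i * (w j)^* *
      (psi (m * (al i - al j)) * psi (n * (be i - be j))).
  rewrite normCK rmorph_sum mulr_suml; apply: eq_bigr => i _.
  rewrite mulr_sumr; apply: eq_bigr => j _.
  rewrite rmorphM /= psi_conj mulrACA; congr (_ * _).
  by rewrite -!psiD; congr psi; ring.
have SE : \sum_m \sum_n `|\sum_(i | P i) w i * psi (m * al i + n * be i)| ^+ 2 =
    \sum_(i | P i) \sum_(j | P j) w i * (w j)^* *
      ((\sum_m psi (m * (al i - al j))) * (\sum_n psi (n * (be i - be j)))).
  under eq_bigr do under eq_bigr do rewrite sqE.
  under eq_bigr do rewrite exchange_big.
  rewrite exchange_big; apply: eq_bigr => i _ /=.
  under eq_bigr do rewrite exchange_big.
  rewrite exchange_big; apply: eq_bigr => j _ /=.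
  rewrite mulr_suml mulr_sumr; apply: eq_bigr => m _.
  by rewrite mulr_sumr mulr_sumr.
have S_ge0 : 0 <= \sum_m \sum_n `|\sum_(i | P i) w i * psi (m * al i + n * be i)| ^+ 2.
  by apply: sumr_ge0 => m _; apply: sumr_ge0 => n _; rewrite exprn_ge0.
rewrite -(ger0_norm S_ge0) SE.
apply: le_trans (ler_norm_sum _ _ _) _.
apply: le_trans (ler_sum _ _) _.
  by move=> i Pi; apply: ler_norm_sum.
rewrite pair_big /= natrM -[X in _ * X%:R]sum1_card natr_sum mulr_sumr [leRHS]big_mkcond [leLHS]big_mkcond /=.
apply: ler_sum => -[i j] _; rewrite !inE /=.
case Pi: (P i); case Pj: (P j) => //=.
rewrite !psi_orth !subr_eq0; case: eqP; case: eqP => /=; rewrite ?mulr0 ?mul0r ?mulr0 ?normr0 //.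
move=> _ _; rewrite !normrM norm_conjC normr_nat mulr1 expnS expn1 natrM.
rewrite -[leRHS]mul1r ler_wpM2r ?mulr_ge0 //.
by apply: mulr_ile1.
Qed.

Variable c : A -> C.
Hypothesis c_le1 : forall x, `|c x| <= 1.
Hypothesis c_twist : forall u, u \is a GRing.unit -> exists2 k : C, `|k| = 1
  & forall x, x \is a GRing.unit -> c (x * u) = k * c x.

(** A Kloosterman sum for c = 1, a Salie sum when c is a quadratic character. *)
Definition kloo m n := \sum_(x | x \is a GRing.unit) c x * psi (m * x + n * x^-1).

(** The substitution x -> x u moves (m, n) along a hyperbola and costs only the phase of the
    twist. *)
Lemma kloo_scale u m n : u \is a GRing.unit ->
  `|kloo (m * u) (n * u^-1)| = `|kloo m n|.
Proof.
move=> uU; have [k k1 kE] := c_twist uU.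
have -> : kloo m n = k * kloo (m * u) (n * u^-1).
  rewrite /kloo (reindex_inj (mulIr uU)) mulr_sumr /=.
  apply: eq_big => [x|x]; first by rewrite unitrMl.
  rewrite unitrMl // => xU; rewrite kE // invrM //.
  by rewrite -[LHS]mulrA; congr (_ * (_ * psi _)); ring.
by rewrite normrM k1 mul1r.
Qed.

Definition zprod_set := [set z : A * A | (z.1 + z.2) * (z.1 - 1) * (z.2 - 1) == 0].

(** The additive energy of the hyperbola of points (x, 1/x). *)
Definition energy_set := [set ij : (A * A) * (A * A) |
  [&& (ij.1.1 \is a GRing.unit) && (ij.1.2 \is a GRing.unit),
      (ij.2.1 \is a GRing.unit) && (ij.2.2 \is a GRing.unit),
      ij.1.1 + ij.1.2 == ij.2.1 + ij.2.2
    & ij.1.1^-1 + ij.1.2^-1 == ij.2.1^-1 + ij.2.2^-1]].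

(* Eliminating [z = x + y - t] from [1/x + 1/y = 1/z + 1/t] leaves
   [(x + y)(x - t)(y - t) = 0]; the unit [t] is then scaled out. *)
Lemma card_energy_le :
  (#|energy_set| <= #|[set x : A | x \is a GRing.unit]| * #|zprod_set|)%N.
Proof.
rewrite -cardsX; set E := energy_set.
(* The triple (t, x/t, y/t) determines the quadruple, since z = x + y - t. *)
pose f (ij : (A * A) * (A * A)) := (ij.2.2, (ij.1.1 / ij.2.2, ij.1.2 / ij.2.2)).
have f_inj : {in E &, injective f}.
  move=> [[x y] [z t]] [[x' y'] [z' t']]; rewrite !inE /=.
  move=> /and4P[_ /andP[_ tU] /eqP e1 _] /and4P[_ _ /eqP e2 _] [tt'].
  rewrite -tt' in e2 *; have tVU: t^-1 \is a GRing.unit by rewrite unitrV.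
  move=> /(mulIr tVU) xx' /(mulIr tVU) yy'; rewrite -xx' -yy' in e2 *.
  by rewrite e1 in e2; rewrite (addIr _ e2).
rewrite -(card_in_imset f_inj); apply/subset_leq_card/fintype.subsetP => _ /imsetP[[[x y] [z t]] + ->].
rewrite !inE /= => /and4P[/andP[xU yU] /andP[zU tU] /eqP e1 /eqP e2].
rewrite tU /=.
have zE : z = x + y - t by rewrite e1; ring.
have e3 : (x + y) * (z * t) = (z + t) * (x * y).
  have -> : x + y = (x^-1 + y^-1) * (x * y).
    by rewrite mulrDl mulrA mulVr // mul1r mulrCA mulVr // mulr1 addrC.
  have -> : z + t = (z^-1 + t^-1) * (z * t).
    by rewrite mulrDl mulrA mulVr // mul1r mulrCA mulVr // mulr1 addrC.
  by rewrite e2; ring.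
have e4 : (x + y) * (x - t) * (y - t) = 0.
  have -> : (x + y) * (x - t) * (y - t) = (z + t) * (x * y) - (x + y) * (z * t).
    by rewrite zE; ring.
  by rewrite e3 subrr.
have -> : (x / t + y / t) * (x / t - 1) * (y / t - 1) =
    (x + y) * (x - t) * (y - t) * (t^-1 * t^-1 * t^-1).
  rewrite -(divrr tU); ring.
by rewrite e4 mul0r.
Qed.

(** The square of [kloo m n] is an exponential sum over pairs of units with frequencies x + y and
    1/x + 1/y, so Parseval for it counts [energy_set]. *)
Lemma kloo_moment :
  \sum_m \sum_n `|kloo m n| ^+ 4 <=
  (#|A| ^ 2 * (#|[set x : A | x \is a GRing.unit]| * #|zprod_set|))%:R.
Proof.
pose P (z : A * A) := (z.1 \is a GRing.unit) && (z.2 \is a GRing.unit).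
pose al (z : A * A) := z.1 + z.2.
pose be (z : A * A) := z.1^-1 + z.2^-1.
pose w (z : A * A) := c z.1 * c z.2.
have w1 z : `|w z| <= 1 by rewrite normrM mulr_ile1.
have := parseval_le P al be w1.
have E m n : `|\sum_(i | P i) w i * psi (m * al i + n * be i)| ^+ 2 = `|kloo m n| ^+ 4.
  rewrite -[4%N]/(2 * 2)%N exprM -[in RHS]normrX; congr (`|_| ^+ 2).
  rewrite expr2 /kloo mulr_suml -(pair_big (fun x => x \is a GRing.unit)
    (fun x => x \is a GRing.unit)
    (fun x y => w (x, y) * psi (m * al (x, y) + n * be (x, y)))) /=.
  apply: eq_bigr => x _; rewrite mulr_sumr; apply: eq_bigr => y _.
  rewrite /w /al /be /= mulrACA -psiD; congr (_ * psi _); ring.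
under eq_bigr do under eq_bigr do rewrite E.
move=> /le_trans; apply; rewrite ler_nat leq_mul2l; apply/orP; right.
exact: card_energy_le.
Qed.

(** The pairs (m u, n/u) all carry the same absolute value, and each is hit by at most g units u.
    Hence |U| |S|^4 is at most g times the fourth moment, whose bound also contains the factor |U|,
    and |U| cancels. *)
Lemma kloo_le (g : nat) (m n : A) :
  (#|[set v : A | (n * v == 0)%R]| <= g)%N \/ (#|[set v : A | (m * v == 0)%R]| <= g)%N ->
  `|kloo m n| ^+ 4 <= (g * (#|A| ^ 2 * #|zprod_set|))%:R.
Proof.
move=> ann_le; set U := [set x : A | x \is a GRing.unit].
have U_gt0 : (0 < #|U|)%N by apply/card_gt0P; exists 1; rewrite inE unitr1.
(* In the fibre through u0, the differences u^-1 - u0^-1 are killed by n and the differences u - u0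
   by m. *)
have fiber (k : A * A) :
    (#|[set u in U | (m * u, n * u^-1)%R == k]| <= g)%N.
  have [->//|] := set_0Vmem [set u in U | (m * u, n * u^-1) == k].
    by rewrite cards0.
  move=> [u0]; rewrite !inE => /andP[u0U /eqP <-].
  case: ann_le => [annn|annm].
    apply: leq_trans annn; pose h u := u^-1 - u0^-1.
    have h_inj : injective h by move=> u v /addIr /invr_inj.
    rewrite -(card_imset _ h_inj); apply/subset_leq_card/fintype.subsetP => _ /imsetP[u + ->].
    by rewrite !inE xpair_eqE => /and3P[_ _ /eqP nE]; rewrite mulrBr nE subrr.
  apply: leq_trans annm; pose h u := u - u0.
  have h_inj : injective h by move=> u v /addIr.
  rewrite -(card_imset _ h_inj); apply/subset_leq_card/fintype.subsetP => _ /imsetP[u + ->].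
  by rewrite !inE xpair_eqE => /and3P[_ /eqP nE _]; rewrite mulrBr nE subrr.
have : \sum_(u in U) `|kloo (m * u) (n * u^-1)| ^+ 4 <=
       g%:R * \sum_m \sum_n `|kloo m n| ^+ 4.
  rewrite pair_big /= (partition_big (fun u => (m * u, n * u^-1)) predT) //=.
  rewrite mulr_sumr; apply: ler_sum => k _.
  rewrite (eq_bigr (fun=> `|kloo k.1 k.2| ^+ 4)); last first.
    by move=> u /andP[_ /eqP <-].
  rewrite sumr_const -[leLHS]mulr_natl ler_wpM2r ?exprn_ge0 // ler_nat.
  apply: leq_trans (fiber k); apply/subset_leq_card/fintype.subsetP => u.
  by rewrite unfold_in /= !inE.
under eq_bigr => u do [rewrite inE => uU; rewrite (kloo_scale _ _ uU)].
rewrite sumr_const -[leLHS]mulr_natl => le1.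
have le2 := le_trans le1 (ler_wpM2l (ler0n _ g) kloo_moment).
rewrite -(@ler_pM2l _ #|U|%:R) ?ltr0n // (le_trans le2) //.
rewrite -!natrM ler_nat -/U.
by rewrite [in leqRHS]mulnCA leq_mul2l mulnCA leqnn orbT.
Qed.

End KloostermanMoment.

(** * Kloosterman sums modulo an arbitrary integer *)

Section KloostermanZp.

Lemma card_Zp_type q : (1 < q)%N -> #|'Z_q| = q.
Proof. by move=> q_gt1; rewrite card_ord Zp_cast. Qed.

Lemma val_Zp_lt q (a : 'Z_q) : (1 < q)%N -> (a < q)%N.
Proof. by move=> q_gt1; rewrite -[q in X in (_ < X)%N](Zp_cast q_gt1). Qed.

Lemma Zp_intr_eq0 q (k : int) : (1 < q)%N -> ((k%:~R : 'Z_q) == 0) = (q %| `|k|)%N.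
Proof.
move=> q_gt1; have natE n : ((n%:R : 'Z_q) == 0) = (q %| n)%N.
  by rewrite -val_eqE /= val_Zp_nat.
by case: (intP k) => [|n|n]; rewrite ?mulr0z ?eqxx ?dvdn0 // ?mulrNz ?oppr_eq0 ?abszN natE.
Qed.

Lemma card_dvd_ord_le q d : (0 < q)%N -> (d %| q)%N ->
  (#|[set a : 'I_q | (d %| a)%N]| <= q %/ d)%N.
Proof.
move=> q_gt0 d_dv; have d_gt0 := dvdn_gt0 q_gt0 d_dv.
have lt_q (a : 'I_q) : (d %| a)%N -> (a %/ d < q %/ d)%N.
  by move=> d_a; rewrite ltn_divRL // divnK.
rewrite -[leqRHS]card_ord -cardsT.
pose f (a : 'I_q) : option 'I_(q %/ d) := insub (a %/ d)%N.
have f_inj : {in [set a : 'I_q | (d %| a)%N] &, injective f}.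
  move=> a b; rewrite !inE => da db; rewrite /f.
  rewrite !insubT ?lt_q // => ha hb [e]; apply/val_inj => /=.
  by rewrite -(divnK da) -(divnK db) e.
rewrite -(card_in_imset f_inj).
have some_inj : injective (@Some 'I_(q %/ d)) by move=> x y [].
rewrite -(card_imset _ some_inj).
apply/subset_leq_card/fintype.subsetP => _ /imsetP[a + ->].
rewrite inE /f => da; rewrite insubT ?lt_q // => h.
by apply/imsetP; exists (Sub (a %/ d)%N h).
Qed.

(** Residues sharing with q a divisor of size at least q^(1/3): among three residues with product 0,
    one is of this kind. *)
Definition near_zero q := [set a : 'I_q | (q <= gcdn a q ^ 3)%N].

(** Such a residue is a multiple of a divisor d of q with d^3 >= q; there are at most tau(q) such d,
    each with q/d <= q^(2/3) multiples. Cubing keeps the estimate within [nat]. *)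
Lemma card_near_zero_le q : (0 < q)%N -> (#|near_zero q| ^ 3 <= tau q ^ 3 * q ^ 2)%N.
Proof.
move=> q_gt0; pose e := (\max_(d <- divisors q | (q <= d ^ 3)%N) (q %/ d))%N.
have e3 : (e ^ 3 <= q ^ 2)%N.
  rewrite /e big_seq_cond; apply: (big_ind (fun x => (x ^ 3 <= q ^ 2)%N)) => //.
    by move=> x y hx hy; rewrite /maxn; case: ifP.
  move=> d /andP[]; rewrite -dvdn_divisors // => d_dv d3.
  rewrite -(@leq_pmul2r (d ^ 3)%N) ?expn_gt0 ?(dvdn_gt0 q_gt0 d_dv) //.
  by rewrite -expnMn divnK // expnSr leq_mul2l d3 orbT.
have le1 : (#|near_zero q| <= tau q * e)%N.
  have sub : near_zero q \subset
     \bigcup_(d <- divisors q | (q <= d ^ 3)%N) [set a : 'I_q | (d %| a)%N].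
    apply/fintype.subsetP => a; rewrite inE => aq.
    have dq : gcdn a q \in divisors q by rewrite -dvdn_divisors ?dvdn_gcdr.
    rewrite (big_rem _ dq) aq /= !inE dvdn_gcdl //.
  apply: leq_trans (subset_leq_card sub) _.
  apply: leq_trans (_ : \sum_(d <- divisors q | (q <= d ^ 3)%N) e <= _)%N; last first.
    rewrite big_const_seq iter_addn_0 mulnC leq_mul2r count_size orbT //.
  rewrite [X in #|pred_of_set X|]big_seq_cond [leqRHS]big_seq_cond.
  apply: (@leq_trans (\sum_(d <- divisors q | (d \in divisors q) && (q <= d ^ 3))
     #|[set a : 'I_q | (d %| a)%N]|)%N).
    elim/big_ind2: _ => [|A m B n hA hB|//]; first by rewrite cards0.
    by rewrite (leq_trans (leq_card_setU _ _)) ?leq_add.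
  apply: leq_sum => d /andP[dq d3].
  have d_dv : (d %| q)%N by rewrite dvdn_divisors.
  apply: leq_trans (card_dvd_ord_le q_gt0 d_dv) _.
  exact: (@leq_bigmax_seq _ (divisors q) (fun d => (q <= d ^ 3)%N) (fun d => q %/ d)%N).
apply: leq_trans (_ : (tau q * e) ^ 3 <= _)%N; first by rewrite leq_exp2r.
by rewrite expnMn leq_mul2l e3 orbT.
Qed.

(** One of the factors is near zero while one coordinate stays free, so the count is at most 3 q
    times the number of residues near zero. *)
Lemma card_zprod_le q : (1 < q)%N ->
  (#|@zprod_set 'Z_q| ^ 3 <= 27 * tau q ^ 3 * q ^ 5)%N.
Proof.
move=> q_gt1; have q_gt0 := ltnW q_gt1.
pose B := [set a : 'Z_q | (q <= gcdn a q ^ 3)%N].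
have cardB : #|B| = #|near_zero q|.
  by rewrite /B /near_zero; case: q q_gt1 {q_gt0 B} => [|[|q]] // _.
have le1 : (#|@zprod_set 'Z_q| <= 3 * (q * #|B|))%N.
  (* Injective changes of coordinates, each bringing one of the three factors into second
     position. *)
  pose f1 (z : 'Z_q * 'Z_q) := (z.1, z.1 + z.2).
  pose f2 (z : 'Z_q * 'Z_q) := (z.2, z.1 - 1).
  pose f3 (z : 'Z_q * 'Z_q) := (z.1, z.2 - 1).
  have pinj (u v : 'Z_q * 'Z_q) : u = v -> u.1 = v.1 /\ u.2 = v.2 by move->.
  have f1_inj : injective f1 by move=> [x y] [x' y'] /pinj[/= -> /addrI ->].
  have f2_inj : injective f2 by move=> [x y] [x' y'] /pinj[/= -> /addIr ->].
  have f3_inj : injective f3 by move=> [x y] [x' y'] /pinj[/= -> /addIr ->].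
  have cardf (f : 'Z_q * 'Z_q -> 'Z_q * 'Z_q) : injective f ->
      (#|f @^-1: finset.setX [set: 'Z_q] B| <= q * #|B|)%N.
    move=> f_inj; rewrite -(card_imset _ f_inj).
    apply: leq_trans (_ : #|finset.setX [set: 'Z_q] B| <= _)%N.
      apply/subset_leq_card/fintype.subsetP => _ /imsetP[z + ->].
      by rewrite inE.
    by rewrite cardsX cardsT card_Zp_type.
  apply: leq_trans (_ : #|(f1 @^-1: finset.setX [set: 'Z_q] B) :|: (f2 @^-1: finset.setX [set: 'Z_q] B)
      :|: (f3 @^-1: finset.setX [set: 'Z_q] B)| <= _)%N; last first.
    apply: leq_trans (leq_card_setU _ _) _.
    rewrite mulSn addnC leq_add ?cardf // mulSn mul1n.
    by apply: leq_trans (leq_card_setU _ _) _; rewrite leq_add ?cardf.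
  apply/subset_leq_card/fintype.subsetP => -[x y].
  rewrite !inE /=; set a := x + y; set b := x - 1; set c := y - 1 => /eqP abc.
  have dv : (q %| a * b * c)%N.
    have : ((a * b * c)%N%:R : 'Z_q) == 0 by rewrite !natrM !natr_Zp abc.
    by rewrite -(Zp_intr_eq0 (a * b * c)%N).
  have gle : (q <= gcdn a q * gcdn b q * gcdn c q)%N.
    apply: dvdn_leq; first by rewrite !muln_gt0 !gcdn_gt0 q_gt0 !orbT.
    apply: dvdn_trans (_ : gcdn (a * b * c) q %| _)%N; first by rewrite dvdn_gcd dv dvdnn.
    have gM m n : (gcdn (m * n) q %| gcdn m q * gcdn n q)%N.
      rewrite muln_gcdl !muln_gcdr !dvdn_gcd.
      rewrite dvdn_gcdl /= !(dvdn_trans (dvdn_gcdr _ _)) //.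
      by rewrite dvdn_mulr. by rewrite dvdn_mulr. by rewrite dvdn_mull.
    by apply: dvdn_trans (gM _ _) _; rewrite dvdn_mul.
  apply: contraT; rewrite !negb_or -!ltnNge => /andP[/andP[ga gb] gc].
  have : (gcdn a q ^ 3 * gcdn b q ^ 3 * gcdn c q ^ 3 < q ^ 3)%N.
    rewrite (_ : q ^ 3 = q * q * q)%N; last by rewrite -mulnA.
    by rewrite !ltn_mul.
  by rewrite ltnNge -!expnMn leq_exp2r // gle.
apply: leq_trans (_ : (3 * (q * #|B|)) ^ 3 <= _)%N; first by rewrite leq_exp2r.
rewrite !expnMn cardB -mulnA leq_mul2l /=.
rewrite (_ : q ^ 5 = q ^ 3 * q ^ 2)%N; last by rewrite -expnD.
by rewrite mulnCA leq_mul2l card_near_zero_le ?orbT.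
Qed.

(** Multiplication by b sends this annihilator into that of k, which has at most |k| elements, and
    its fibres lie in translates of the annihilator of b. *)
Lemma card_ann_le q (k : int) (B : nat) (b : 'Z_q) : (1 < q)%N -> k != 0 ->
  (#|[set v : 'Z_q | (b * v == 0)%R]| <= B)%N ->
  (#|[set v : 'Z_q | (k%:~R * b * v == 0)%R]| <= `|k| * B)%N.
Proof.
move=> q_gt1 k_neq0 annb; pose W := [set w : 'Z_q | (k%:~R * w == 0)%R].
have k_gt0 : (0 < `|k|)%N by rewrite absz_gt0.
have cardW : (#|W| <= `|k|)%N.
  have lt_k (w : 'Z_q) : (`|k| * w %/ q < `|k|)%N.
    by rewrite ltn_divLR ?(ltnW q_gt1) // ltn_mul2l k_gt0 val_Zp_lt.
  rewrite -[leqRHS]card_ord.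
  pose f (w : 'Z_q) := Ordinal (lt_k w).
  have dvdW (w : 'Z_q) : w \in W -> (q %| `|k| * w)%N.
    rewrite inE => kw; have : ((k * (w : nat)%:Z)%:~R : 'Z_q) == 0.
      by rewrite intrM -pmulrn natr_Zp.
    by rewrite Zp_intr_eq0 // abszM.
  rewrite -(@card_in_imset _ _ f) ?max_card // => v w /dvdW dv /dvdW dw [e].
  apply/val_inj/eqP; rewrite /= -(eqn_pmul2l k_gt0) -(divnK dv) e divnK //.
rewrite -sum1_card (partition_big (fun v => b * v) (mem W)) /=; last first.
  by move=> v; rewrite !inE mulrA.
apply: leq_trans (_ : \sum_(w in W) B <= _)%N; last first.
  by rewrite sum_nat_const leq_mul2r cardW orbT.
apply: leq_sum => w _; rewrite sum1_card -cardsE.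
set X := [set _ in _]; have [->|[v0]] := set_0Vmem X; first by rewrite cards0.
rewrite inE unfold_in /= => /andP[_ /eqP bv0].
apply: leq_trans annb.
rewrite -(card_imset X (addIr (- v0))).
apply/subset_leq_card/fintype.subsetP => _ /imsetP[v + ->].
by rewrite !inE unfold_in /= => /andP[_ /eqP vE]; rewrite mulrBr vE bv0 subrr.
Qed.

Theorem kloo_Zp_le : exists C : nat, forall (K : numClosedFieldType) q (psi c : 'Z_q -> K)
    (g : nat) (m n : 'Z_q),
  (1 < q)%N ->
  (forall a b, psi (a + b) = psi a * psi b) ->
  (forall a, (psi a)^* = psi (- a)) ->
  (forall a, \sum_x psi (x * a) = if a == 0 then #|'Z_q|%:R else 0) ->
  (forall x, `|c x| <= 1) ->
  (forall u, u \is a GRing.unit -> exists2 k : K, `|k| = 1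
    & forall x, x \is a GRing.unit -> c (x * u) = k * c x) ->
  (#|[set v : 'Z_q | (n * v == 0)%R]| <= g)%N \/ (#|[set v : 'Z_q | (m * v == 0)%R]| <= g)%N ->
  q%:R * `|kloo psi c m n| ^+ 24 <= (C * g ^ 6 * totient q ^ 24)%:R.
Proof.
have [//|C0 tauC] := @tau_exp_le 30.
exists (27 ^ 2 * C0)%N => K q psi c g m n q_gt1 psiD psiJ psi_orth c_le1 c_tw ann.
have q_gt0 := ltnW q_gt1.
have le4 := kloo_le psiD psiJ psi_orth c_le1 c_tw ann.
set S := `|kloo psi c m n| in le4 *.
have S_ge0 : 0 <= S by exact: normr_ge0.
have le12 : S ^+ 12 <= (27 * g ^ 3 * tau q ^ 3 * q ^ 11)%:R.
  rewrite (_ : S ^+ 12 = (S ^+ 4) ^+ 3); last by rewrite -exprM.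
  apply: le_trans (_ : ((g * (#|'Z_q| ^ 2 * #|@zprod_set 'Z_q|)) ^ 3)%:R <= _).
    by rewrite natrX lerXn2r ?nnegrE ?exprn_ge0 ?ler0n.
  rewrite ler_nat card_Zp_type // !expnMn.
  apply: leq_trans (_ : g ^ 3 * (q ^ 3 * q ^ 3 * (27 * tau q ^ 3 * q ^ 5)) <= _)%N.
    by rewrite !leq_mul2l card_zprod_le ?orbT.
  by apply: eq_leq; ring.
have le12' : q%:R * S ^+ 12 <= (27 * g ^ 3 * tau q ^ 15 * totient q ^ 12)%:R.
  apply: le_trans (ler_wpM2l (ler0n _ _) le12) _.
  rewrite -natrM ler_nat.
  apply: leq_trans (_ : 27 * g ^ 3 * tau q ^ 3 * (tau q * totient q) ^ 12 <= _)%N.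
    rewrite mulnCA -expnS leq_mul2l; apply/orP; right.
    by rewrite leq_exp2r // tau_totient_ge.
  by apply: eq_leq; ring.
have le24 : q%:R * (q%:R * S ^+ 24) <= q%:R * (27 ^ 2 * C0 * g ^ 6 * totient q ^ 24)%:R.
  have -> : q%:R * (q%:R * S ^+ 24) = (q%:R * S ^+ 12) ^+ 2 by ring.
  apply: le_trans (_ : ((27 * g ^ 3 * tau q ^ 15 * totient q ^ 12) ^ 2)%:R <= _).
    by rewrite natrX lerXn2r ?nnegrE ?mulr_ge0 ?exprn_ge0 ?ler0n.
  rewrite -natrM ler_nat.
  apply: leq_trans (_ : 27 ^ 2 * g ^ 6 * tau q ^ 30 * totient q ^ 24 <= _)%N.
    by apply: eq_leq; ring.
  apply: leq_trans (_ : 27 ^ 2 * g ^ 6 * (C0 * q) * totient q ^ 24 <= _)%N.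
    by rewrite leq_mul2r leq_mul2l tauC ?orbT.
  by apply: eq_leq; ring.
by rewrite -(ler_pM2l (_ : 0 < q%:R)) // ltr0n.
Qed.

End KloostermanZp.

(** * Conjugation in cyclotomic fields *)

(** Cyclicity of the trace on the full-rank factorization A = C R, where idempotence gives R C =
    1. *)
Lemma mxtrace_idempotent (F : fieldType) n (A : 'M[F]_n) :
  A *m A = A -> \tr A = (\rank A)%:R.
Proof.
move=> AA; rewrite -[in LHS](mulmx_base A) mxtrace_mulC.
suff -> : row_base A *m col_base A = 1%:M by rewrite mxtrace1.
have [L LK] := row_fullP (col_base_full A).
have [U UK] := row_freeP (row_base_free A).
have := congr1 (mulmx L) (mulmx_base A); rewrite mulmxA LK mul1mx => RE.
have := congr1 (mulmx^~ U) (mulmx_base A); rewrite -mulmxA UK mulmx1 => CE.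
by rewrite RE CE mulmxA -(mulmxA L) AA -RE UK.
Qed.

Section Conjugation.

(** Irreducibility of the cyclotomic polynomial over [rat]. A nontrivial common factor has a root in
    [algC], which is a primitive n-th root of unity and so has minimal polynomial ['Phi_n]. *)
Lemma dvdp_Phi (n : nat) (r : {poly rat}) : (0 < n)%N ->
  ~~ (map_poly intr 'Phi_n %| r) -> coprimep (map_poly intr 'Phi_n : {poly rat}) r.
Proof.
move=> n_gt0 ndv; set Phi := map_poly _ _ in ndv *.
have PhiE (z : algC) : n.-primitive_root z -> forall q : {poly rat}, root (map_poly ratr q) z = (Phi %| q).
  move=> zP; have [p [pE _ pdvd]] := minCpolyP z.
  suff -> : Phi = p by [].
  apply: (@map_poly_inj rat algC ratr); rewrite -pE (minCpoly_cyclotomic zP).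
  rewrite -(Cintr_Cyclotomic zP) -map_poly_comp.
  by apply: eq_map_poly => x /=; rewrite rmorph_int.
have [z0 z0P] := C_prim_root_exists n_gt0.
rewrite /coprimep; apply/negPn/negP => g_neq1.
have g_neq0 : gcdp Phi r != 0.
  rewrite gcdp_eq0 negb_and; apply/orP; left.
  rewrite /Phi map_poly_eq0_id0 ?monic_neq0 ?Cyclotomic_monic //.
  by rewrite (monicP (Cyclotomic_monic n)) oner_eq0.
have : size (map_poly (ratr : rat -> algC) (gcdp Phi r)) != 1 by rewrite size_map_poly.
move=> /closed_rootP[z gz].
have zP : n.-primitive_root z.
  rewrite -(root_cyclotomic z0P) -(Cintr_Cyclotomic z0P).
  have -> : map_poly intr 'Phi_n = map_poly (ratr : rat -> algC) Phi.
    by rewrite -map_poly_comp; apply: eq_map_poly => x /=; rewrite rmorph_int.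
  have /dvdpP[s sE] := dvdp_gcdl Phi r.
  by rewrite [in root _ _]sE rmorphM /= rootM gz orbT.
case/negP: ndv; apply: dvdp_trans (dvdp_gcdr Phi r).
by rewrite -(PhiE z zP).
Qed.

Variable K : numFieldType.

(** Moves from [algC] to any [numFieldType]: z is a root of some ['Phi_d] with d | n, and then z^d =
    1 gives n | d. *)
Lemma root_Phi n (z : K) : (0 < n)%N -> n.-primitive_root z ->
  root (map_poly intr 'Phi_n) z.
Proof.
move=> n_gt0 zP; have := prod_Cyclotomic n_gt0.
move=> /(congr1 (fun p => (map_poly (intr : int -> K) p).[z])).
rewrite rmorph_prod /= rmorphB /= map_polyXn rmorph1 hornerD hornerN hornerXn hornerC.
rewrite (prim_expr_order zP) subrr horner_prod => /eqP.
rewrite prodf_seq_eq0 => /hasP[d]; rewrite -dvdn_divisors // => d_dv /= dz.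
have d_gt0 := dvdn_gt0 n_gt0 d_dv.
suff : (n %| d)%N.
  by move=> n_dv; have -> : n = d by apply/eqP; rewrite eqn_dvd n_dv.
rewrite (prim_order_dvd zP) -subr_eq0.
have := prod_Cyclotomic d_gt0.
move=> /(congr1 (fun p => (map_poly (intr : int -> K) p).[z])).
rewrite rmorph_prod /= rmorphB /= map_polyXn rmorph1 hornerD hornerN hornerXn hornerC.
move=> <-; rewrite horner_prod.
by rewrite prodf_seq_eq0; apply/hasP; exists d => //; rewrite -dvdn_divisors.
Qed.

(** Acts as the Galois automorphism z -> z^p: a rational polynomial vanishing at z is a multiple of
    ['Phi_n], of which z^p is a root too. *)
Lemma conj_root n (z : K) (r : {poly rat}) p : (0 < n)%N -> n.-primitive_root z ->
  coprime p n -> (map_poly ratr r).[z] = 0 -> (map_poly ratr r).[z ^+ p] = 0.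
Proof.
move=> n_gt0 zP co_pn rz.
have PhiK : map_poly (ratr : rat -> K) (map_poly intr 'Phi_n) = map_poly intr 'Phi_n.
  by rewrite -map_poly_comp; apply: eq_map_poly => x /=; rewrite rmorph_int.
have zpP : n.-primitive_root (z ^+ p) by rewrite prim_root_exp_coprime.
have [|/(dvdp_Phi n_gt0)] := boolP (map_poly intr 'Phi_n %| r).
  move=> /dvdpP[s ->]; rewrite rmorphM /= hornerM PhiK.
  by rewrite (rootP (root_Phi n_gt0 zpP)) mulr0.
move=> /Bezout_eq1_coprimepP[[u v]] /= /(congr1 (fun p => (map_poly (ratr : rat -> K) p).[z])).
rewrite rmorphD !rmorphM /= rmorph1 hornerD !hornerM PhiK rz.
by rewrite (rootP (root_Phi n_gt0 zP)) !mulr0 addr0 hornerC => /eqP; rewrite eq_sym oner_eq0.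
Qed.

(** Galois-fixed elements are rational. Modulo ['Phi_n] the polynomial r has degree below phi(n) and
    takes the value s at the phi(n) conjugates of z, so it is constant. *)
Lemma conj_invariant_rat n (z : K) (r : {poly rat}) (s : K) :
  (0 < n)%N -> n.-primitive_root z ->
  (forall p, coprime p n -> (map_poly ratr r).[z ^+ p] = s) -> exists t : rat, s = ratr t.
Proof.
move=> n_gt0 zP rs; set Phi := map_poly intr 'Phi_n : {poly rat}.
have PhiK : map_poly (ratr : rat -> K) Phi = map_poly intr 'Phi_n.
  by rewrite -map_poly_comp; apply: eq_map_poly => x /=; rewrite rmorph_int.
have size_Phi : size Phi = (totient n).+1.
  by rewrite size_map_poly_id0 ?size_Cyclotomic // (monicP (Cyclotomic_monic n)) oner_eq0.
have Phi_neq0 : Phi != 0 by rewrite -size_poly_gt0 size_Phi.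
set m := r %% Phi; exists m`_0.
set mK := map_poly (ratr : rat -> K) m.
have mKs p : coprime p n -> mK.[z ^+ p] = s.
  move=> co_pn; rewrite -(rs p co_pn) {1}(divp_eq r Phi) rmorphD rmorphM /= hornerD hornerM PhiK.
  by rewrite (rootP (root_Phi n_gt0 _)) ?mulr0 ?add0r // prim_root_exp_coprime.
have size_mK : (size (mK - s%:P)%R <= totient n)%N.
  have tot_gt0 : (0 < totient n)%N by rewrite totient_gt0.
  apply: leq_trans (size_polyD _ _) _; rewrite geq_max size_map_poly size_polyN.
  rewrite (leq_trans (size_polyC_leq1 _)) // andbT -ltnS -size_Phi.
  by rewrite ltn_modp.
have mK0 : mK - s%:P = 0.
  pose rs' := [seq z ^+ p | p <- iota 0 n & coprime p n].
  apply: (@roots_geq_poly_eq0 _ _ rs').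
  - apply/allP => _ /mapP[p + ->]; rewrite mem_filter => /andP[co_pn _].
    by rewrite /root hornerD hornerN hornerC mKs // subrr.
  - rewrite map_inj_in_uniq ?filter_uniq ?iota_uniq // => p p'.
    rewrite !mem_filter !mem_iota /= !add0n => /andP[_ lt_p] /andP[_ lt_p'] /eqP.
    by rewrite (eq_prim_root_expr zP) !modn_small // => /eqP.
  - rewrite size_map size_filter; apply: leq_trans size_mK _.
    rewrite totient_count_coprime -sum1_count [leqRHS]big_mkcond /= /index_iota subn0.
    by apply: leq_sum => p _; rewrite coprime_sym; case: coprime.
have : (mK - s%:P)`_0 = 0 by rewrite mK0 coef0.
by rewrite coefB coefC coef_map /= => /eqP; rewrite subr_eq0 => /eqP ->.
Qed.

End Conjugation.

Lemma sqrt_rat_square (q a b : nat) : (0 < a)%N -> (q * a ^ 2 = b ^ 2)%N -> is_square q.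
Proof.
move=> a_gt0 e; have q_dv : (a ^ 2 %| b ^ 2)%N by rewrite -e dvdn_mull.
have : (a %| b)%N by rewrite dvdn_pexp2r in q_dv.
case/dvdnP=> c cE; exists c; apply/eqP.
by rewrite -(@eqn_pmul2r (a ^ 2)) ?expn_gt0 ?a_gt0 // e cE expnMn.
Qed.

(** * Gauss sums *)

Section GaussSum.
Variable R : realType.
Local Notation C := R[i].
Local Notation chi := (@chi R).

Lemma g1E (p : int) q : g1 R p q = \sum_(h < q) chi q (p * h%:Z ^+ 2).
Proof. by rewrite /g1 /gsum; apply: eq_bigr => h _; rewrite mul1r expr2. Qed.

Lemma sum_delta q (f : int -> C) (a : int) : (0 < q)%N ->
  (forall b, f (b + q%:Z) = f b) ->
  \sum_(k < q) f k%:Z * (q %| k%:Z + a)%Z%:R = f (- a).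
Proof.
move=> q_gt0 fq.
have -> : \sum_(k < q) f k%:Z * (q %| k%:Z + a)%Z%:R =
          \sum_(k < q) f (k%:Z - a) * (q %| k%:Z)%Z%:R.
  rewrite -[RHS](@sum_shift _ q (fun k => f (k - a) * (q %| k)%Z%:R) a) //.
    by apply: eq_bigr => k _; rewrite addrK.
  by move=> b; rewrite addrAC fq; congr (_ * _%:R); rewrite rpredDr ?dvdzz.
rewrite (bigD1 (Ordinal q_gt0)) //= add0r dvdz0 mulr1 big1 ?addr0 // => k k_neq0.
suff -> : (q %| k%:Z)%Z = false by rewrite mulr0.
apply/negP => /= dv; case/negP: k_neq0; rewrite -val_eqE /=.
by move: (ltn_ord k); rewrite ltnNge; apply: contraNT; rewrite -lt0n => /dvdn_leq; apply.
Qed.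

(** The trace of the squared normalised Fourier matrix, which is the permutation matrix of j -> -j:
    1 for odd q, 2 for even q. *)
Definition ndbl q := (\sum_(j < q) (q %| 2 * j))%N.

Lemma g1_sqr_norm (p q : nat) : (0 < q)%N -> coprime p q ->
  g1 R p q * (g1 R p q)^* = q%:R * \sum_(h < q | (q %| 2 * h)%N) chi q (p%:Z * h%:Z ^+ 2).
Proof.
move=> q_gt0 co_pq; rewrite g1E rmorph_sum /= mulr_sumr.
(* Shifting h by k in the first factor cancels the terms in k^2; k then occurs linearly, and its sum
   is a delta. *)
transitivity (\sum_(k < q) \sum_(h < q) chi q (p%:Z * h%:Z ^+ 2) * chi q (k%:Z * (2 * p%:Z * h%:Z))).
  apply: eq_bigr => k _; rewrite -(sum_chi_shift R p k q_gt0) mulr_suml.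
  by apply: eq_bigr => h _; rewrite chi_conj -!chiD; congr chi; ring.
rewrite exchange_big mulr_sumr [RHS]big_mkcond /=; apply: eq_bigr => h _.
rewrite -mulr_sumr sum_chi //.
have -> : (q %| 2 * p%:Z * h%:Z)%Z = (q %| 2 * h)%N.
  by rewrite -!PoszM -mulnA mulnCA dvdzE /= Gauss_dvdr // coprime_sym.
by case: ifP; rewrite ?mulr0 // mulrC.
Qed.

(** A quarter of the sum is the projection onto the vectors fixed by X, and its trace is its
    rank. *)
Lemma mxtrace_period4 n (X : 'M[C]_n) : X *m X *m X *m X = 1%:M ->
  exists a : nat, \tr (1%:M + X + X *m X + X *m X *m X) = (4 * a)%:R.
Proof.
move=> X4; pose S := 1%:M + X + X *m X + X *m X *m X.
have XS : X *m S = S.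
  rewrite /S !mulmxDr mulmx1 !mulmxA X4 addrC !addrA //.
pose P := 4%:R^-1 *: S.
have PP : P *m P = P.
  rewrite /P -scalemxAl -scalemxAr scalerA.
  have -> : S *m S = 4%:R *: S.
    by rewrite {1}/S !mulmxDl mul1mx -!mulmxA !XS scaler_nat !mulrS mulr0n addr0 !addrA.
  by rewrite scalerA -mulrA mulVf ?mulr1 // pnatr_eq0.
exists (\rank P); rewrite natrM -mxtrace_idempotent // /P linearZ /=.
by rewrite mulrA divff ?mul1r // pnatr_eq0.
Qed.

Definition wsum (p q : nat) : C := g1 R p q / csqrt R q.

Lemma csqrt_sqr q : csqrt R q * csqrt R q = q%:R.
Proof.
by rewrite /csqrt -rmorphM /= -expr2 sqr_sqrtr ?ler0n // rmorph_nat.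
Qed.

Lemma csqrt_neq0 q : (0 < q)%N -> csqrt R q != 0.
Proof. by move=> q_gt0; rewrite -sqrf_eq0 expr2 csqrt_sqr pnatr_eq0 -lt0n. Qed.

Lemma csqrt_conj q : (csqrt R q)^* = csqrt R q.
Proof. exact: conjc_real. Qed.

(* Schur: the normalised Fourier matrix [A] satisfies [A^4 = 1], so
   [(1 + e A + e^2 A^2 + e^3 A^3) / 4] is idempotent and its trace is a natural number. *)
Lemma wsum_trace (p q : nat) (e : C) : (0 < q)%N -> coprime p q -> e ^+ 4 = 1 ->
  exists a : nat,
    q%:R + e * wsum p q + e ^+ 2 * (ndbl q)%:R + e ^+ 3 * (wsum p q)^* = (4 * a)%:R.
Proof.
move=> q_gt0 co_pq e4; set s := csqrt R q.
have s_neq0 : s != 0 by apply: csqrt_neq0.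
have ss : s * s = q%:R by apply: csqrt_sqr.
pose A : 'M[C]_q := \matrix_(j, k) (chi q (p%:Z * j%:Z * k%:Z) / s).
(* [B] is A^2, the reflection j -> -j; [A'] is A^3, whose entries are the conjugates of those of
   [A]. *)
pose B : 'M[C]_q := \matrix_(j, k) (q %| k%:Z + j%:Z)%Z%:R.
pose A' : 'M[C]_q := \matrix_(j, k) (chi q (- (p%:Z * j%:Z * k%:Z)) / s).
have AA : A *m A = B.
  apply/matrixP => j l; rewrite !mxE.
  under eq_bigr => k _.
    rewrite !mxE mulrACA -chiD -invfM ss
      (_ : p%:Z * j%:Z * k%:Z + p%:Z * k%:Z * l%:Z = k%:Z * (p%:Z * (l%:Z + j%:Z))); first over.
    by ring.
  rewrite -mulr_suml sum_chi //.
  have -> : (q %| p%:Z * (l%:Z + j%:Z))%Z = (q %| l%:Z + j%:Z)%Z.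
    by rewrite Gauss_dvdzr // coprimezE /= coprime_sym.
  by case: ifP; rewrite ?mul0r // divff // pnatr_eq0 -lt0n.
have AB : A *m B = A'.
  apply/matrixP => j l; rewrite !mxE.
  under eq_bigr => k _ do rewrite !mxE addrC.
  rewrite (@sum_delta q (fun k => chi q (p%:Z * j%:Z * k) / s)) //.
    by rewrite mulrN.
  by move=> b; rewrite mulrDr chiD [_ * q%:Z]mulrC chi_mull ?mulr1.
have BB : B *m B = 1%:M.
  apply/matrixP => j l; rewrite !mxE.
  under eq_bigr => k _ do rewrite !mxE [l%:Z + _]addrC.
  rewrite (@sum_delta q (fun k => (q %| k + j%:Z)%Z%:R)) //; last first.
    by move=> b; rewrite addrAC rpredDr ?dvdzz.
  suff -> : (q %| - l%:Z + j%:Z)%Z = (j == l) by [].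
  apply/idP/eqP => [dv|->]; last by rewrite addNr dvdz0.
  have : (j%:Z == l%:Z %[mod q])%Z by rewrite eqz_mod_dvd addrC.
  by rewrite !modz_small ?ltz_nat ?ltn_ord // => /eqP[]; exact: val_inj.
have X4 : (e *: A) *m (e *: A) *m (e *: A) *m (e *: A) = 1%:M.
  rewrite -!scalemxAl -!scalemxAr -!scalemxAl !scalerA AA -mulmxA AA BB.
  by rewrite -[RHS]scale1r -e4; congr (_ *: _); ring.
have [a aE] := mxtrace_period4 X4; exists a; rewrite -aE.
rewrite !mxtraceD mxtrace1; congr (_ + _ + _ + _).
- rewrite linearZ /=; congr (_ * _); rewrite /wsum g1E mulr_suml; apply: eq_bigr => j _.
  by rewrite mxE expr2 mulrA.
- rewrite -scalemxAl -scalemxAr AA !linearZ /= mulrA; congr (_ * _).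
  rewrite /ndbl natr_sum; apply: eq_bigr => j _; rewrite mxE /dvdz /=.
  by rewrite mul2n -addnn.
- rewrite -!scalemxAl -!scalemxAr -!scalemxAl -mulmxA AA AB !linearZ /= !mulrA.
  congr (_ * _); first by ring.
  rewrite /wsum g1E rmorphM rmorph_sum /= mulr_suml; apply: eq_bigr => j _.
  by rewrite mxE fmorphV -[X in _ / X = _]/((csqrt R q)^*) csqrt_conj chi_conj expr2 mulrA.
Qed.

End GaussSum.

(** * Real and imaginary parts; Gaussian integers of norm 1 and 2 *)

Section ComplexParts.
Variable R : rcfType.
Implicit Types z w : R[i].

Lemma reD z w : complex.Re (z + w) = complex.Re z + complex.Re w.
Proof. by case: z; case: w. Qed.
Lemma imD z w : complex.Im (z + w) = complex.Im z + complex.Im w.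
Proof. by case: z; case: w. Qed.
Lemma reN z : complex.Re (- z) = - complex.Re z.
Proof. by case: z. Qed.
Lemma imN z : complex.Im (- z) = - complex.Im z.
Proof. by case: z. Qed.
Lemma reM z w : complex.Re (z * w) =
  complex.Re z * complex.Re w - complex.Im z * complex.Im w.
Proof. by case: z; case: w. Qed.
Lemma imM z w : complex.Im (z * w) =
  complex.Re z * complex.Im w + complex.Im z * complex.Re w.
Proof. by case: z; case: w. Qed.
Lemma re_nat n : complex.Re (n%:R : R[i]) = n%:R.
Proof. by rewrite -(rmorph_nat (real_complex R)). Qed.
Lemma re_sum I (r : seq I) P (F : I -> R[i]) :
  complex.Re (\sum_(i <- r | P i) F i) = \sum_(i <- r | P i) complex.Re (F i).
Proof. by elim/big_rec2: _ => // i x y _ <-; rewrite reD. Qed.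
Lemma im_sum I (r : seq I) P (F : I -> R[i]) :
  complex.Im (\sum_(i <- r | P i) F i) = \sum_(i <- r | P i) complex.Im (F i).
Proof. by elim/big_rec2: _ => // i x y _ <-; rewrite imD. Qed.

Lemma complex_eqP z w : complex.Re z = complex.Re w -> complex.Im z = complex.Im w -> z = w.
Proof. by case: z; case: w => ? ? ? ? /= -> ->. Qed.

Lemma mulJ_parts z : z * z^* = (complex.Re z ^+ 2 + complex.Im z ^+ 2)%:C%C.
Proof. by rewrite add_Re2_Im2 normCK. Qed.

End ComplexParts.

(** Parity tells the Gaussian units 1, -1 from i, -i. *)
Lemma int_sqr_sum1 (a b : int) : a ^+ 2 + b ^+ 2 = 1 -> odd `|a| -> a ^+ 2 = 1 /\ b = 0.
Proof.
rewrite !expr2 => e oa; have a1 : -1 <= a <= 1 by nia.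
have [->|[->|a0]] : a = 1 \/ a = -1 \/ a = 0 by lia.
- by split; nia.
- by split; nia.
- by rewrite a0 in oa.
Qed.
Lemma int_sqr_sum2 (a b : int) : a ^+ 2 + b ^+ 2 = 2 -> a ^+ 2 = 1 /\ b ^+ 2 = 1.
Proof.
rewrite !expr2 => e; have a1 : -1 <= a <= 1 by nia.
have b1 : -1 <= b <= 1 by nia.
have : a = 1 \/ a = -1 \/ a = 0 by lia.
have : b = 1 \/ b = -1 \/ b = 0 by lia.
by move=> [bE|[bE|bE]] [aE|[aE|aE]]; rewrite aE bE in e *.
Qed.

(** * Values of the normalised Gauss sum *)

Section GaussValues.
Variable R : realType.
Local Notation C := R[i].
Local Notation chi := (@chi R).
Local Notation wsum := (wsum R).
Local Notation re := (@complex.Re R).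
Local Notation im := (@complex.Im R).

Lemma sum_dbl_odd (V : nmodType) q (F : nat -> V) : odd q ->
  \sum_(h < q | (q %| 2 * h)%N) F h = F 0%N.
Proof.
move=> q_odd; have q_gt0 : (0 < q)%N by case: q q_odd.
rewrite (bigD1 (Ordinal q_gt0)) /= ?muln0 ?dvdn0 // big1 ?addr0 // => h /andP[].
rewrite Gauss_dvdr ?coprimen2 // => /dvdn_leq dv; rewrite -val_eqE /= -lt0n => h_gt0.
by move: (dv h_gt0); rewrite leqNgt ltn_ord.
Qed.

Lemma sum_dbl_even (V : nmodType) k (F : nat -> V) : (0 < k)%N ->
  \sum_(h < 2 * k | (2 * k %| 2 * h)%N) F h = F 0%N + F k.
Proof.
move=> k_gt0; have q_gt0 : (0 < 2 * k)%N by rewrite muln_gt0.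
have k_lt : (k < 2 * k)%N by rewrite -{1}[k]mul1n ltn_pmul2r.
rewrite (bigD1 (Ordinal q_gt0)) /= ?muln0 ?dvdn0 // (bigD1 (Ordinal k_lt)) /=; last first.
  by rewrite dvdnn -val_eqE /= -lt0n.
rewrite big1 ?addr0 // => h /andP[/andP[]]; rewrite dvdn_pmul2l // => /dvdnP[c cE].
rewrite -!val_eqE /= => h0 hk; have := ltn_ord h; rewrite cE ltn_pmul2r // => c2.
by case: c c2 cE => [|[|//]] _ cE; move: h0 hk; rewrite cE ?mul1n ?eqxx.
Qed.

Lemma ndblE q : ndbl q = (\sum_(j < q | q %| 2 * j) 1)%N.
Proof. by rewrite [RHS]big_mkcond; apply: eq_bigr => j _; case: (_ %| _)%N. Qed.

(** The trace identity isolates w + w^* for e = 1 and w - w^* for e = i, so both parts are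
    half-integers whose class modulo 2 depends on q only. *)
Lemma wsum_parts (p q : nat) : (0 < q)%N -> coprime p q ->
  exists a b : int, 2 * re (wsum p q) = (4 * a - q%:Z - (ndbl q)%:Z)%:~R /\
                    2 * im (wsum p q) = (q%:Z - (ndbl q)%:Z - 4 * b)%:~R.
Proof.
move=> q_gt0 co_pq.
have [a aE] := @wsum_trace R p q 1 q_gt0 co_pq (expr1n _ 4).
have i4 : ('i%C : C) ^+ 4 = 1 by rewrite -[4%N]/(2 * 2)%N exprM sqr_i sqrrN expr1n.
have [b bE] := wsum_trace q_gt0 co_pq i4.
exists a%:Z, b%:Z; split.
  move/(congr1 re): aE; rewrite !expr1n !mul1r !reD !re_nat.
  have -> : re (wsum p q)^* = re (wsum p q) by case: (wsum p q).
  rewrite natrM !rmorphB rmorphM /= => e; rewrite -!pmulrn; lra.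
have i3 : ('i%C : C) ^+ 3 = - 'i%C by rewrite exprS sqr_i mulrN1.
move/(congr1 re): bE; rewrite i3 sqr_i mulN1r mulNr !reD !re_nat.
have -> : re (- (ndbl q)%:R) = - (ndbl q)%:R by rewrite -(rmorph_nat (real_complex R)).
case: (wsum p q) => x y /=.
rewrite natrM !rmorphB rmorphM /= => e; rewrite -!pmulrn; lra.
Qed.

Lemma wsum_norm (p q : nat) : (0 < q)%N -> coprime p q ->
  wsum p q * (wsum p q)^* = \sum_(h < q | (q %| 2 * h)%N) chi q (p%:Z * h%:Z ^+ 2).
Proof.
move=> q_gt0 co_pq; have -> : (wsum p q)^* = (g1 R p q)^* / csqrt R q.
  by rewrite rmorphM /= fmorphV -[X in _ / X = _]/((csqrt R q)^*) csqrt_conj.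
rewrite /wsum.
rewrite mulrACA -invfM csqrt_sqr g1_sqr_norm // mulrAC divff ?mul1r //.
by rewrite pnatr_eq0 -lt0n.
Qed.

(** A Gaussian integer of norm 1 whose real part is odd exactly for q = 1 modulo 4: this decides
    between +-1 and +-i, while the sign s stays unknown. *)
Lemma wsum_odd (p q : nat) : odd q -> coprime p q ->
  exists2 s : R, s ^+ 2 = 1 & wsum p q = epsq R q * s%:C%C.
Proof.
move=> q_odd co_pq; have q_gt0 : (0 < q)%N by case: q q_odd {co_pq}.
have [a [b]] := wsum_parts q_gt0 co_pq; rewrite ndblE (sum_dbl_odd (fun=> 1%N)) // => -[reE imE].
have := wsum_norm q_gt0 co_pq.
rewrite (sum_dbl_odd (fun h => chi q (p%:Z * h%:Z ^+ 2))) // expr0n mulr0 chi0 mulJ_parts.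
move=> /(congr1 re) /= n1.
pose k := q./2; have qE : q = (k.*2).+1 by rewrite -(odd_double_half q) q_odd.
pose x := 2 * a - k%:Z - 1; pose y := k%:Z - 2 * b.
have xE : re (wsum p q) = x%:~R.
  apply: (@mulfI R 2); first by rewrite pnatr_eq0.
  rewrite reE -[2]/(2%:~R) -intrM; congr _%:~R; rewrite /x qE -mul2n; lia.
have yE : im (wsum p q) = y%:~R.
  apply: (@mulfI R 2); first by rewrite pnatr_eq0.
  rewrite imE -[2]/(2%:~R) -intrM; congr _%:~R; rewrite /y qE -mul2n; lia.
have xy : x ^+ 2 + y ^+ 2 = 1.
  by apply/eqP; rewrite -(eqr_int R) rmorphD !rmorphXn /= -xE -yE n1.
have q4 : (q %% 4 == 1)%N = ~~ odd k.
  by rewrite qE; lia.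
rewrite /epsq q4; case: (boolP (odd k)) => /= k_odd.
  have [y1 x0] : y ^+ 2 = 1 /\ x = 0.
    apply: int_sqr_sum1; first by rewrite addrC.
    by rewrite /y; lia.
  exists y%:~R; first by rewrite -rmorphXn /= y1.
  by apply: complex_eqP; rewrite ?xE ?yE ?reM ?imM /= ?x0; lra.
have [x1 y0] : x ^+ 2 = 1 /\ y = 0.
  by apply: int_sqr_sum1 => //; rewrite /x; lia.
exists x%:~R; first by rewrite -rmorphXn /= x1.
by apply: complex_eqP; rewrite ?xE ?yE ?reM ?imM /= ?y0; lra.
Qed.

(** Exhibits i as a power of the root of unity [chi q 1], so that conjugation acts on it as well. *)
Lemma chi_quarter q : (0 < q)%N -> (4 %| q)%N -> chi q 1 ^+ (q %/ 4) = 'i%C.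
Proof.
move=> q_gt0 /dvdnP[k qE]; have k_gt0 : (0 < k)%N by case: (k) q_gt0 qE => // /[swap] ->.
rewrite -chi_nat qE mulnK // -[k%:Z]mul1r mulnC chi_scale //.
rewrite /chi /ee; have -> : 2 * pi * (1%:~R / 4%:R) = pi / 2 :> R by lra.
by rewrite cos_pihalf sin_pihalf.
Qed.

Lemma wsum_four (p q : nat) : (0 < q)%N -> (4 %| q)%N -> coprime p q ->
  re (wsum p q) ^+ 2 = 1 /\ im (wsum p q) ^+ 2 = 1.
Proof.
move=> q_gt0 q4 co_pq; have [k qE] := dvdnP q4.
have k_gt0 : (0 < k)%N by case: (k) q_gt0 qE => // /[swap] ->.
have qE2 : q = (2 * (2 * k))%N by rewrite qE mulnC mulnA.
have k2_gt0 : (0 < 2 * k)%N by rewrite muln_gt0.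
have [a [b]] := wsum_parts q_gt0 co_pq.
have -> : ndbl q = 2%N by rewrite ndblE qE2 (sum_dbl_even (fun=> 1%N)).
move=> [reE imE].
have := wsum_norm q_gt0 co_pq.
have -> : \sum_(h < q | (q %| 2 * h)%N) chi q (p%:Z * h%:Z ^+ 2) = 2%:R.
  have := sum_dbl_even (fun h => chi q (p%:Z * h%:Z ^+ 2)) k2_gt0.
  (* The second solution of 2h = 0 is h = q/2, whose square is a multiple of q because 4 divides
     q. *)
  rewrite -qE2 => ->; rewrite expr0n mulr0 chi0 (@chi_dvd _ q) //.
  by apply/dvdzP; exists (p%:Z * k%:Z); rewrite qE2; lia.
rewrite mulJ_parts => /(congr1 re); rewrite re_nat /= => n2.
pose x := 2 * a - 2 * k%:Z - 1; pose y := 2 * k%:Z - 1 - 2 * b.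
have xE : re (wsum p q) = x%:~R.
  apply: (@mulfI R 2); first by rewrite pnatr_eq0.
  rewrite reE -[2]/(2%:~R) -intrM; congr _%:~R; rewrite /x qE2; lia.
have yE : im (wsum p q) = y%:~R.
  apply: (@mulfI R 2); first by rewrite pnatr_eq0.
  rewrite imE -[2]/(2%:~R) -intrM; congr _%:~R; rewrite /y qE2; lia.
have xy : x ^+ 2 + y ^+ 2 = 2.
  by apply/eqP; rewrite -(eqr_int R) rmorphD !rmorphXn /= -xE -yE n2.
have [x1 y1] := int_sqr_sum2 xy.
by rewrite xE yE -!rmorphXn /= x1 y1.
Qed.

End GaussValues.

(** * Gauss sums as quadratic characters of p *)

Section GaussCharacters.
Variable R : realType.
Local Notation C := R[i].
Local Notation chi := (@chi R).
Local Notation wsum := (@wsum R).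
Local Notation re := (@complex.Re R).
Local Notation im := (@complex.Im R).

Lemma g1_mod (p p' q : nat) : (0 < q)%N -> p = p' %[mod q] -> g1 R p q = g1 R p' q.
Proof.
move=> q_gt0 pp'; rewrite !g1E; apply: eq_bigr => h _; apply: chi_eqmod => //.
rewrite -mulrBl dvdz_mulr // -eqz_mod_dvd; apply/eqP.
by rewrite !modz_nat pp'.
Qed.

(** The Gauss sum as a rational polynomial in [chi q 1]; passing to the conjugate [chi q 1 ^+ u]
    replaces p by p u. *)
Definition gpoly (p q : nat) : {poly rat} := \sum_(h < q) 'X^(p * h ^ 2).

Lemma gpoly_eval (p q u : nat) :
  (map_poly ratr (gpoly p q)).[chi q 1 ^+ u] = g1 R (p * u)%N q.
Proof.
rewrite /gpoly rmorph_sum /= horner_sum g1E; apply: eq_bigr => h _.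
rewrite map_polyXn hornerXn -!exprM -chi_nat; congr chi.
by rewrite -mulnn !PoszM; ring.
Qed.

Lemma g1_conj (p q k u : nat) (s : rat) : (0 < q)%N -> coprime u q ->
  g1 R p q = ratr s * chi q 1 ^+ k * g1 R 1%N q ->
  g1 R (p * u)%N q = ratr s * chi q 1 ^+ (k * u) * g1 R u q.
Proof.
move=> q_gt0 co_uq pE.
have := @conj_root R[i] q (chi q 1) (gpoly p q - s *: ('X^k * gpoly 1 q)) u q_gt0
  (chi_prim R q_gt0) co_uq.
rewrite rmorphB /= linearZ /= rmorphM /= map_polyXn !(hornerD, hornerN, hornerZ, hornerM, hornerXn).
have := gpoly_eval p q 1; have := gpoly_eval 1 q 1; rewrite !expr1 !muln1 => -> ->.
rewrite !gpoly_eval mul1n -exprM [(u * k)%N]mulnC => /(_ _)/eqP.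
by rewrite !mulrA pE subrr => /(_ erefl); rewrite subr_eq0 => /eqP.
Qed.

Lemma g1_conj_sqr (q k u : nat) (s : rat) : (0 < q)%N -> coprime u q ->
  g1 R 1%N q ^+ 2 = ratr s * chi q 1 ^+ k ->
  g1 R u q ^+ 2 = ratr s * chi q 1 ^+ (k * u).
Proof.
move=> q_gt0 co_uq pE.
have := @conj_root R[i] q (chi q 1) (gpoly 1 q ^+ 2 - s *: 'X^k) u q_gt0
  (chi_prim R q_gt0) co_uq.
rewrite rmorphB /= linearZ /= rmorphXn /= map_polyXn !(hornerD, hornerN, hornerZ, horner_exp, hornerXn).
have := gpoly_eval 1 q 1; rewrite expr1 muln1 => ->.
rewrite gpoly_eval mul1n -exprM [(u * k)%N]mulnC pE subrr => /(_ erefl)/eqP.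
by rewrite subr_eq0 => /eqP.
Qed.

(** A real character modulo q up to a global sign; the freedom of sign spares the value at p = 1,
    that is, the sign of the Gauss sum. *)
Definition twisted (q : nat) (c : nat -> R) : Prop :=
  [/\ forall p, c (p %% q)%N = c p,
      forall p, coprime p q -> c p ^+ 2 = 1
    & forall u, coprime u q -> exists2 k : R, k ^+ 2 = 1
      & forall p, coprime p q -> c (p * u)%N = k * c p].

Lemma wsum_mod (p q : nat) : (0 < q)%N -> wsum (p %% q)%N q = wsum p q.
Proof. by move=> q_gt0; rewrite /wsum (@g1_mod _ p) ?modn_mod. Qed.

Lemma wsum_conj (p q k u : nat) (s : rat) : (0 < q)%N -> coprime u q ->
  wsum p q = ratr s * chi q 1 ^+ k * wsum 1%N q ->
  wsum (p * u)%N q = ratr s * chi q 1 ^+ (k * u) * wsum u q.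
Proof.
move=> q_gt0 co_uq; have q0 := csqrt_neq0 R q_gt0.
move=> /(congr1 (fun z => z * csqrt R q)); rewrite /wsum mulrA !divfK // => pE.
by rewrite (g1_conj q_gt0 co_uq pE) mulrA.
Qed.

Lemma sqr1_cases (x : R) : x ^+ 2 = 1 -> x = 1 \/ x = -1.
Proof. by move=> /eqP; rewrite sqrf_eq1 => /orP[] /eqP ->; [left|right]. Qed.

(** For odd q and p coprime to q this is the Jacobi symbol (p/q). *)
Definition jac q p : R := re (wsum p q / epsq R q).

Lemma epsq_neq0 q : epsq R q != 0.
Proof. by rewrite /epsq; case: ifP; rewrite ?oner_eq0 // eq_complex /= oner_eq0 andbF. Qed.

Lemma jacE p q : odd q -> coprime p q -> wsum p q = epsq R q * (jac q p)%:C%C.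
Proof.
move=> q_odd co_pq; have [s s1 wE] := wsum_odd R q_odd co_pq.
by rewrite /jac {2}wE mulrAC divff ?mul1r ?epsq_neq0 ?wE.
Qed.

Lemma jac_sqr p q : odd q -> coprime p q -> jac q p ^+ 2 = 1.
Proof.
move=> q_odd co_pq; have [s s1 wE] := wsum_odd R q_odd co_pq.
by rewrite /jac wE mulrAC divff ?mul1r ?epsq_neq0.
Qed.

(** [wsum p] and [wsum 1] differ by a sign, which is rational and therefore fixed by conjugation;
    conjugating by u gives the same ratio between [wsum (p * u)] and [wsum u]. *)
Lemma jacM p q : odd q -> coprime p q -> exists2 k : R, k ^+ 2 = 1
  & forall u, coprime u q -> jac q (p * u)%N = k * jac q u.
Proof.
move=> q_odd co_pq; have q_gt0 : (0 < q)%N by case: q q_odd {co_pq}.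
have co1 : coprime 1 q by rewrite coprime1n.
have [s sE] : exists s : rat, (ratr s : R) ^+ 2 = 1 /\ jac q p = ratr s * jac q 1%N.
  case: (sqr1_cases (jac_sqr q_odd co_pq)) => ->;
    case: (sqr1_cases (jac_sqr q_odd co1)) => ->.
  - by exists 1; rewrite rmorph1 expr1n mulr1.
  - by exists (-1); rewrite rmorphN rmorph1 sqrrN expr1n mulrNN mulr1.
  - by exists (-1); rewrite rmorphN rmorph1 sqrrN expr1n mulr1.
  - by exists 1; rewrite rmorph1 expr1n mul1r.
exists (ratr s); first by case: sE.
move=> u co_uq.
have := @wsum_conj p q 0 u s q_gt0 co_uq.
rewrite !expr0 mulr1 !jacE ?coprimeMl ?co_pq // (sE.2).
have -> : (ratr s : C) = (ratr s : R)%:C%C by rewrite (fmorph_rat (real_complex R)).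
have reK x : re (epsq R q * x%:C%C / epsq R q) = x by rewrite mulrAC divff ?mul1r ?epsq_neq0.
rewrite mulrCA -rmorphM => /(_ erefl)/(congr1 (fun z => re (z / epsq R q))).
by rewrite [X in _ = re (X / _)]mulrCA -rmorphM !reK.
Qed.

Lemma twisted_jac q : odd q -> twisted q (jac q).
Proof.
move=> q_odd; have q_gt0 : (0 < q)%N by case: q q_odd.
split=> [p|p|u co_uq]; first by rewrite /jac wsum_mod.
  exact: jac_sqr.
have [k k1 kE] := jacM q_odd co_uq; exists k => // p co_pq.
by rewrite mulnC kE.
Qed.

End GaussCharacters.

(** * Moduli divisible by four *)

Section GaussFour.
Variable R : realType.
Local Notation C := R[i].
Local Notation chi := (@chi R).
Local Notation wsum := (@wsum R).
Local Notation re := (@complex.Re R).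
Local Notation im := (@complex.Im R).
Local Notation iC := (Complex 0 1 : C).

(** On odd u, the nontrivial character modulo 4. *)
Definition chi4 (u : nat) : R := (-1) ^+ u./2.

Lemma chi4_sqr u : chi4 u ^+ 2 = 1. Proof. exact: sqrr_sign. Qed.

Lemma i_odd u : odd u -> iC ^+ u = Complex 0 (chi4 u).
Proof.
move=> u_odd; have -> : Complex 0 (chi4 u) = ((-1) ^+ u./2)%:C%C * iC.
  by apply: complex_eqP; rewrite ?reM ?imM /chi4 /=; lra.
rewrite -{1}(odd_double_half u) u_odd exprD expr1 -mul2n exprM sqr_i mulrC; congr (_ * _).
by rewrite -[in RHS]signr_odd -[in LHS]signr_odd; case: odd; rewrite ?expr0 ?expr1 ?rmorphN ?rmorph1.
Qed.

Lemma i_cases (x1 y1 x y : R) : x1 ^+ 2 = 1 -> y1 ^+ 2 = 1 -> x ^+ 2 = 1 -> y ^+ 2 = 1 ->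
  exists2 k : nat, (k < 4)%N & Complex x y = iC ^+ k * Complex x1 y1.
Proof.
have i3 : iC ^+ 3 = - iC by rewrite exprS sqr_i mulrN1.
have kE (k : nat) : (k < 4)%N -> Complex x y = iC ^+ k * Complex x1 y1 ->
  exists2 k : nat, (k < 4)%N & Complex x y = iC ^+ k * Complex x1 y1 by exists k.
by move=> /sqr1_cases[]x1E /sqr1_cases[]y1E /sqr1_cases[]xE /sqr1_cases[]yE;
  first [apply: (kE 0%N) => //; apply: complex_eqP; rewrite ?expr0 ?reM ?imM /= ?x1E ?y1E; lra
        | apply: (kE 1%N) => //; apply: complex_eqP; rewrite ?expr1 ?reM ?imM /= ?x1E ?y1E; lra
        | apply: (kE 2%N) => //; apply: complex_eqP; rewrite ?sqr_i ?reM ?imM /= ?x1E ?y1E; lra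
        | apply: (kE 3%N) => //; apply: complex_eqP; rewrite ?i3 ?reM ?imM /= ?x1E ?y1E; lra].
Qed.

Variable q : nat.
Hypotheses (q_gt0 : (0 < q)%N) (q4 : (4 %| q)%N).

Lemma odd_coprime4 u : coprime u q -> odd u.
Proof.
have [k ->] := dvdnP q4; rewrite coprimeMr => /andP[_].
by have := @coprime_pexpr 2 u 2 isT; rewrite coprimen2 => <-.
Qed.

Lemma wsum_conj4 p k u : coprime u q ->
  wsum p q = iC ^+ k * wsum 1%N q -> wsum (p * u)%N q = iC ^+ (k * u) * wsum u q.
Proof.
move=> co_uq; have := @wsum_conj R p q (q %/ 4 * k) u 1 q_gt0 co_uq.
by rewrite rmorph1 !mul1r -mulnA !(exprM _ (q %/ 4)) chi_quarter // => H /H.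
Qed.

(** Both parts of w being +-1, w^2 is 2 i Re w Im w, so the squared Gauss sum is a rational multiple
    of i; conjugating by u replaces i by i^u = i chi4(u). *)
Lemma reim_prod : exists2 s : R, s ^+ 2 = 1
  & forall u, coprime u q -> re (wsum u q) * im (wsum u q) = s * chi4 u.
Proof.
have co1 : coprime 1 q by rewrite coprime1n.
have [x1 y1] := wsum_four R q_gt0 q4 co1.
pose s := re (wsum 1%N q) * im (wsum 1%N q).
have s1 : s ^+ 2 = 1 by rewrite exprMn x1 y1 mulr1.
exists s => // u co_uq.
have [t tE] : exists t : rat, ratr t = s.
  by case: (sqr1_cases s1) => ->; [exists 1|exists (-1)]; rewrite ?rmorphN rmorph1.
have sqrE p : coprime p q -> g1 R p q ^+ 2 = q%:R * (2 * (re (wsum p q) * im (wsum p q)))%:C%C * iC.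
  move=> co_pq; have [xp yp] := wsum_four R q_gt0 q4 co_pq.
  rewrite -csqrt_sqr; have -> : g1 R p q = csqrt R q * wsum p q.
    by rewrite /wsum mulrC divfK // csqrt_neq0.
  rewrite exprMn expr2 -!mulrA; congr (_ * (_ * _)).
  move: xp yp; case: (wsum p q) => x y /= xp yp.
  by apply: complex_eqP; rewrite expr2 ?reM ?imM /= ?reM ?imM /= -?expr2 ?xp ?yp; lra.
have := @g1_conj_sqr R q (q %/ 4) u (q%:R * (2 * t)) q_gt0 co_uq.
have ratrE : (ratr (q%:R * (2 * t)) : C) = q%:R * (2 * s)%:C%C.
  rewrite -tE rmorphM rmorph_nat rmorphM rmorph_nat [in RHS]rmorphM /= rmorph_nat.
  by rewrite (fmorph_rat (real_complex R)).
rewrite ratrE exprM chi_quarter // !sqrE // => /(_ erefl).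
rewrite i_odd ?(odd_coprime4 co_uq) // -!mulrA => /mulfI.
rewrite pnatr_eq0 -lt0n => /(_ q_gt0) /(congr1 im).
have imE (a b : R) : im (a%:C%C * Complex 0 b) = a * b by rewrite imM /= mul0r addr0.
rewrite !imE mulr1 => e; apply: (@mulfI R 2); first by rewrite pnatr_eq0.
by rewrite e /s !mulrA.
Qed.

(** Conjugating [wsum p = iC ^+ j * wsum 1] by u multiplies [wsum u] by (i chi4(u))^j. For odd j
    this exchanges the two parts up to sign and the factor chi4(u); the identity Re Im = s chi4
    exchanges them back and leaves constant signs. *)
Lemma twisted_four : exists s : R,
  [/\ twisted q (fun p => re (wsum p q)), twisted q (fun p => im (wsum p q)),
     twisted q (fun p => re (wsum p q) * im (wsum p q)) & s ^+ 2 = 1 /\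
     forall u, coprime u q -> re (wsum u q) * im (wsum u q) = s * chi4 u].
Proof.
have [s s1 sE] := reim_prod; exists s.
have co1 : coprime 1 q by rewrite coprime1n.
have key p : coprime p q -> exists k : R, k ^+ 2 = 1 /\ exists l : R, l ^+ 2 = 1 /\
    forall u, coprime u q -> re (wsum (u * p)%N q) = k * re (wsum u q) /\
      im (wsum (u * p)%N q) = l * im (wsum u q).
  move=> co_pq; have [x1 y1] := wsum_four R q_gt0 q4 co1.
  have [xp yp] := wsum_four R q_gt0 q4 co_pq.
  have [j j4 jE] := i_cases x1 y1 xp yp.
  have wE u : coprime u q -> wsum (u * p)%N q = (iC ^+ u) ^+ j * wsum u q.
    move=> co_uq; rewrite -exprM [(u * j)%N]mulnC [(u * p)%N]mulnC; apply: wsum_conj4 => //.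
    by move: jE; case: (wsum p q) (wsum 1%N q) => ? ? [].
  have dat u : coprime u q -> [/\ iC ^+ u = Complex 0 (chi4 u), chi4 u = 1 \/ chi4 u = -1,
     re (wsum u q) = 1 \/ re (wsum u q) = -1, im (wsum u q) = 1 \/ im (wsum u q) = -1
     & s = re (wsum u q) * im (wsum u q) * chi4 u].
    move=> co_uq; have [xu yu] := wsum_four R q_gt0 q4 co_uq.
    rewrite i_odd ?odd_coprime4 // sE // -mulrA -expr2 chi4_sqr mulr1.
    by split=> //; apply: sqr1_cases; rewrite ?chi4_sqr.
  case: j j4 wE {jE} => [|[|[|[|//]]]] _ wE.
  - exists 1; rewrite expr1n; split=> //; exists 1; rewrite expr1n; split => // u co_uq.
    by rewrite wE // expr0 !mul1r.
  - exists (- s); rewrite sqrrN; split=> //; exists s; split => // u co_uq.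
    rewrite wE // expr1; have [-> cc] := dat u co_uq; case: (wsum u q) => x y /= xx yy xy.
    by split; rewrite ?reM ?imM /= ?reM ?imM /= ?xy; case: xx => ->; case: yy => ->; case: cc => ->; lra.
  - exists (-1); rewrite sqrrN expr1n; split=> //; exists (-1); rewrite sqrrN expr1n; split => // u co_uq.
    rewrite wE // expr2; have [-> cc] := dat u co_uq; case: (wsum u q) => x y /= xx yy xy.
    by split; rewrite ?reM ?imM /= ?reM ?imM /= ?xy; case: xx => ->; case: yy => ->; case: cc => ->; lra.
  - exists s; split=> //; exists (- s); rewrite sqrrN; split => // u co_uq.
    rewrite wE // !exprS expr0; have [-> cc] := dat u co_uq; case: (wsum u q) => x y /= xx yy xy.
    by split; rewrite ?reM ?imM /= ?reM ?imM /= ?xy; case: xx => ->; case: yy => ->; case: cc => ->; lra.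
split=> //.
- split=> [p|p co_pq|u co_uq]; first by rewrite wsum_mod.
    by have [] := wsum_four R q_gt0 q4 co_pq.
  by have [k [k1 [l [l1 kl]]]] := key u co_uq; exists k => // p /kl[].
- split=> [p|p co_pq|u co_uq]; first by rewrite wsum_mod.
    by have [] := wsum_four R q_gt0 q4 co_pq.
  by have [k [k1 [l [l1 kl]]]] := key u co_uq; exists l => // p /kl[].
- split=> [p|p co_pq|u co_uq]; first by rewrite wsum_mod.
    by have [xu yu] := wsum_four R q_gt0 q4 co_pq; rewrite exprMn xu yu mulr1.
  have [k [k1 [l [l1 kl]]]] := key u co_uq; exists (k * l).
    by rewrite exprMn k1 l1 mulr1.
  by move=> p /kl[-> ->]; rewrite mulrACA.
Qed.

End GaussFour.

(** * Mean values of Gauss sums over the units *)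

Section GaussMeans.
Variable R : realType.
Local Notation C := R[i].
Local Notation chi := (@chi R).
Local Notation wsum := (@wsum R).
Local Notation jac := (@jac R).
Local Notation re := (@complex.Re R).
Local Notation im := (@complex.Im R).

Lemma eqn_mod_mulr a b u q : coprime u q -> a * u = b * u %[mod q] -> a = b %[mod q].
Proof.
move=> co_uq; wlog ab : a b / (b <= a)%N => [wl|/eqP].
  by case: (leqP b a) => [/wl//|/ltnW/wl H /esym/H/esym].
rewrite eqn_mod_dvd ?leq_mul2r ?ab ?orbT // -mulnBl Gauss_dvdl 1?coprime_sym // => dv.
by apply/eqP; rewrite eqn_mod_dvd.
Qed.

Lemma sum_unit_mul (V : nmodType) q u (F : nat -> V) : (0 < q)%N -> coprime u q ->
  (forall p, F (p %% q)%N = F p) ->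
  \sum_(p < q | coprime p q) F (p * u)%N = \sum_(p < q | coprime p q) F p.
Proof.
move=> q_gt0 co_uq Fq; pose h (p : 'I_q) := Ordinal (ltn_pmod (p * u) q_gt0).
have h_inj : injective h.
  move=> a b [] /(eqn_mod_mulr co_uq).
  by rewrite !modn_small ?ltn_ord // => /val_inj.
rewrite [RHS](reindex_inj h_inj) /=; apply: eq_big => p; rewrite ?Fq //.
by rewrite coprime_modl coprimeMl co_uq andbT.
Qed.

Lemma sum_sign_int (I : finType) (P : pred I) (c : I -> R) :
  (forall i, P i -> c i ^+ 2 = 1) -> exists z : int, \sum_(i | P i) c i = z%:~R.
Proof.
move=> c1; elim/big_ind: _ => [|x y [a ->] [b ->]|i /c1/sqr1_cases[]->].
- by exists 0.
- by exists (a + b); rewrite intrD.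
- by exists 1.
- by exists (-1); rewrite rmorphN1.
Qed.

Lemma sqrt_int_rat (q : nat) (z : int) (t : rat) : ~ is_square q ->
  Num.sqrt (q%:R : R) * z%:~R = ratr t -> z = 0.
Proof.
move=> nsq e; apply/eqP/negPn/negP => z_neq0; apply: nsq.
have e2 : (q%:R * z%:~R ^+ 2 : rat) = t ^+ 2.
  apply: (fmorph_inj (ratr : {rmorphism rat -> R})).
  rewrite rmorphM !rmorphXn /= rmorph_nat rmorph_int -e exprMn sqr_sqrtr //.
have tE : t * (denq t)%:~R = (numq t)%:~R by rewrite -{1}[t]divq_num_den divfK // intr_eq0 denq_neq0.
have e3 : q%:Z * (z * denq t) ^+ 2 = numq t ^+ 2.
  apply/eqP; rewrite -(eqr_int rat) rmorphM !rmorphXn /= rmorphM /= -tE !exprMn -e2 mulrA.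
  by rewrite -pmulrn.
apply: (@sqrt_rat_square q `|z * denq t| `|numq t|).
  by rewrite absz_gt0 mulf_neq0 ?denq_neq0.
by rewrite -!abszX -e3 abszM.
Qed.

(** Multiplying p by a unit permutes the sum, which is therefore invariant under conjugation. The
    root of unity has order r while p runs over units modulo q; [lift] makes each conjugation modulo
    r come from a unit modulo q. The case r = q/2 serves q = 2 modulo 4. *)
Lemma sum_g1_rat (r q k : nat) : (0 < q)%N -> (r %| q)%N ->
  (forall u, coprime u r -> exists2 u', coprime u' q & u' = u %[mod r]) ->
  exists t : rat, \sum_(p < q | coprime p q) g1 R (k * p)%N r = ratr t.
Proof.
move=> q_gt0 rq lift; have r_gt0 := dvdn_gt0 q_gt0 rq.
have F_mod p : g1 R (k * (p %% q))%N r = g1 R (k * p)%N r.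
  by apply: g1_mod => //; rewrite -modnMmr modn_dvdm // modnMmr.
apply: (conj_invariant_rat (r := \sum_(p < q | coprime p q) gpoly (k * p) r) r_gt0 (chi_prim R r_gt0)).
move=> u /lift[u' co_u' uu'].
rewrite rmorph_sum horner_sum -(sum_unit_mul q_gt0 co_u' F_mod).
apply: eq_bigr => p _; rewrite gpoly_eval; apply: g1_mod => //.
have pu : p * u = p * u' %[mod r] by rewrite -modnMmr -uu' modnMmr.
by rewrite -mulnA -modnMmr pu modnMmr.
Qed.

Lemma g1_wsum p q : (0 < q)%N -> g1 R p%:Z q = csqrt R q * wsum p q.
Proof. by move=> q_gt0; rewrite /wsum mulrC divfK // csqrt_neq0. Qed.

Lemma re_ratr (t : rat) : re (ratr t) = ratr t.
Proof. by rewrite -(fmorph_rat (real_complex R)). Qed.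

Lemma im_ratr (t : rat) : im (ratr t) = 0.
Proof. by rewrite -(fmorph_rat (real_complex R)). Qed.

Lemma sum_jac_eq0 (r q k : nat) : odd r -> ~ is_square r -> (0 < q)%N -> (r %| q)%N ->
  (forall u, coprime u r -> exists2 u', coprime u' q & u' = u %[mod r]) ->
  coprime k r -> \sum_(p < q | coprime p q) jac r (k * p)%N = 0.
Proof.
move=> r_odd nsq q_gt0 rq lift co_kr; have r_gt0 := dvdn_gt0 q_gt0 rq.
have co_r p : coprime p q -> coprime (k * p) r.
  by move=> co_pq; rewrite coprimeMl co_kr (coprime_dvdr rq).
have [t] := sum_g1_rat k q_gt0 rq lift.
have [z zE] : exists z : int, \sum_(p < q | coprime p q) jac r (k * p)%N = z%:~R.
  by apply: sum_sign_int => p /co_r; exact: jac_sqr.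
have -> : \sum_(p < q | coprime p q) g1 R (k * p)%N r =
    epsq R r * (Num.sqrt (r%:R : R) * z%:~R)%:C%C.
  rewrite -zE rmorphM rmorph_sum /= mulrCA !mulr_sumr; apply: eq_bigr => p /co_r co_pr.
  by rewrite g1_wsum // jacE // mulrCA.
rewrite zE /epsq; case: ifP => _.
  rewrite mul1r => /(congr1 re); rewrite re_ratr => /sqrt_int_rat -> //.
(* When eps_r = i the sum is both rational and purely imaginary, hence 0. *)
move=> /(congr1 im); rewrite im_ratr imM /= mul0r mul1r add0r => /eqP.
by rewrite mulf_eq0 sqrtr_eq0 -[_ <= 0]negbK -ltNge ltr0n r_gt0 => /eqP.
Qed.

Section Four.
Variable q : nat.
Hypotheses (q_gt0 : (0 < q)%N) (q4 : (4 %| q)%N).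

(** The sum of the Gauss sums is rational: its imaginary part vanishes for every q, whereas its real
    part is sqrt q times an integer. *)
Lemma sum_wsum_four : \sum_(p < q | coprime p q) im (wsum p q) = 0 /\
  (~ is_square q -> \sum_(p < q | coprime p q) re (wsum p q) = 0).
Proof.
have lift u : coprime u q -> exists2 u', coprime u' q & u' = u %[mod q] by exists u.
have [t] := sum_g1_rat 1 q_gt0 (dvdnn q) lift.
under eq_bigr do rewrite mul1n g1_wsum //.
rewrite -mulr_sumr => tE; have sq_neq0 : Num.sqrt (q%:R : R) != 0.
  by rewrite sqrtr_eq0 -ltNge ltr0n.
split.
  move/(congr1 im): tE; rewrite im_ratr imM im_sum /= mul0r addr0 => /eqP.
  by rewrite mulf_eq0 (negPf sq_neq0) => /eqP.
move=> nsq; move/(congr1 re): tE; rewrite re_ratr reM re_sum /= mul0r subr0.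
have [z ->] : exists z : int, \sum_(p < q | coprime p q) re (wsum p q) = z%:~R.
  by apply: sum_sign_int => p co_pq; have [] := wsum_four R q_gt0 q4 co_pq.
by move=> /sqrt_int_rat -> //.
Qed.

(** The substitution p -> -p reverses the sign of chi4, to which Re Im is proportional. *)
Lemma sum_reim_eq0 : \sum_(p < q | coprime p q) re (wsum p q) * im (wsum p q) = 0.
Proof.
have [s [_ _ [c_mod c_sqr c_tw] [s1 sE]]] := twisted_four R q_gt0 q4.
have [k' qE] := dvdnP q4; have k_gt0 : (0 < k')%N by case: (k') q_gt0 qE => // /[swap] ->.
have co_u : coprime q.-1 q by rewrite coprime_sym coprimenP.
have co1 : coprime 1 q by rewrite coprime1n.
have [k _ kE] := c_tw _ co_u.
have kN1 : k = -1.
  have := kE _ co1; rewrite mul1n !sE //.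
  have -> : chi4 R q.-1 = -1.
    rewrite /chi4 (_ : q.-1./2 = (2 * k'.-1).+1); last by rewrite qE; lia.
    by rewrite exprS exprM sqrrN !expr1n mulr1.
  rewrite /chi4 /= expr0 mulr1; have s_neq0 : s != 0 by rewrite -sqrf_eq0 s1 oner_eq0.
  by rewrite mulrC => /(mulIf s_neq0).
have := sum_unit_mul q_gt0 co_u c_mod.
rewrite (eq_bigr (fun p : 'I_q => - (re (wsum p q) * im (wsum p q)))); last first.
  by move=> p co_pq; rewrite kE // kN1 mulN1r.
rewrite sumrN; set S := \sum_(p < q | _) _ => e; lra.
Qed.

End Four.

Lemma sum_ord_mul (V : nmodType) m n (F : nat -> V) :
  \sum_(h < m * n) F h = \sum_(b < n) \sum_(a < m) F (m * b + a)%N.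
Proof.
elim: n => [|n IHn]; first by rewrite muln0 !big_ord0.
rewrite mulnSr big_split_ord /= IHn big_ord_recr /=; congr (_ + _).
Qed.

(** With h = m b + a, the square of h is linear in b modulo m^2, and the sum over b forces m |
    2a. *)
Lemma g1_square (p m : nat) : (0 < m)%N -> coprime p m ->
  g1 R p (m * m) = m%:R * \sum_(a < m | (m %| 2 * a)%N) chi (m * m) (p%:Z * a%:Z ^+ 2).
Proof.
move=> m_gt0 co_pm; have q_gt0 : (0 < m * m)%N by rewrite muln_gt0 m_gt0.
rewrite g1E (sum_ord_mul m m (fun h => chi (m * m) (p%:Z * h%:Z ^+ 2))) exchange_big.
rewrite mulr_sumr [RHS]big_mkcond; apply: eq_bigr => a _.
have chiE (b : nat) : chi (m * m) (p%:Z * (m * b + a)%N%:Z ^+ 2) =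
    chi (m * m) (p%:Z * a%:Z ^+ 2) * chi m (b%:Z * (2 * p%:Z * a%:Z)).
  rewrite -(@chi_scale _ m m) // -chiD; apply: chi_eqmod => //.
  by apply/dvdzP; exists (p%:Z * b%:Z ^+ 2); rewrite PoszD !PoszM; ring.
under eq_bigr do rewrite chiE.
rewrite -mulr_sumr sum_chi //.
have -> : (m %| 2 * p%:Z * a%:Z)%Z = (m %| 2 * a)%N.
  by rewrite -!PoszM -mulnA mulnCA dvdzE /= Gauss_dvdr // coprime_sym.
by case: ifP; rewrite ?mulr0 // mulrC.
Qed.

Lemma csqrt_square m : csqrt R (m * m) = m%:R.
Proof. by rewrite /csqrt natrM -expr2 sqrtr_sqr ger0_norm ?rmorph_nat. Qed.

Lemma epsq_square m : odd m -> epsq R (m * m) = 1.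
Proof.
move=> m_odd; rewrite /epsq ifT //.
have [k ->] : exists k, m = (1 + k * 2)%N.
  by exists m./2; rewrite -{1}(odd_double_half m) m_odd muln2.
have -> : ((1 + k * 2) * (1 + k * 2) = (k * k + k) * 4 + 1)%N by ring.
by rewrite modnMDl.
Qed.

Lemma wsum_odd_square p m : odd m -> coprime p m -> wsum p (m * m) = 1.
Proof.
move=> m_odd co_pm; have m_gt0 : (0 < m)%N by case: m m_odd {co_pm}.
rewrite /wsum g1_square // (sum_dbl_odd (fun a => chi (m * m) (p%:Z * a%:Z ^+ 2))) //.
by rewrite expr0n mulr0 chi0 mulr1 csqrt_square divff // pnatr_eq0 -lt0n.
Qed.

(** The normalised sum is 1 plus a point of the unit circle, so its real part, which is +-1 by
    [wsum_four], cannot be -1. *)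
Lemma re_wsum_even_square p m : (0 < m)%N -> (2 %| m)%N -> coprime p m ->
  re (wsum p (m * m)) = 1.
Proof.
move=> m_gt0 m2 co_pm; have q_gt0 : (0 < m * m)%N by rewrite muln_gt0 m_gt0.
have q4 : (4 %| m * m)%N by rewrite (@dvdn_mul 2 2).
have co_pq : coprime p (m * m) by rewrite coprimeMr co_pm.
have [x1 _] := wsum_four R q_gt0 q4 co_pq.
have [k mE] := dvdnP m2; have k_gt0 : (0 < k)%N by case: (k) m_gt0 mE => // /[swap] ->.
have wE : wsum p (m * m) = 1 + chi (m * m) (p%:Z * k%:Z ^+ 2).
  rewrite /wsum g1_square // csqrt_square mulrAC divff ?mul1r ?pnatr_eq0 -?lt0n //.
  have := sum_dbl_even (fun a => chi (m * m) (p%:Z * a%:Z ^+ 2)) k_gt0.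
  by rewrite expr0n mulr0 chi0 mulnC -mE.
have [//|xN] := sqr1_cases x1.
have : `|re (chi (m * m) (p%:Z * k%:Z ^+ 2))| <= 1 by exact: cos_max.
by move: xN; rewrite wE reD ler_norml /= => xN /andP[]; lra.
Qed.

End GaussMeans.

(** * Weyl sums *)

Section WeylSums.
Variable R : realType.
Local Notation C := R[i].
Local Notation chi := (@chi R).

Definition zinv (q p : nat) : nat := (p%:R : 'Z_q)^-1.

Lemma zinvP q p : (1 < q)%N -> coprime p q -> (q %| p%:Z * (zinv q p)%:Z - 1)%Z.
Proof.
move=> q_gt1 co_pq; rewrite -[(q %| _)%Z]/(q %| `|_|)%N -Zp_intr_eq0 // intrB intrM -!pmulrn.
by rewrite natr_Zp mulrV ?subrr // unitZpE // coprime_sym.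
Qed.

Lemma chi_Zp q (k : int) : (1 < q)%N -> chi q (val (k%:~R : 'Z_q))%:Z = chi q k.
Proof.
move=> q_gt1; apply: chi_eqmod; first exact: ltnW.
rewrite -[(q %| _)%Z]/(q %| `|_|)%N -Zp_intr_eq0 // intrB -pmulrn.
by rewrite natr_Zp subrr.
Qed.

Lemma unit_Zp_coprime q (x : 'Z_q) : (1 < q)%N -> (x \is a GRing.unit) = coprime x q.
Proof. by move=> q_gt1; rewrite -{1}(natr_Zp x) unitZpE // coprime_sym. Qed.

Lemma chi_ZpD q (u v : 'Z_q) : (1 < q)%N ->
  chi q (val (u + v))%:Z = chi q (val u)%:Z * chi q (val v)%:Z.
Proof.
move=> q_gt1; rewrite -chiD -[RHS](chi_Zp _ q_gt1) rmorphD /= -!pmulrn.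
by rewrite !natr_Zp.
Qed.

Lemma chi_ZpM q (k : int) (u : 'Z_q) : (1 < q)%N ->
  chi q (val (k%:~R * u))%:Z = chi q (k * (val u)%:Z).
Proof.
move=> q_gt1; rewrite -[RHS](chi_Zp _ q_gt1) rmorphM /= -!pmulrn.
by rewrite natr_Zp.
Qed.

Lemma sum_Zp (V : nmodType) q (F : nat -> V) : (1 < q)%N ->
  \sum_(x : 'Z_q) F (val x) = \sum_(h < q) F h.
Proof. by case: q => [|[|q]]. Qed.

Lemma val_ZpM q (x u : 'Z_q) : (1 < q)%N -> val (x * u) = (x * u %% q)%N.
Proof. by case: q x u => [|[|q]]. Qed.

Lemma sum_chi_Zp q (u : 'Z_q) : (1 < q)%N ->
  \sum_x chi q (val (x * u))%:Z = if u == 0 then #|'Z_q|%:R else 0.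
Proof.
move=> q_gt1; rewrite card_Zp_type //.
have -> : (u == 0) = (q %| (val u)%:Z)%Z.
  rewrite -[(q %| _)%Z]/(q %| `|(val u)%:Z|)%N -Zp_intr_eq0 // -pmulrn.
  by rewrite natr_Zp.
rewrite -sum_chi ?(ltnW q_gt1) // -(sum_Zp (fun h => chi q (h%:Z * (val u)%:Z))) //.
apply: eq_bigr => h _; rewrite -[in LHS](natr_Zp h) pmulrn chi_ZpM //.
Qed.

Definition wmean (q : nat) (F : nat -> C) : C :=
  (\sum_(p < q | coprime p q) F p) / (totient q)%:R.

Lemma kloo_sum q (c : nat -> R) (b m n : int) : (1 < q)%N -> twisted q c ->
  \sum_(p < q | coprime p q)
    (c p)%:C%C * (ee (m%:~R * (p%:R / q%:R)) * ee (n%:~R * ((b * (zinv q p)%:Z)%:~R / q%:R))) =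
  kloo (fun x : 'Z_q => chi q (val x)%:Z)
       (fun x => if x \is a GRing.unit then (c (val x))%:C%C else 0)
       (m%:~R) (n%:~R * b%:~R).
Proof.
move=> q_gt1 [c_mod c_sqr c_tw]; rewrite /kloo.
(* For a modulus of the form [q'.+2] the types ['Z_q] and ['I_q] are convertible, so both sums have
   the same index type. *)
case: q q_gt1 c_mod c_sqr c_tw => [|[|q']] // q_gt1 _ _ _; set q := q'.+2 in q_gt1 *.
rewrite -[Zp_trunc q]/q'.
have unitE (x : 'Z_q) := unit_Zp_coprime x q_gt1.
apply: eq_big => [x|x co_x]; first by rewrite unitE.
rewrite unitE co_x; congr (_ * _).
rewrite (chi_ZpD _ _ q_gt1) (chi_ZpM _ _ q_gt1) -intrM (chi_ZpM _ _ q_gt1); congr (_ * _).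
  by rewrite /chi intrM -pmulrn mulrA.
by rewrite /chi /zinv natr_Zp !intrM !mulrA.
Qed.

(** K depends on m, n and B but not on q, c or b: the annihilator of n b has at most |n| B elements
    if n is nonzero, and that of m at most |m| if n is zero. *)
Lemma weyl_bound (B : nat) (m n : int) : (m != 0) || (n != 0) ->
  exists K : nat, forall q (c : nat -> R) (b : int), (1 < q)%N -> twisted q c ->
    (#|[set v : 'Z_q | (b%:~R * v == 0)%R]| <= B)%N ->
    q%:R * `|wmean q (fun p => (c p)%:C%C * (ee (m%:~R * (p%:R / q%:R)) *
        ee (n%:~R * ((b * (zinv q p)%:Z)%:~R / q%:R))))| ^+ 24 <= K%:R.
Proof.
move=> mn_neq0; have [K KP] := kloo_Zp_le; pose g := (`|m| + `|n| * B)%N.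
exists (K * g ^ 6)%N => q c b q_gt1 tw annb; have q_gt0 := ltnW q_gt1.
rewrite /wmean kloo_sum // normrM normfV normr_nat exprMn exprVn mulrA.
have tot_gt0 : 0 < (totient q)%:R ^+ 24 :> C by rewrite exprn_gt0 // ltr0n totient_gt0.
rewrite ler_pdivrMr //.
have -> : (K * g ^ 6)%:R * (totient q)%:R ^+ 24 = (K * g ^ 6 * totient q ^ 24)%:R :> C.
  by rewrite [RHS]natrM natrX.
have card_q := card_Zp_type q_gt1.
have unitE (x : 'Z_q) := unit_Zp_coprime x q_gt1.
case: tw => c_mod c_sqr c_tw.
apply: KP => //.
- by move=> u v; apply: chi_ZpD.
- move=> u; rewrite chi_conj -[LHS](chi_Zp _ q_gt1) rmorphN /= -pmulrn.
  by rewrite natr_Zp.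
- by move=> u; apply: sum_chi_Zp.
- move=> x; case: ifP => [|_]; last by rewrite normr0 ler01.
  rewrite unitE => /c_sqr c1; rewrite -(@expr_le1 _ 2) // -normrX -rmorphXn /= c1 rmorph1 normr1.
  by [].
- move=> u; rewrite unitE => co_uq; have [k k1 kE] := c_tw _ co_uq.
  exists k%:C%C.
    by apply/eqP; rewrite -(@eqrXn2 _ 2) // -normrX -rmorphXn /= k1 rmorph1 normr1 expr1n.
  move=> x; rewrite !unitE => co_xq.
  have -> : coprime (x * u)%R q.
    by rewrite -unitE unitrM !unitE co_xq co_uq.
  rewrite co_xq -rmorphM /= -kE //; congr (_%:C)%C; rewrite -[RHS]c_mod; congr c.
  exact: val_ZpM.
- have [n0|n_neq0] := eqVneq n 0.
    right; rewrite n0 eqxx orbF in mn_neq0.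
    have := card_ann_le (B := 1) (b := 1) q_gt1 mn_neq0.
    rewrite muln1 => H; apply: leq_trans (leq_addr _ _); apply: leq_trans (H _).
      by apply: eq_leq; apply: eq_card => v; rewrite !inE mulr1.
    apply: eq_leq; rewrite -[RHS](cards1 (0 : 'Z_q)); apply: eq_card => v.
    by rewrite !inE mul1r.
  left; apply: leq_trans (leq_addl _ _).
  exact: card_ann_le.
Qed.

End WeylSums.

(** * Completing the square *)

Section CompleteSquare.
Variable R : realType.
Local Notation chi := (@chi R).

(* An inverse of -4 modulo the odd number [q]. *)
Definition bodd (q : nat) : int := ((q * q).-1 %/ 4)%N%:Z.

Lemma boddE q : odd q -> 4 * bodd q = q%:Z ^+ 2 - 1.
Proof.
move=> q_odd; have [k ->] : exists k, q = (1 + k * 2)%N.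
  by exists q./2; rewrite -{1}(odd_double_half q) q_odd muln2.
rewrite /bodd (_ : ((1 + k * 2) * (1 + k * 2)).-1 = ((k * k + k) * 4))%N; last by rewrite -subn1; nia.
by rewrite mulnK // PoszD !PoszM PoszD PoszM; ring.
Qed.

Lemma complete_square_odd q p k : odd q -> (1 < q)%N -> coprime p q ->
  \sum_(h < q) chi q (p%:Z * h%:Z ^+ 2 + k * h%:Z) =
  g1 R p q * chi q (bodd q * (zinv q p)%:Z * k ^+ 2).
Proof.
move=> q_odd q_gt1 co_pq; have q_gt0 := ltnW q_gt1.
have b4 := boddE q_odd; have /dvdzP[m pz] := zinvP q_gt1 co_pq.
set b := bodd q in b4 *; set z := (zinv q p)%:Z in pz *.
(* Modulo q this shift is k / (2p), because 4 b = -1 and p z = 1. *)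
rewrite g1E -(sum_chi_shift R p (- (2 * b * z * k)) q_gt0) mulr_suml.
apply: eq_bigr => h _; rewrite -chiD; apply: chi_eqmod => //; apply/dvdzP.
have bz : (4 * b) * (p%:Z * z) = q%:Z * (q%:Z + (q%:Z ^+ 2 - 1) * m) - 1.
  by rewrite b4 -[p%:Z * z](subrK 1) pz; ring.
exists ((q%:Z + (q%:Z ^+ 2 - 1) * m) * (h%:Z * k - b * z * k ^+ 2)).
transitivity (h%:Z * k * (1 + (4 * b) * (p%:Z * z)) - b * z * k ^+ 2 * ((4 * b) * (p%:Z * z) + 1)).
  by ring.
by rewrite bz; ring.
Qed.

(** With linear coefficient 2j the shift is j / p, which exists modulo even q too. *)
Lemma complete_square_even q p j : (1 < q)%N -> coprime p q ->
  \sum_(h < q) chi q (p%:Z * h%:Z ^+ 2 + 2 * j * h%:Z) =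
  g1 R p q * chi q (-1 * (zinv q p)%:Z * j ^+ 2).
Proof.
move=> q_gt1 co_pq; have q_gt0 := ltnW q_gt1.
have /dvdzP[m pz] := zinvP q_gt1 co_pq; set z := (zinv q p)%:Z in pz *.
rewrite g1E -(sum_chi_shift R p (z * j) q_gt0) mulr_suml.
apply: eq_bigr => h _; rewrite -chiD; apply: chi_eqmod => //; apply/dvdzP.
exists (- m * (2 * j * h%:Z + z * j ^+ 2)).
transitivity (- (p%:Z * z - 1) * (2 * j * h%:Z + z * j ^+ 2)); first by ring.
by rewrite pz; ring.
Qed.

Lemma chi2 (k : int) : chi 2 k = if odd `|k|%N then -1 else 1.
Proof.
have c1 : chi 2 1 = -1.
  rewrite /chi /ee; have -> : 2 * pi * (1%:~R / 2%:R) = pi :> R by lra.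
  by rewrite cospi sinpi; apply: complex_eqP; rewrite /= ?oppr0.
have -> : chi 2 k = chi 2 `|k|%N%:Z.
  apply: chi_eqmod => //; rewrite -[X in (X %| _)%Z]/(2%:Z); apply/dvdzP.
  by case: (intP k) => [|n|n]; [exists 0|exists 0|exists (- n.+1%:Z)]; lia.
rewrite chi_nat c1 -signr_odd; by case: odd; rewrite ?expr1 ?expr0.
Qed.

Lemma sum_antiperiodic_eq0 q (F : int -> R[i]) (s : int) : (0 < q)%N ->
  (forall a, F (a + q%:Z) = F a) -> (forall a, F (a + s) = - F a) ->
  \sum_(h < q) F h%:Z = 0.
Proof.
move=> q_gt0 Fq Fs; have := sum_shift s q_gt0 Fq.
under eq_bigr do rewrite Fs.
rewrite sumrN => /eqP; rewrite eq_sym -addr_eq0 -mulr2n mulrn_eq0 /=.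
by move/eqP.
Qed.

Lemma chi_quad_period q (p k a : int) : (0 < q)%N ->
  chi q (p * (a + q%:Z) ^+ 2 + k * (a + q%:Z)) = chi q (p * a ^+ 2 + k * a).
Proof.
move=> q_gt0; apply: chi_eqmod => //; apply/dvdzP.
by exists (p * (2 * a + q%:Z) + k); ring.
Qed.

(** Shifting h by q/2 leaves p h^2 unchanged modulo q, as 4 divides q, and adds k q/2 to k h: the
    sum is its own opposite. *)
Lemma sum_four_odd q (p k : int) : (0 < q)%N -> (4 %| q)%N -> odd `|k|%N ->
  \sum_(h < q) chi q (p * h%:Z ^+ 2 + k * h%:Z) = 0.
Proof.
move=> q_gt0 /dvdnP[m qE] k_odd; have m_gt0 : (0 < m)%N by case: (m) q_gt0 qE => // /[swap] ->.
apply: (@sum_antiperiodic_eq0 q (fun h => chi q (p * h ^+ 2 + k * h)) (2 * m)%N%:Z) => // a.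
  exact: chi_quad_period.
have -> : p * (a + (2 * m)%N%:Z) ^+ 2 + k * (a + (2 * m)%N%:Z) =
   (p * a ^+ 2 + k * a) + q%:Z * (p * (a + m%:Z)) + k * (2 * m)%N%:Z.
  by rewrite qE !PoszM; ring.
rewrite chiD chiD chi_mull // mulr1.
have -> : chi q (k * (2 * m)%N%:Z) = -1.
  rewrite (_ : q = (2 * (2 * m))%N); last by rewrite qE mulnA mulnC.
  by rewrite chi_scale ?muln_gt0 // chi2 k_odd.
by rewrite mulrN1.
Qed.

Section TwiceOdd.
Variables (r p : nat).
Hypotheses (r_odd : odd r) (p_odd : odd p).
Let r_gt0 : (0 < r)%N. Proof. by case: (r) r_odd. Qed.
Let q_gt0 : (0 < r * 2)%N. Proof. by rewrite muln_gt0 r_gt0. Qed.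

(** A shift by r, half the modulus, adds (p r + k) r, that is, the sign of the parity of p r + k. As
    p r is odd, even k give an antiperiodic summand and odd k an r-periodic one. *)
Lemma twice_odd_shift (k a : int) :
  chi (r * 2) (p%:Z * (a + r%:Z) ^+ 2 + k * (a + r%:Z)) =
  (if odd `|k|%N then 1 else -1) * chi (r * 2) (p%:Z * a ^+ 2 + k * a).
Proof.
have -> : p%:Z * (a + r%:Z) ^+ 2 + k * (a + r%:Z) =
   (p%:Z * a ^+ 2 + k * a) + (r * 2)%N%:Z * (p%:Z * a) + (p%:Z * r%:Z + k) * r%:Z.
  by rewrite !PoszM; ring.
rewrite chiD chiD chi_mull // mulr1 mulrC; congr (_ * _).
rewrite [(r * 2)%N]mulnC chi_scale // chi2.
have -> : odd `|(p%:Z * r%:Z + k)%R|%N = ~~ odd `|k|%N.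
  have pr : odd (p * r)%N by rewrite oddM p_odd.
  rewrite -PoszM; lia.
by case: odd.
Qed.

Lemma sum_twice_odd_even (k : int) : ~~ odd `|k|%N ->
  \sum_(h < r * 2) chi (r * 2) (p%:Z * h%:Z ^+ 2 + k * h%:Z) = 0.
Proof.
move=> k_even.
apply: (@sum_antiperiodic_eq0 _ (fun h => chi (r * 2) (p%:Z * h ^+ 2 + k * h)) r%:Z) => // a.
  exact: chi_quad_period.
by rewrite twice_odd_shift (negPf k_even) mulN1r.
Qed.

Lemma sum_double_mod (V : nmodType) (F : nat -> V) : (forall a, F (a %% r)%N = F a) ->
  \sum_(a < r) F (2 * a)%N = \sum_(a < r) F a.
Proof.
move=> Fr; pose h (a : 'I_r) := Ordinal (ltn_pmod (2 * a) r_gt0).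
have h_inj : injective h.
  move=> x y [e]; apply: val_inj; rewrite /= -[LHS](modn_small (ltn_ord x)).
  rewrite -[RHS](modn_small (ltn_ord y)); apply: (@eqn_mod_mulr _ _ 2).
    by rewrite coprime2n.
  by rewrite ![(_ * 2)%N]mulnC.
by rewrite [RHS](reindex_inj h_inj); apply: eq_bigr => a _; rewrite /= Fr.
Qed.

Lemma sum_twice_odd_odd (k : int) : (1 < r)%N -> coprime p r -> odd `|k|%N ->
  \sum_(h < r * 2) chi (r * 2) (p%:Z * h%:Z ^+ 2 + k * h%:Z) =
  2 * g1 R (2 * p)%N r * chi (r * 2) (bodd r * (zinv (r * 2) p)%:Z * k ^+ 2).
Proof.
move=> r_gt1 co_pr k_odd.
pose F (a : nat) := chi (r * 2) (p%:Z * a%:Z ^+ 2 + k * a%:Z).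
have Fr a n : F (a + r * n)%N = F a.
  elim: n => [|n IHn]; first by rewrite muln0 addn0.
  by rewrite mulnS addnCA addnC -IHn /F PoszD twice_odd_shift k_odd mul1r.
have Fmod a : F (a %% r)%N = F a by rewrite [in RHS](divn_eq a r) addnC mulnC Fr.
rewrite (sum_ord_mul r 2 F) !big_ord_recl big_ord0 addr0 /=.
under eq_bigr do rewrite addnC Fr.
under [X in _ + X]eq_bigr do rewrite addnC Fr.
rewrite -[LHS]mulr2n -[LHS]mulr_natl -mulrA; congr (_ * _).
(* Residues modulo r may be represented by even numbers 2a, for which the modulus 2r drops to r and
   p becomes 2p. *)
rewrite -(sum_double_mod Fmod).
have co_2pr : coprime (2 * p) r by rewrite coprimeMl coprime2n r_odd.
have := complete_square_odd k r_odd r_gt1 co_2pr.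
have -> : \sum_(h < r) chi r ((2 * p)%N%:Z * h%:Z ^+ 2 + k * h%:Z) = \sum_(a < r) F (2 * a)%N.
  apply: eq_bigr => a _; rewrite /F -(@chi_scale R r 2) //; congr chi.
  by rewrite !PoszM; ring.
move=> ->; congr (_ * _).
have q_gt1 : (1 < r * 2)%N by apply: leq_trans r_gt1 _; rewrite leq_pmulr.
have co_pq : coprime p (r * 2) by rewrite coprimeMr co_pr coprimen2.
have /dvdzP[m1 e1] := zinvP q_gt1 co_pq; have /dvdzP[m2 e2] := zinvP r_gt1 co_2pr.
have [t rE] : exists t, r = (1 + t * 2)%N.
  by exists r./2; rewrite -{1}(odd_double_half r) r_odd muln2.
(* (r^2 - 1)/4 is even because 8 divides r^2 - 1; so a phase with denominator 2r can be read modulo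
   r. *)
have [be bE] : exists be : int, bodd r = be * 2.
  have [u uE] : exists u : nat, (t * (t + 1) = u * 2)%N.
    by exists (t * (t + 1))./2; rewrite muln2 -[LHS]odd_double_half oddM oddD /=; case: odd.
  exists u%:Z; have := boddE r_odd; rewrite rE => e; nia.
set b := bodd r in bE *; set z1 := (zinv (r * 2) p)%:Z in e1 *; set z2 := (zinv r _)%:Z in e2 *.
have -> : b * z1 * k ^+ 2 = be * z1 * k ^+ 2 * 2%N%:Z by rewrite bE; ring.
rewrite chi_scale //; apply: chi_eqmod => //.
have -> : b * z2 * k ^+ 2 - be * z1 * k ^+ 2 = (b * z2 - be * z1) * k ^+ 2 by ring.
apply: dvdz_mulr.
rewrite -(@Gauss_dvdzr _ (2 * p)%N%:Z); last by rewrite coprimezE /= coprime_sym.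
apply/dvdzP; exists (b * m2 - 2 * b * m1).
have -> : (2 * p)%N%:Z * (b * z2 - be * z1) = b * ((2 * p)%N%:Z * z2 - 1) - (be * 2) * (p%:Z * z1 - 1) + (b - be * 2).
  by rewrite !PoszM; ring.
by rewrite e1 e2 -bE subrr addr0 !PoszM; ring.
Qed.

End TwiceOdd.

(** The multiplier is a unit here; 2 instead of 1 is the bound shared by all classes of moduli. *)
Lemma card_ann_bodd q : odd q -> (1 < q)%N ->
  (#|[set v : 'Z_q | ((bodd q)%:~R * v == 0)%R]| <= 2)%N.
Proof.
move=> q_odd q_gt1; apply: (@leq_trans #|[set (0 : 'Z_q)]|); last by rewrite cards1.
apply/subset_leq_card/fintype.subsetP => v; rewrite !inE => /eqP bv.
have : ((4 * bodd q)%:~R : 'Z_q) * v = 0 by rewrite intrM -mulrA bv mulr0.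
rewrite boddE // intrB rmorphXn /= -pmulrn pchar_Zp // expr0n sub0r mulN1r.
by move/eqP; rewrite oppr_eq0.
Qed.

Lemma card_ann_N1 q : (1 < q)%N -> (#|[set v : 'Z_q | ((-1)%:~R * v == 0)%R]| <= 2)%N.
Proof.
move=> q_gt1; apply: (@leq_trans #|[set (0 : 'Z_q)]|); last by rewrite cards1.
apply/subset_leq_card/fintype.subsetP => v; rewrite !inE.
by rewrite rmorphN1 mulN1r oppr_eq0.
Qed.

Lemma card_Zp_ord q (P : pred nat) : (1 < q)%N ->
  #|[set v : 'Z_q | P v]| = #|[set a : 'I_q | P a]|.
Proof. by case: q => [|[|q]]. Qed.

(** [bodd r] is invertible modulo r but even, so its annihilator modulo 2r consists of multiples of
    r. This is why the Weyl bound asks for a small annihilator and not for a unit. *)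
Lemma card_ann_twice_odd r : odd r ->
  (#|[set v : 'Z_(r * 2) | ((bodd r)%:~R * v == 0)%R]| <= 2)%N.
Proof.
move=> r_odd; have r_gt0 : (0 < r)%N by case: (r) r_odd.
have q_gt1 : (1 < r * 2)%N := leq_pmull 2 r_gt0.
have q_gt0 := ltnW q_gt1.
have := card_dvd_ord_le q_gt0 (dvdn_mulr 2 (dvdnn r)).
rewrite mulKn //; apply: leq_trans.
have key (v : 'Z_(r * 2)) : (bodd r)%:~R * v = 0 -> (r %| v)%N.
  move=> bv; have : ((4 * bodd r * (v : nat)%:Z)%:~R : 'Z_(r * 2)) == 0.
    by rewrite !intrM -pmulrn natr_Zp -mulrA bv mulr0.
  rewrite Zp_intr_eq0 // boddE // => dv.
  have : (r%:Z %| (r%:Z ^+ 2 - 1) * (v : nat)%:Z)%Z.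
    by rewrite dvdzE; apply: dvdn_trans dv; rewrite dvdn_mulr.
  have -> : (r%:Z ^+ 2 - 1) * (v : nat)%:Z = r%:Z * (r%:Z * (v : nat)%:Z) - (v : nat)%:Z by ring.
  by rewrite rpredBl ?dvdz_mulr.
rewrite -(card_Zp_ord (fun v => r %| v)%N) //.
by apply/subset_leq_card/fintype.subsetP => v; rewrite !inE => /eqP /key.
Qed.

End CompleteSquare.

Local Open Scope classical_set_scope.
Local Open Scope ring_scope.

(** * Approximation by trigonometric polynomials *)

Section Fejer.
Local Open Scope complex_scope.
Variable R : realType.
Local Notation C := R[i].
Local Notation ee := (@ee R).

Definition tpoly (s : seq (C * int)) (x : R) : C := \sum_(t <- s) t.1 * ee (t.2%:~R * x).

Definition dirichlet N (x : R) : C := \sum_(k < N) ee (k%:R * x).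

Definition fejer N (x : R) : C := `|dirichlet N x| ^+ 2 / N%:R.

Lemma fejerE N x : fejer N x =
  \sum_(k < N) \sum_(l < N) ee ((k%:Z - l%:Z)%:~R * x) / N%:R.
Proof.
rewrite /fejer normCK /dirichlet rmorph_sum mulr_suml mulr_suml.
apply: eq_bigr => k _; rewrite mulr_sumr mulr_suml; apply: eq_bigr => l _.
  by rewrite -[X in _ * X / _ = _]/((ee (l%:R * x))^*%R) ee_conj -eeD intrB -!pmulrn mulrBl.
Qed.

Lemma dirichlet_geo N x : dirichlet N x * (ee x - 1) = ee (N%:R * x) - 1.
Proof.
rewrite /dirichlet eeMn mulrC subrX1; congr (_ * _).
by apply: eq_bigr => k _; rewrite eeMn.
Qed.

Lemma norm_ee_sub1 x : `|ee x - 1| ^+ 2 = (2 - 2 * cos (2 * pi * x))%:C.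
Proof.
rewrite -add_Re2_Im2; congr (_%:C); rewrite /ee /= subr0 sqrrB1 mulr2n.
have := cos2Dsin2 (2 * pi * x); lra.
Qed.

Lemma fejer_ge0 N x : 0 <= fejer N x.
Proof. by rewrite divr_ge0 ?exprn_ge0. Qed.

(** The geometric sum gives |D(x)| |e(x) - 1| <= 2, and 2 - 2 cos is the square of |e(x) - 1|. *)
Lemma fejer_decay N x : fejer N x * (2 - 2 * cos (2 * pi * x))%:C <= 4 / N%:R.
Proof.
rewrite -norm_ee_sub1 /fejer mulrAC ler_wpM2r ?invr_ge0 //.
rewrite -exprMn -normrM dirichlet_geo (_ : 4 = 2 ^+ 2); last by rewrite -natrX.
rewrite lerXn2r ?nnegrE //.
by rewrite (le_trans (ler_normB _ _)) // ee_norm normr1; exact: lexx.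
Qed.

(** The frequencies k - l are smaller than N in absolute value, so sampling at the N nodes j/N
    integrates the kernel exactly. *)
Lemma fejer_mean N x : (0 < N)%N ->
  \sum_(j < N) fejer N (x - j%:R / N%:R) / N%:R = 1.
Proof.
move=> N_gt0; have N_neq0 : (N%:R : C) != 0 by rewrite pnatr_eq0 -lt0n.
under eq_bigr do rewrite fejerE mulr_suml.
rewrite exchange_big (eq_bigr (fun=> N%:R^-1)) /=; last first.
  move=> k _; under eq_bigr do rewrite mulr_suml.
  rewrite exchange_big (bigD1 k) //= [X in _ + X]big1 ?addr0.
    under eq_bigr do rewrite subrr mul0r ee0.
    by rewrite sumr_const card_ord mul1r -[LHS]mulr_natr -mulrA mulVf ?mulr1.
  move=> l lk; rewrite (eq_bigr (fun j : 'I_N => ee ((k%:Z - l%:Z)%:~R * x) / N%:R / N%:R *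
      chi R N (j%:Z * (l%:Z - k%:Z)))); last first.
    move=> j _; rewrite [RHS]mulrAC [X in _ = X / _]mulrAC -eeD.
    congr (ee _ / _ / _); rewrite intrM !intrB -!pmulrn; ring.
  rewrite -mulr_sumr sum_chi //; case: ifP => [dv|]; last by rewrite mulr0.
  case/negP: lk; apply/eqP; apply: val_inj => /=.
  have : (l%:Z == k%:Z %[mod N])%Z by rewrite eqz_mod_dvd.
  by rewrite !modz_small ?ltz_nat ?ltn_ord // => /eqP[].
by rewrite sumr_const card_ord -[LHS]mulr_natr mulVf.
Qed.

(** The modulus of continuity is assumed in the shape that [fejer_decay] absorbs: the constant term
    survives averaging and the term in K costs 4 K / N. The approximant is a Fejer mean over the
    nodes j/N. *)
Lemma fejer_approx (F : R -> R) :
  (forall e, 0 < e -> exists2 K, 0 <= K &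
     forall x y, `|F x - F y| <= e + K * (2 - 2 * cos (2 * pi * (x - y)))) ->
  forall e, 0 < e -> exists s, forall x, `|(F x)%:C - tpoly s x| <= e%:C.
Proof.
move=> Fmod e e_gt0; have e2_gt0 : 0 < e / 2 by rewrite divr_gt0.
have [K K_ge0 FK] := Fmod _ e2_gt0.
pose N := (Num.trunc (8 * K / e)).+1.
have N_gt0 : (0 < N%:R :> R) by rewrite ltr0n.
have N_large : K * (4 / N%:R) <= e / 2.
  have : 8 * K / e < N%:R by rewrite /N truncnS_gt.
  rewrite ltr_pdivrMr // => h; rewrite mulrA ler_pdivrMr //; lra.
pose co (t : 'I_N * 'I_N * 'I_N) : C * int := let: (j, k, l) := t in
  ((F (j%:R / N%:R))%:C / N%:R / N%:R * ee (- ((k%:Z - l%:Z)%:~R * (j%:R / N%:R))), k%:Z - l%:Z).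
exists [seq co t | t <- enum {: 'I_N * 'I_N * 'I_N}] => x.
have PE : tpoly [seq co t | t <- enum {: 'I_N * 'I_N * 'I_N}] x =
    \sum_(j < N) (F (j%:R / N%:R))%:C * (fejer N (x - j%:R / N%:R) / N%:R).
  rewrite /tpoly big_map big_enum /=.
  transitivity (\sum_j \sum_k \sum_l (co (j, k, l)).1 * ee ((co (j, k, l)).2%:~R * x)).
    by rewrite pair_bigA pair_bigA /=; apply: eq_bigr => -[[j k] l].
  apply: eq_bigr => j _; rewrite fejerE mulr_suml mulr_sumr; apply: eq_bigr => k _.
  rewrite mulr_suml mulr_sumr; apply: eq_bigr => l _ /=.
  rewrite mulrBr eeD; ring.
rewrite PE -[(F x)%:C]mulr1 -{1}(fejer_mean x (ltn0Sn _ : (0 < N)%N)) mulr_sumr -sumrB.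
apply: le_trans (ler_norm_sum _ _ _) _.
apply: le_trans (_ : \sum_(j < N) ((e / 2)%:C * (fejer N (x - j%:R / N%:R) / N%:R) +
    K%:C * (4 / N%:R) / N%:R) <= _).
  apply: ler_sum => j _; rewrite -mulrBl normrM.
  rewrite [X in _ * X <= _]ger0_norm ?divr_ge0 ?fejer_ge0 //.
  rewrite -rmorphB; set y := _ / _.
  have := fejer_decay N (x - y); have := fejer_ge0 N (x - y).
  have := FK x y; set r := 2 - 2 * cos _; move: (fejer N _) => z xy z_ge0 zr.
  apply: le_trans (_ : (e / 2 + K * r)%:C * (z / N%:R) <= _).
    rewrite ler_wpM2r ?divr_ge0 //.
    by rewrite normc_def /= expr0n addr0 sqrtr_sqr lecR.
  rewrite rmorphD mulrDl lerD2l rmorphM /= !mulrA ler_wpM2r ?invr_ge0 //.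
  by rewrite -!mulrA ler_wpM2l ?ler0c // mulrC.
rewrite big_split /= -mulr_sumr fejer_mean // mulr1 sumr_const card_ord.
rewrite -[X in _ + X <= _]mulr_natr divfK ?pnatr_eq0 //.
have -> : K%:C * (4 / N%:R) = (K * (4 / N%:R))%:C.
  by rewrite !rmorphM /= fmorphV !rmorph_nat.
by rewrite -rmorphD lecR /=; lra.
Qed.

End Fejer.

(** * Uniform continuity of periodic functions *)

Section PeriodicModulus.
Variable R : realType.
Implicit Types F : R -> R.

Definition periodic1 (T : Type) (F : R -> T) := forall x, F (x + 1) = F x.

Lemma periodic_int (T : Type) (F : R -> T) (k : int) x : periodic1 F -> F (x + k%:~R) = F x.
Proof.
move=> F1; have Fn (n : nat) y : F (y + n%:R) = F y.
  by elim: n => [|n IHn]; rewrite ?addr0 // -natr1 addrA F1.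
case: k => n; first by rewrite -pmulrn Fn.
by rewrite NegzE mulrNz -[LHS](Fn n.+1) subrK.
Qed.

(** Only x is confined to the segment; x + t may leave it, which uniform continuity on [0, 1] would
    not cover. *)
Lemma heine_segment F : continuous F -> forall e, 0 < e ->
  exists2 d, 0 < d & forall x t, 0 <= x <= 1 -> `|t| < d -> `|F (x + t) - F x| <= e.
Proof.
move=> Fc e e_gt0.
have /compact_near_coveringP cov := @segment_compact R 0 1.
have [|] := cov R (0 : R)^'+ (fun d x => forall t, `|t| < d -> `|F (x + t) - F x| <= e).
  move=> x _.
  have e2 : 0 < e / 2 by rewrite divr_gt0.
  have /cvgrPdist_lt /(_ _ e2) := Fc x.
  move=> [r /= r_gt0 rP].
  exists ([set y | `|x - y| < r / 2], [set d | d < r / 2]).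
    split => /=.
      by exists (r / 2); rewrite /= ?divr_gt0.
    by near=> d; near: d; apply: nbhs_right_lt; rewrite divr_gt0.
  move=> [y d] [/= xy dr] t td.
  have h1 : `|F x - F y| < e / 2 by apply: rP => /=; lra.
  have h2 : `|F x - F (y + t)| < e / 2.
    apply: rP; rewrite /= opprD addrA (le_lt_trans (ler_normB _ _)) //; lra.
  have -> : F (y + t) - F y = (F x - F y) - (F x - F (y + t)) by ring.
  by rewrite (le_trans (ler_normB _ _)) //; lra.
move=> r /= r_gt0 rP.
exists (r / 2); first by rewrite divr_gt0.
move=> x t x01 tr; apply: (rP (r / 2)) => //=.
- by rewrite sub0r normrN gtr0_norm ?divr_gt0 //; lra.
- by rewrite divr_gt0.

Unshelve. all: by end_near.
Qed.

Lemma periodic_frac F x : periodic1 F -> exists2 y, 0 <= y <= 1 & F x = F y.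
Proof.
move=> F1; exists (x - (Num.floor x)%:~R).
  have := floor_le_tmp x; have := floorD1_gt x; rewrite intrD1; lra.
by rewrite -mulrNz periodic_int.
Qed.

Lemma periodic_bounded F : continuous F -> periodic1 F ->
  exists2 M, 0 <= M & forall x, `|F x| <= M.
Proof.
move=> Fc F1; have Fw : {within `[0, 1], continuous F} by exact: continuous_subspaceT.
have [a _ aP] := EVT_max ler01 Fw; have [b _ bP] := EVT_min ler01 Fw.
exists (`|F a| + `|F b|); first by rewrite addr_ge0.
move=> x; have [y y01 ->] := periodic_frac x F1.
have := aP y; have := bP y; rewrite !in_itv /= y01 => /(_ isT) h1 /(_ isT) h2.
have := ler_norm (F a); have := ler_norm (- F b); rewrite normrN => h3 h4.
have := normr_ge0 (F a); have := normr_ge0 (F b) => h5 h6.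
rewrite ler_norml; lra.
Qed.

(** Where x - y is within d of an integer, uniform continuity gives e; elsewhere 2 - 2 cos is
    bounded below, and K brings the right side to 2M. With d <= 1/4 and |t| <= 1/2 the angles lie in
    [0, pi], where cos decreases. *)
Lemma periodic_modulus F : continuous F -> periodic1 F ->
  forall e, 0 < e -> exists2 K, 0 <= K &
     forall x y, `|F x - F y| <= e + K * (2 - 2 * cos (2 * pi * (x - y))).
Proof.
move=> Fc F1 e e_gt0.
have [M M_ge0 MP] := periodic_bounded Fc F1.
have [d0 d0_gt0 d0P] := heine_segment Fc e_gt0.
pose d := Num.min d0 (1 / 4).
have d_gt0 : 0 < d by rewrite lt_min d0_gt0 /=; lra.
have d_le : d <= 1 / 4 by rewrite ge_min lexx orbT.
have pi0 := @pi_gt0 R.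
have cosd : cos (2 * pi * d) < 1.
  have d_in : 2 * pi * d \in `[0, pi] by rewrite in_itv /=; apply/andP; split; nra.
  have z_in : 0 \in `[0, (pi : R)] by rewrite in_itv /= lexx pi_ge0.
  have pd_gt0 : 0 < 2 * pi * d by nra.
  by rewrite -[ltRHS]cos0 ltr_cos.
pose K := 2 * M / (2 - 2 * cos (2 * pi * d)).
have k_gt0 : 0 < 2 - 2 * cos (2 * pi * d) by lra.
exists K; first by rewrite divr_ge0 ?mulr_ge0 // ltW.
move=> x y; pose k := Num.floor (x - y + 1 / 2); pose t := x - y - k%:~R.
have t_itv : - (1 / 2) <= t <= 1 / 2.
  have := floor_le_tmp (x - y + 1 / 2); have := floorD1_gt (x - y + 1 / 2).
  rewrite intrD1 -/k /t; lra.
have cosE : cos (2 * pi * (x - y)) = cos (2 * pi * t).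
  have cper : periodic1 (fun z : R => cos (2 * pi * z)).
    by move=> z; rewrite mulrDr mulr1 mulr_natl cosD2pi.
  by rewrite /t -mulrNz (periodic_int _ _ cper).
have cos1 := cos_le1 (2 * pi * t).
rewrite cosE; have [td|td] := ltP `|t| d.
  apply: le_trans (_ : e <= _); last first.
    by rewrite lerDl mulr_ge0 ?divr_ge0 ?mulr_ge0 // ?ltW //; lra.
  have y0 := floor_le_tmp y; have y1 := floorD1_gt y; rewrite intrD1 in y1.
  have -> : F y = F (y - (Num.floor y)%:~R) by rewrite -mulrNz periodic_int.
  have -> : F x = F (y - (Num.floor y)%:~R + t).
    rewrite -(periodic_int (- Num.floor y - k) x F1) intrB mulrNz; congr F; rewrite /t; ring.
  apply: d0P; first by lra.
  by rewrite (lt_le_trans td) // ge_min lexx.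
have cosle : cos (2 * pi * t) <= cos (2 * pi * d).
  have -> : cos (2 * pi * t) = cos (2 * pi * `|t|).
    by rewrite -cos_norm normrM [X in X * _]ger0_norm // mulr_ge0 // ltW.
  have t2 : `|t| <= 1 / 2 by rewrite ler_norml; lra.
  have d_in : 2 * pi * d \in `[0, pi] by rewrite in_itv /=; apply/andP; split; nra.
  have t_in : 2 * pi * `|t| \in `[0, pi] by rewrite in_itv /=; apply/andP; split; nra.
  by rewrite leNgt ltr_cos // -leNgt ler_pM2l //; nra.
apply: le_trans (_ : 2 * M <= _).
  by rewrite (le_trans (ler_normB _ _)) // mulr_natl mulr2n lerD.
rewrite -[leLHS]add0r lerD ?(ltW e_gt0) //.
rewrite /K -mulrA ler_peMr ?mulr_ge0 // -ler_pdivrMl ?invr_gt0 // invrK mulr1; lra.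
Qed.

End PeriodicModulus.

(** * Integration over one period *)

Section TorusIntegral.
Local Open Scope complex_scope.
Variable R : realType.
Local Notation C := R[i].
Local Notation ee := (@ee R).
Local Notation re := (@complex.Re R).
Local Notation im := (@complex.Im R).
Local Notation mu := (@lebesgue_measure R).

Definition intT (F : R -> R) : R := Rintegral mu `[0, 1[ F.

Lemma continuous_integrableT (F : R -> R) : continuous F ->
  mu.-integrable `[0, 1[ (EFin \o F).
Proof.
move=> Fc; apply: (@integrableS _ _ _ mu `[0, 1]) => //.
  by apply: subset_itvl; rewrite bnd_simp.
apply: continuous_compact_integrable; first exact: segment_compact.
exact: continuous_subspaceT.
Qed.

Lemma intT_cst (a : R) : intT (fun=> a) = a.
Proof.
rewrite /intT Rintegral_cst //= lebesgue_measure_itv /= lte01 oppr0 adde0 /= mulr1 //.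
Qed.

Lemma intTD (F G : R -> R) : continuous F -> continuous G ->
  intT (fun x => F x + G x) = intT F + intT G.
Proof. by move=> Fc Gc; apply: RintegralD => //; exact: continuous_integrableT. Qed.

Lemma intTB (F G : R -> R) : continuous F -> continuous G ->
  intT (fun x => F x - G x) = intT F - intT G.
Proof. by move=> Fc Gc; apply: RintegralB => //; exact: continuous_integrableT. Qed.

Lemma intTZ a (F : R -> R) : continuous F -> intT (fun x => a * F x) = a * intT F.
Proof. by move=> Fc; apply: RintegralZl => //; exact: continuous_integrableT. Qed.

Lemma le_intT (F G : R -> R) : continuous F -> continuous G -> (forall x, F x <= G x) ->
  intT F <= intT G.
Proof. by move=> Fc Gc FG; apply: le_Rintegral => //; exact: continuous_integrableT. Qed.

Lemma intT_norm_le (F : R -> R) a : continuous F -> (forall x, `|F x| <= a) -> `|intT F| <= a.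
Proof.
move=> Fc Fa; rewrite ler_norml -{1}(intT_cst (- a)) -{2}(intT_cst a) !le_intT //;
  try exact: cst_continuous.
  by move=> x; have := Fa x; rewrite ler_norml => /andP[].
by move=> x; have := Fa x; rewrite ler_norml => /andP[].
Qed.

Lemma intT_FTC (f F : R -> R) : continuous f -> (forall x : R, is_derive x 1 F (f x)) ->
  intT f = F 1 - F 0.
Proof.
move=> fc Ff; rewrite /intT Rintegral_itv_bndo_bndc; last exact: continuous_integrableT.
have Fder x : derivable F x 1 by have Hx := Ff x; exact: ex_derive.
have Fc : continuous F by move=> x; exact/differentiable_continuous/derivable1_diffP/Fder.
rewrite /Rintegral (@continuous_FTC2 _ f F) //.
- exact: continuous_subspaceT.
- split.
  + by move=> x _.
  + by apply: cvg_at_right_filter; exact: Fc.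
  + by apply: cvg_at_left_filter; exact: Fc.
- by move=> x _; rewrite derive1E derive_val.
Qed.

Lemma continuous_cos_freq (a : R) : continuous (fun x => cos (a * x)).
Proof.
move=> x; apply: continuous_comp; last exact: continuous_cos.
by apply: cvgM; [exact: cvg_cst|exact: cvg_id].
Qed.

Lemma continuous_sin_freq (a : R) : continuous (fun x => sin (a * x)).
Proof.
move=> x; apply: continuous_comp; last exact: continuous_sin.
by apply: cvgM; [exact: cvg_cst|exact: cvg_id].
Qed.


Lemma is_derive_lin (w x : R) : is_derive x 1 (fun y : R => w * y) w.
Proof.
have : is_derive x 1 (w \*: (@idfun R)) (w *: 1) by exact: is_deriveZ.
by rewrite /GRing.scale /= mulr1.
Qed.

Lemma is_derive_sin_freq (w x : R) : w != 0 ->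
  is_derive x 1 (fun y : R => w^-1 * sin (w * y)) (cos (w * x)).
Proof.
move=> w_neq0; have h1 := is_derive_lin w x.
have h2 : is_derive x 1 (sin \o (fun y : R => w * y)) (cos (w * x) * w).
  exact: is_derive1_comp.
have : is_derive x 1 (w^-1 \*: (sin \o (fun y : R => w * y))) (w^-1 *: (cos (w * x) * w)).
  exact: is_deriveZ.
by rewrite /GRing.scale /= mulrCA mulVf ?mulr1.
Qed.

Lemma is_derive_cos_freq (w x : R) : w != 0 ->
  is_derive x 1 (fun y : R => - w^-1 * cos (w * y)) (sin (w * x)).
Proof.
move=> w_neq0; have h1 := is_derive_lin w x.
have h2 : is_derive x 1 (cos \o (fun y : R => w * y)) (- sin (w * x) * w).
  exact: is_derive1_comp.
have : is_derive x 1 (- w^-1 \*: (cos \o (fun y : R => w * y))) (- w^-1 *: (- sin (w * x) * w)).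
  exact: is_deriveZ.
by rewrite /GRing.scale /= mulNr mulNr mulrN opprK mulrCA mulVf ?mulr1.
Qed.

Lemma intT_cos (k : int) : intT (fun x => cos (2 * pi * (k%:~R * x))) = (k == 0)%:R.
Proof.
have [->|k_neq0] := eqVneq k 0.
  rewrite -[RHS]/1 -[RHS](intT_cst 1); congr intT; apply/funext => x.
  by rewrite mul0r mulr0 cos0.
pose w : R := 2 * pi * k%:~R.
have w_neq0 : w != 0.
  by rewrite mulf_neq0 ?intr_eq0 // mulf_neq0 ?pnatr_eq0 // gt_eqF ?pi_gt0.
transitivity (intT (fun x => cos (w * x))).
  by congr intT; apply/funext => x; rewrite /w mulrA.
rewrite (intT_FTC (@continuous_cos_freq w) (fun x => is_derive_sin_freq x w_neq0)).
have : ee k%:~R = 1 by rewrite ee_int.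
by rewrite mulr1 mulr0 sin0 mulr0 subr0 /ee -/w => -[_ ->]; rewrite mulr0.
Qed.

Lemma intT_sin (k : int) : intT (fun x => sin (2 * pi * (k%:~R * x))) = 0.
Proof.
have [->|k_neq0] := eqVneq k 0.
  rewrite -[RHS](intT_cst 0); congr intT; apply/funext => x.
  by rewrite mul0r mulr0 sin0.
pose w : R := 2 * pi * k%:~R.
have w_neq0 : w != 0.
  by rewrite mulf_neq0 ?intr_eq0 // mulf_neq0 ?pnatr_eq0 // gt_eqF ?pi_gt0.
transitivity (intT (fun x => sin (w * x))).
  by congr intT; apply/funext => x; rewrite /w mulrA.
rewrite (intT_FTC (@continuous_sin_freq w) (fun x => is_derive_cos_freq x w_neq0)).
have : ee k%:~R = 1 by rewrite ee_int.
by rewrite mulr1 mulr0 cos0 /ee -/w => -[-> _]; rewrite subrr.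
Qed.

Definition tmean (s : seq (C * int)) : C := \sum_(t <- s) (if t.2 == 0 then t.1 else 0).

Lemma continuous_tpoly s : continuous (fun x => re (tpoly s x)) /\
  continuous (fun x => im (tpoly s x)).
Proof.
elim: s => [|t s [IHr IHi]].
  by split; rewrite (_ : (fun x => _) = fun=> 0); try exact: cst_continuous;
    apply/funext => x; rewrite /tpoly big_nil.
have cc := @continuous_cos_freq (2 * pi * t.2%:~R).
have cs := @continuous_sin_freq (2 * pi * t.2%:~R).
split.
  rewrite (_ : (fun x => _) = fun x => re t.1 * cos (2 * pi * t.2%:~R * x)
     - im t.1 * sin (2 * pi * t.2%:~R * x) + re (tpoly s x)); last first.
    by apply/funext => x; rewrite /tpoly big_cons reD reM /= mulrA.
  move=> x; apply: cvgD; last exact: IHr.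
  by apply: cvgB; apply: cvgM; [exact: cvg_cst|exact: cc|exact: cvg_cst|exact: cs].
rewrite (_ : (fun x => _) = fun x => re t.1 * sin (2 * pi * t.2%:~R * x)
     + im t.1 * cos (2 * pi * t.2%:~R * x) + im (tpoly s x)); last first.
  by apply/funext => x; rewrite /tpoly big_cons imD imM /= mulrA.
move=> x; apply: cvgD; last exact: IHi.
by apply: cvgD; apply: cvgM; [exact: cvg_cst|exact: cs|exact: cvg_cst|exact: cc].
Qed.

Lemma intT_tpoly s : intT (fun x => re (tpoly s x)) = re (tmean s) /\
  intT (fun x => im (tpoly s x)) = im (tmean s).
Proof.
elim: s => [|t s [IHr IHi]].
  by split; rewrite /tmean big_nil -[RHS](intT_cst 0); congr intT;
    apply/funext => x; rewrite /tpoly big_nil.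
have [cr ci] := continuous_tpoly s.
have cc : continuous (fun x : R => cos (2 * pi * (t.2%:~R * x))).
  by have := @continuous_cos_freq (2 * pi * t.2%:~R); under eq_fun do rewrite -mulrA.
have cs : continuous (fun x : R => sin (2 * pi * (t.2%:~R * x))).
  by have := @continuous_sin_freq (2 * pi * t.2%:~R); under eq_fun do rewrite -mulrA.
have cM (a : R) (f : R -> R) : continuous f -> continuous (fun x => a * f x).
  by move=> fc x; apply: cvgM; [exact: cvg_cst|exact: fc].
have cB (f g : R -> R) : continuous f -> continuous g -> continuous (fun x => f x - g x).
  by move=> fc gc x; apply: cvgB; [exact: fc|exact: gc].
have cD (f g : R -> R) : continuous f -> continuous g -> continuous (fun x => f x + g x).
  by move=> fc gc x; apply: cvgD; [exact: fc|exact: gc].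
have mE : tmean (t :: s) = (if t.2 == 0 then t.1 else 0) + tmean s by rewrite /tmean big_cons.
rewrite mE reD imD -IHr -IHi; split.
  rewrite (_ : (fun x => _) = fun x => (re t.1 * cos (2 * pi * (t.2%:~R * x))
     - im t.1 * sin (2 * pi * (t.2%:~R * x))) + re (tpoly s x)); last first.
    by apply/funext => x; rewrite /tpoly big_cons reD reM.
  rewrite intTD ?intTB ?intTZ ?intT_cos ?intT_sin; do ?[exact: cM|apply: cB|exact: cr] => //.
  by congr (_ + _); case: eqP => _; rewrite ?mulr1 ?mulr0 subr0.
rewrite (_ : (fun x => _) = fun x => (re t.1 * sin (2 * pi * (t.2%:~R * x))
     + im t.1 * cos (2 * pi * (t.2%:~R * x))) + im (tpoly s x)); last first.
  by apply/funext => x; rewrite /tpoly big_cons imD imM.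
rewrite intTD ?(@intTD (fun x => re t.1 * _)) ?intTZ ?intT_cos ?intT_sin;
  do ?[exact: cM|apply: cD|exact: ci] => //.
by congr (_ + _); case: eqP => _; rewrite ?mulr1 ?mulr0 add0r.
Qed.

Lemma norm_parts (z : C) : `|z| <= (`|re z| + `|im z|)%:C.
Proof.
case: z => x y; have -> : Complex x y = x%:C + 'i * y%:C.
  by apply: complex_eqP; rewrite ?reD ?imD ?reM ?imM /=; lra.
apply: le_trans (ler_normD _ _) _; rewrite normrM (_ : `|'i| = 1) ?mul1r; last by rewrite normc_def /= expr0n expr1n add0r sqrtr1.
by rewrite !normc_def /= !expr0n !addr0 !sqrtr_sqr -rmorphD /= ?mul0r ?mul1r ?add0r ?subr0.
Qed.

Lemma parts_norm (z : C) (a : R) : `|z| <= a%:C -> `|re z| <= a /\ `|im z| <= a.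
Proof.
rewrite normc_def lecR => za.
have a_ge0 : 0 <= a by apply: le_trans za; rewrite sqrtr_ge0.
have := lerXn2r 2 _ _ za; rewrite !nnegrE sqrtr_ge0 a_ge0 => /(_ isT isT).
rewrite sqr_sqrtr ?addr_ge0 ?sqr_ge0 // => h.
have hr := sqr_ge0 (re z); have hi := sqr_ge0 (im z).
by split; rewrite -(@ler_pXn2r _ 2) ?nnegrE // real_normK ?num_real //; lra.
Qed.

(** Real and imaginary parts are bounded separately, whence the doubled error. *)
Lemma intT_approx (F : R -> R) s e : continuous F ->
  (forall x, `|(F x)%:C - tpoly s x| <= e%:C) ->
  `|(intT F)%:C - tmean s| <= (e + e)%:C.
Proof.
move=> Fc Fs; have [cr ci] := continuous_tpoly s; have [ir ii] := intT_tpoly s.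
apply: le_trans (norm_parts _) _; rewrite lecR lerD //.
  rewrite reD /= reN -ir -intTB //; apply: intT_norm_le.
    by move=> x; apply: cvgB; [exact: Fc|exact: cr].
  by move=> x; have [h _] := parts_norm (Fs x); move: h; rewrite reD /= reN.
rewrite imD /= add0r imN -ii normrN; apply: intT_norm_le => // x.
by have [_] := parts_norm (Fs x); rewrite imD /= add0r imN normrN.
Qed.

End TorusIntegral.

(** * Equidistribution *)

Section Equidistribution.
Local Open Scope complex_scope.
Variable R : realType.
Local Notation C := R[i].
Local Notation ee := (@ee R).
Local Notation wmean := (@wmean R).
Implicit Types S : nat -> Prop.

Lemma sum_coprime1 q : (\sum_(p < q | coprime p q) 1 = totient q)%N.
Proof.
rewrite totient_count_coprime big_mkord big_mkcond /=; apply: eq_bigr => p _.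
by rewrite coprime_sym; case: coprime.
Qed.

Lemma norm_real_complex (x : R) : `|x%:C| = `|x|%:C.
Proof. by rewrite normc_def /= expr0n addr0 sqrtr_sqr. Qed.

Definition rmean (q : nat) (F : nat -> R) : R :=
  (\sum_(p < q | coprime p q) F p) / (totient q)%:R.

Lemma rmean_wmean q F : (rmean q F)%:C = wmean q (fun p => (F p)%:C).
Proof. by rewrite /rmean /wmean rmorphM rmorph_sum fmorphV rmorph_nat. Qed.

Lemma wmean_norm_le q (F : nat -> C) (a : R) : (0 < q)%N ->
  (forall p, coprime p q -> `|F p| <= a%:C) -> `|wmean q F| <= a%:C.
Proof.
move=> q_gt0 Fa; rewrite /wmean normrM normfV normr_nat ler_pdivrMr ?ltr0n ?totient_gt0 //.
apply: le_trans (ler_norm_sum _ _ _) _.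
apply: le_trans (_ : \sum_(p < q | coprime p q) a%:C <= _).
  by apply: ler_sum => p; exact: Fa.
by rewrite sumr_const -[leLHS]mulr_natr -sum_coprime1 sum1_card.
Qed.

Lemma wmeanD q (F G : nat -> C) : wmean q (fun p => F p + G p) = wmean q F + wmean q G.
Proof. by rewrite /wmean big_split mulrDl. Qed.

Lemma wmeanB q (F G : nat -> C) : wmean q (fun p => F p - G p) = wmean q F - wmean q G.
Proof. by rewrite /wmean sumrB mulrBl. Qed.

Lemma wmeanZ q a (F : nat -> C) : wmean q (fun p => a * F p) = a * wmean q F.
Proof. by rewrite /wmean -mulr_sumr mulrA. Qed.

Definition lim_along S (u : nat -> C) (l : C) := forall e : R, 0 < e ->
  exists N : nat, forall q, (N <= q)%N -> S q -> `|u q - l| <= e%:C.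

Lemma lim_alongD S u v l m : lim_along S u l -> lim_along S v m ->
  lim_along S (fun q => u q + v q) (l + m).
Proof.
move=> ul vm e e_gt0; have e2 : 0 < e / 2 by rewrite divr_gt0.
have [N1 N1P] := ul _ e2; have [N2 N2P] := vm _ e2.
exists (maxn N1 N2) => q; rewrite geq_max => /andP[q1 q2] Sq.
rewrite opprD addrACA (le_trans (ler_normD _ _)) //.
have -> : e%:C = (e / 2)%:C + (e / 2)%:C by rewrite -rmorphD /=; congr (_%:C); lra.
by rewrite lerD ?N1P ?N2P.
Qed.

Lemma lim_alongZ S a u l : lim_along S u l -> lim_along S (fun q => a * u q) (a * l).
Proof.
move=> ul e e_gt0; pose A := `|complex.Re a| + `|complex.Im a| + 1.
have A_gt0 : 0 < A by rewrite ltr_wpDl ?addr_ge0.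
have [N NP] := ul (e / A) (divr_gt0 e_gt0 A_gt0).
exists N => q qN Sq; rewrite -mulrBr normrM.
have -> : e%:C = A%:C * (e / A)%:C by rewrite -rmorphM /= mulrCA divff ?mulr1 ?gt_eqF.
rewrite ler_pM ?NP // (le_trans (norm_parts _)) // lecR lerDl //.
Qed.

Lemma eq_lim_along S u v l : (forall q, (1 < q)%N -> S q -> u q = v q) ->
  lim_along S u l -> lim_along S v l.
Proof.
move=> uv ul e /ul[N NP]; exists (maxn 2 N) => q; rewrite geq_max => /andP[q1 qN] Sq.
by rewrite -uv // NP.
Qed.

Lemma lim_along0 S : lim_along S (fun=> 0) 0.
Proof. by move=> e e_gt0; exists 0%N => q _ _; rewrite subrr normr0 ler0c ltW. Qed.

Lemma pow_bound_le (n q K : nat) (T : C) (e : R) : (0 < n)%N -> (0 < q)%N -> 0 <= T -> 0 <= e ->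
  q%:R * T ^+ n <= K%:R -> K%:R <= q%:R * e ^+ n -> T <= e%:C.
Proof.
move=> n_gt0 q_gt0 T_ge0 e_ge0 hT; rewrite -lecR rmorphM rmorphXn !rmorph_nat /= => /(le_trans hT).
by rewrite ler_pM2l ?ltr0n // ler_pXn2r // nnegrE ?ler0c.
Qed.

Lemma tpoly_cons (a : C) (k : int) s x : tpoly ((a, k) :: s) x = a * ee (k%:~R * x) + tpoly s x.
Proof. by rewrite /tpoly big_cons. Qed.

(** Collects what equidistribution asks of a weight: a twisted sign, a multiplier with bounded
    annihilator, and a mean d, which will be 1 for the constant weight and 0 for the others. *)
Definition admissible S (b : nat -> int) (c : nat -> nat -> R) (d : R) :=
  forall q, (1 < q)%N -> S q ->
  [/\ twisted q (c q), (#|[set v : 'Z_q | ((b q)%:~R * v == 0)%R]%SET| <= 2)%N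
    & \sum_(p < q | coprime p q) c q p = d * (totient q)%:R].

Variables (S : nat -> Prop) (b : nat -> int) (c : nat -> nat -> R) (d : R).
Hypotheses (adm : admissible S b c d) (d_le1 : `|d| <= 1).

Definition xpt (q p : nat) : R := (b q * (zinv q p)%:Z)%:~R / q%:R.

Lemma weyl_lim (m n : int) :
  lim_along S (fun q => wmean q (fun p =>
      (c q p)%:C * (ee (m%:~R * (p%:R / q%:R)) * ee (n%:~R * xpt q p))))
    (d%:C * ((m == 0)%:R * (n == 0)%:R)).
Proof.
have [mn0|mn_neq0] := boolP ((m == 0) && (n == 0)).
  case/andP: mn0 => /eqP -> /eqP ->; rewrite eqxx !mulr1 => e e_gt0.
  exists 2%N => q q_gt1 Sq; have [_ _ sc] := adm q_gt1 Sq.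
  have -> : wmean q (fun p => (c q p)%:C * (ee (0%:~R * (p%:R / q%:R)) * ee (0%:~R * xpt q p)))
      = d%:C.
    rewrite /wmean; under eq_bigr do rewrite !mul0r ee0 !mulr1.
    rewrite -rmorph_sum /= sc rmorphM rmorph_nat mulfK // pnatr_eq0 -lt0n totient_gt0.
    exact: ltnW.
  by rewrite subrr normr0 ler0c ltW.
have -> : (m == 0)%:R * (n == 0)%:R = 0 :> C by rewrite -natrM mulnb (negPf mn_neq0).
move=> e e_gt0; rewrite mulr0.
rewrite negb_and in mn_neq0; have [K KP] := @weyl_bound R 2 m n mn_neq0.
have e24 : 0 < e ^+ 24 by rewrite exprn_gt0.
(* Beyond K / e^24 the estimate q T^24 <= K forces T <= e. *)
exists (maxn 2 (Num.trunc (K%:R / e ^+ 24)).+1) => q.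
rewrite geq_max => /andP[q_gt1 qK] Sq; have [tw ann _] := adm q_gt1 Sq.
have := KP q (c q) (b q) q_gt1 tw ann; rewrite subr0; set T := `|_| => hT.
have T_ge0 : 0 <= T by exact: normr_ge0.
have q_gt0 : 0 < q%:R :> R by rewrite ltr0n ltnW.
have KE : K%:R <= q%:R * e ^+ 24.
  rewrite -ler_pdivrMr //; apply: le_trans (ltW (truncnS_gt _)) _.
  by rewrite ler_nat.
by apply: (pow_bound_le _ _ T_ge0 (ltW e_gt0) hT KE) => //; exact: ltnW.
Qed.

Lemma tpoly_lim s t :
  lim_along S (fun q => wmean q (fun p =>
      (c q p)%:C * (tpoly s (p%:R / q%:R) * tpoly t (xpt q p))))
    (d%:C * (tmean s * tmean t)).
Proof.
elim: s => [|[a m] s IHs].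
  rewrite /tmean big_nil mul0r mulr0; apply: eq_lim_along (@lim_along0 S) => q _ _.
  by rewrite /wmean big1 ?mul0r // => p _; rewrite /tpoly big_nil mul0r mulr0.
have IH1 : lim_along S (fun q => wmean q (fun p =>
      (c q p)%:C * (ee (m%:~R * (p%:R / q%:R)) * tpoly t (xpt q p))))
    (d%:C * ((m == 0)%:R * tmean t)).
  elim: t {IHs} => [|[a' n] t IHt].
    rewrite /tmean big_nil !mulr0; apply: eq_lim_along (@lim_along0 S) => q _ _.
    by rewrite /wmean big1 ?mul0r // => p _; rewrite /tpoly big_nil !mulr0.
  have -> : d%:C * ((m == 0)%:R * tmean ((a', n) :: t)) =
     a' * (d%:C * ((m == 0)%:R * (n == 0)%:R)) + d%:C * ((m == 0)%:R * tmean t).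
    have -> : tmean ((a', n) :: t) = a' * (n == 0)%:R + tmean t.
      by rewrite /tmean big_cons /=; case: (n == 0); rewrite ?mulr1 ?mulr0.
    by ring.
  apply: eq_lim_along (lim_alongD (lim_alongZ a' (weyl_lim m n)) IHt) => q _ _.
  rewrite -wmeanZ -wmeanD; congr (_ / _); apply: eq_bigr => p _.
  rewrite tpoly_cons; ring.
have -> : d%:C * (tmean ((a, m) :: s) * tmean t) =
   a * (d%:C * ((m == 0)%:R * tmean t)) + d%:C * (tmean s * tmean t).
  have -> : tmean ((a, m) :: s) = a * (m == 0)%:R + tmean s.
    by rewrite /tmean big_cons /=; case: (m == 0); rewrite ?mulr1 ?mulr0.
  by ring.
apply: eq_lim_along (lim_alongD (lim_alongZ a IH1) IHs) => q _ _.
rewrite -wmeanZ -wmeanD; congr (_ / _); apply: eq_bigr => p _.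
rewrite tpoly_cons; ring.
Qed.

(** eta ranges up to 2 because integrals are approximated only within eta + eta; the bound is 2 M
    eta + eta^2 <= 4 M eta. *)
Lemma mul_approx (h F : R) (t t' : C) (M eta : R) : 1 <= M -> 0 <= eta <= 2 ->
  `|h| <= M -> `|F| <= M -> `|h%:C - t| <= eta%:C -> `|F%:C - t'| <= eta%:C ->
  `|(h * F)%:C - t * t'| <= (4 * M * eta)%:C.
Proof.
move=> M1 eta01 hM FM ht Ft.
have -> : (h * F)%:C - t * t' = (h%:C - t) * F%:C + t * (F%:C - t').
  by rewrite rmorphM /=; ring.
apply: le_trans (ler_normD _ _) _; rewrite !normrM.
have tM : `|t| <= (M + eta)%:C.
  have -> : t = h%:C - (h%:C - t) by ring.
  apply: le_trans (ler_normB _ _) _; rewrite rmorphD lerD //.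
  by rewrite norm_real_complex lecR.
apply: le_trans (_ : eta%:C * M%:C + (M + eta)%:C * eta%:C <= _).
  by rewrite lerD // ler_pM // norm_real_complex lecR.
rewrite -!rmorphM -rmorphD lecR /=.
have : 0 <= (2 - eta) * eta by apply: mulr_ge0; lra.
nra.
Qed.

Lemma equidistribution (h F : R -> R) : continuous h -> continuous F ->
  periodic1 h -> periodic1 F ->
  cvg_along S (fun q => rmean q (fun p => c q p * (h (p%:R / q%:R) * F (xpt q p))))
    (d * (intT h * intT F)).
Proof.
move=> hc Fc h1 F1 e e_gt0.
have [Mh Mh_ge0 hM] := periodic_bounded hc h1.
have [MF MF_ge0 FM] := periodic_bounded Fc F1.
pose M := 1 + Mh + MF; have M1 : 1 <= M by rewrite /M; lra.
(* The errors 4 M eta, e/4 and 8 M eta then add up to at most 5e/8. *)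
pose eta := Num.min 1 (e / (32 * M)).
have M_gt0 : 0 < M by lra.
have eta_gt0 : 0 < eta by rewrite lt_min ltr01 divr_gt0 ?mulr_gt0.
have eta1 : eta <= 1 by rewrite ge_min lexx.
have etae : M * eta <= e / 32.
  have : eta <= e / (32 * M) by rewrite ge_min lexx orbT.
  rewrite ler_pdivlMr ?mulr_gt0 //; lra.
have [s sP] := fejer_approx (periodic_modulus hc h1) eta_gt0.
have [t tP] := fejer_approx (periodic_modulus Fc F1) eta_gt0.
have [N NP] := tpoly_lim s t (divr_gt0 e_gt0 (ltr0n _ 4)).
exists (maxn 2 N) => q; rewrite geq_max => /andP[q_gt1 qN] Sq.
have [[_ c_sqr _] _ _] := adm q_gt1 Sq.
have := NP q qN Sq; set T := wmean q _ => hT.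
have hA : `|(rmean q (fun p => c q p * (h (p%:R / q%:R) * F (xpt q p))))%:C - T|
    <= (4 * M * eta)%:C.
  rewrite rmean_wmean -wmeanB; apply: wmean_norm_le => [|p co_pq]; first exact: ltnW.
  rewrite rmorphM -mulrBr normrM.
  have -> : `|(c q p)%:C| = 1.
    by rewrite norm_real_complex; case: (sqr1_cases (c_sqr p co_pq)) => ->; rewrite ?normrN normr1.
  rewrite mul1r; apply: mul_approx => //; first by rewrite ltW //=; lra.
    by apply: le_trans (hM _) _; rewrite /M; lra.
  by apply: le_trans (FM _) _; rewrite /M; lra.
have hB : `|(d * (intT h * intT F))%:C - d%:C * (tmean s * tmean t)| <= (4 * M * (eta + eta))%:C.
  rewrite rmorphM -mulrBr normrM -[leRHS]mul1r ler_pM //.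
    by rewrite norm_real_complex -[1]/(1%:C) lecR.
  apply: mul_approx => //; first by lra.
  - by apply: le_trans (intT_norm_le hc hM) _; rewrite /M; lra.
  - by apply: le_trans (intT_norm_le Fc FM) _; rewrite /M; lra.
  - exact: intT_approx.
  - exact: intT_approx.
rewrite -ltcR -norm_real_complex rmorphB /=.
set A := (rmean _ _)%:C in hA *; set B := (d * _)%:C in hB *; set L := d%:C * _ in hB hT *.
have -> : A - B = (A - T) + ((T - L) - (B - L)) by ring.
apply: le_lt_trans (ler_normD _ _) _.
apply: le_lt_trans (lerD hA (le_trans (ler_normB _ _) (lerD hT hB))) _.
rewrite -!rmorphD ltcR /=; lra.
Qed.

End Equidistribution.

(** * Jordan measurable sets *)

Section Tent.
Variable R : realType.
Implicit Types (A D : set R) (x y : R) (n : nat).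
Local Notation mu := (@lebesgue_measure R).

(** [tent] is max (0, 1 - n dist(x, A)); the element 0 cuts it off below and keeps the set nonempty
    when A is empty. *)
Definition tent_set A n x : set R :=
  [set r | r = 0 \/ exists2 a, A a & r = 1 - n%:R * `|x - a|].

Definition tent A n x : R := sup (tent_set A n x).

Lemma tent_set_ubound A n x : ubound (tent_set A n x) 1.
Proof. by move=> r [->|[a _ ->]]; rewrite ?ler01 // gerBl mulr_ge0. Qed.

Lemma le_tent A n x r : tent_set A n x r -> r <= tent A n x.
Proof. by move=> Er; apply: ub_le_sup => //; exists 1; exact: tent_set_ubound. Qed.

Lemma tent_le A n x r : ubound (tent_set A n x) r -> tent A n x <= r.
Proof. by move=> Er; apply: ge_sup => //; exists 0; left. Qed.

Lemma tent_ge0 A n x : 0 <= tent A n x.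
Proof. by apply: le_tent; left. Qed.

Lemma tent_le1 A n x : tent A n x <= 1.
Proof. by apply: tent_le; exact: tent_set_ubound. Qed.

Lemma tent_in A n x : A x -> tent A n x = 1.
Proof.
move=> Ax; apply/eqP; rewrite eq_le tent_le1; apply: le_tent; right.
by exists x => //; rewrite subrr normr0 mulr0 subr0.
Qed.

Lemma tent_lip A n x y : tent A n x <= tent A n y + n%:R * `|x - y|.
Proof.
apply: tent_le => r [->|[a Aa ->]]; first by rewrite addr_ge0 ?tent_ge0 ?mulr_ge0.
apply: le_trans (_ : (1 - n%:R * `|y - a|) + n%:R * `|x - y| <= _); last first.
  by rewrite lerD2r; apply: le_tent; right; exists a.
have : `|y - a| <= `|x - a| + `|x - y|.
  have -> : y - a = (x - a) - (x - y) by ring.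
  exact: ler_normB.
by move=> /(ler_wpM2l (ler0n R n)); lra.
Qed.

Lemma tent_dist A n x y : `|tent A n x - tent A n y| <= n%:R * `|x - y|.
Proof.
have h1 := tent_lip A n x y; have h2 := tent_lip A n y x; rewrite distrC in h2.
by rewrite ler_norml; lra.
Qed.

Lemma tent_continuous A n : continuous (tent A n).
Proof.
move=> x; apply/cvgrPdist_le => e e_gt0.
have n1 : 0 < n%:R + 1 :> R by rewrite ltr_wpDl.
near=> y; apply: le_trans (tent_dist _ _ _ _) _.
have : `|x - y| < e / (n%:R + 1).
  by near: y; exists (e / (n%:R + 1)) => //=; rewrite divr_gt0.
rewrite ltr_pdivlMr // => h.
have : 0 <= `|x - y| by []. 
lra.
Unshelve. all: by end_near. Qed.

Lemma tent_periodic A n : (forall x, A x <-> A (x + 1)) -> periodic1 (tent A n).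
Proof.
move=> A1 x; congr sup; apply/seteqP; split => r [->|[a Aa ->]]; try by left.
  right; exists (a - 1); first by apply: (A1 _).2; rewrite subrK.
  by congr (1 - _ * `|_|); ring.
right; exists (a + 1); first exact: (A1 _).1.
by congr (1 - _ * `|_|); ring.
Qed.

Lemma tent_closure A n x : closure A x -> tent A n x = 1.
Proof.
move=> Ax; apply/eqP; rewrite eq_le tent_le1 /= leNgt; apply/negP => lt1.
have n1 : 0 < n%:R + 1 :> R by rewrite ltr_wpDl.
pose d := (1 - tent A n x) / (n%:R + 1).
have d_gt0 : 0 < d by rewrite divr_gt0 // subr_gt0.
have [|a [Aa /= xa]] := Ax (ball x d); first exact: nbhsx_ballx.
have : 1 - n%:R * `|x - a| <= tent A n x by apply: le_tent; right; exists a.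
move: xa; rewrite /ball /= /d ltr_pdivlMr // => xa h.
have : 0 <= `|x - a| by [].
lra.
Qed.

Lemma tent_cvg0 A x : ~ closure A x -> tent A n x @[n --> \oo] --> (0 : R).
Proof.
move=> nA; have : nbhs x (~` closure A).
  by apply: open_nbhs_nbhs; split => //; apply: closed_openC; exact: closed_closure.
move=> [d /= d_gt0 dP]; apply/cvgrPdist_le => e e_gt0.
near=> n; rewrite sub0r normrN ger0_norm ?tent_ge0 //.
apply: le_trans (ltW e_gt0); apply: tent_le => r [->//|[a Aa ->]].
rewrite subr_le0.
have xa : d <= `|x - a|.
  rewrite leNgt; apply/negP => xa; apply: (dP a) => //.
  exact: subset_closure.
apply: le_trans (_ : n%:R * d <= _); last by rewrite ler_wpM2l.
rewrite -ler_pdivrMr //; near: n; exact: nbhs_infty_ger.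
Unshelve. all: by end_near. Qed.

(** The indicator of D lies between 1 minus the tent of the complement and the tent of D. Their gap
    tends to 0 off the boundary and is bounded by 1, so dominated convergence applies. *)
Lemma intT_tent_gap D : (forall x, D x <-> D (x + 1)) ->
  mu (boundary D `&` `[0, 1[) = 0%E ->
  intT (fun x => tent D n x + tent (~` D) n x - 1) @[n --> \oo] --> (0 : R).
Proof.
move=> D1 bD0.
pose f n x := (tent D n x + tent (~` D) n x - 1).
have f_cont n : continuous (f n).
  move=> x; apply: cvgB; last exact: cvg_cst.
  by apply: cvgD; exact: tent_continuous.
have f_cvg x : ~ boundary D x -> f n x @[n --> \oo] --> (0 : R).
  move=> nb; have [Dx|nDx] := pselect (closure D x); last first.
    have nx : (~` D) x by move=> Dx; apply: nDx; exact: subset_closure.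
    have -> : (fun n => f n x) = (fun n => tent D n x).
      by apply/funext => n; rewrite /f (tent_in n nx) addrK.
    exact: tent_cvg0.
  have intx : interior D x by apply: contrapT => nx; apply: nb.
  have ncx : ~ closure (~` D) x by rewrite closure_setC; apply.
  have -> : (fun n => f n x) = (fun n => tent (~` D) n x).
    by apply/funext => n; rewrite /f tent_in ?[1 + _]addrC ?addrK //; exact: interior_subset.
  exact: tent_cvg0.
have mI : measurable (`[0, 1[%classic : set R) by [].
have mB : measurable (boundary D `&` `[0, 1[ : set R).
  apply: measurableI => //; apply: measurableD.
    by apply: closed_measurable; exact: closed_closure.
  by apply: open_measurable; exact: open_interior.
have f_le1 n x : `|f n x| <= 1.
  have := tent_ge0 D n x; have := tent_le1 D n x.
  have := tent_ge0 (~` D) n x; have := tent_le1 (~` D) n x.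
  have : tent D n x = 1 \/ tent (~` D) n x = 1.
    have [Dx|nDx] := pselect (D x); [left|right]; exact: tent_in.
  by rewrite ler_norml /f => -[->|->]; lra.
have ae_cvg : {ae mu, forall x, `[0, 1[%classic x -> (f n x)%:E @[n --> \oo] --> (0%E : \bar R)}.
  exists (boundary D `&` `[0, 1[); split => // x /= /not_implyP[Ix ncv]; split => //.
  apply: contrapT => nb; apply: ncv; apply: cvg_EFin; first exact: nearW.
  exact: f_cvg.
have ae_le : {ae mu, forall x n, `[0, 1[%classic x -> (`|(f n x)%:E| <= (1 : R)%:E)%E}.
  by apply: aeW => x n _; rewrite lee_fin.
have [_ _ cvgf] := @dominated_convergence _ _ R mu _ mI (fun n x => (f n x)%:E)
  (cst 0%E) (EFin \o cst 1) (fun n => measurable_int mu (continuous_integrableT (f_cont n)))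
  (measurable_cst _) ae_cvg (continuous_integrableT (@cst_continuous R R 1)) ae_le.
rewrite integral0 in cvgf.
exact: fine_cvg cvgf.
Qed.

(** All tents are 1 on the closure of D, a Borel set containing D; D itself may fail to be Borel,
    whence the completed measure. *)
Lemma intT_tent_pos D : (0 < completed_lebesgue_measure (D `&` `[0%R, 1%R[))%E ->
  exists2 l : R, 0 < l & forall n, l <= intT (tent D n).
Proof.
move=> D_gt0; have mI : measurable (`[0, 1[%classic : set R) by [].
have mC : measurable (closure D : set R) by apply: closed_measurable; exact: closed_closure.
have mCI : measurable (closure D `&` `[0, 1[ : set R) by exact: measurableI.
have pos : (0 < mu (closure D `&` `[0%R, 1%R[))%E.
  apply: lt_le_trans D_gt0 _; apply: le_outer_measure.
  by apply: setSI; exact: subset_closure.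
have fin : (mu (closure D `&` `[0%R, 1%R[) \is a fin_num)%E.
  have le1 : (mu (closure D `&` `[0%R, 1%R[) <= mu `[0%R, 1%R[)%E.
    by apply: le_measure; rewrite ?inE //; exact: subIsetr.
  rewrite ge0_fin_numE //; apply: le_lt_trans le1 _.
  by rewrite lebesgue_measure_itv /= lte01 oppr0 adde0 ltry.
exists (fine (mu (closure D `&` `[0%R, 1%R[))); first by rewrite fine_gt0 // pos -ge0_fin_numE.
move=> n; rewrite -lee_fin fineK // /intT /Rintegral fineK; last first.
  apply: integrable_fin_num => //; apply: continuous_integrableT; exact: tent_continuous.
have <- := integral_indic (mu : {measure set _ -> \bar R}) mI mC.
have mT : measurable_fun (`[0%R, 1%R[%classic : set (measurableTypeR R)) (EFin \o tent D n).
  by apply: (measurable_int mu); apply: continuous_integrableT; exact: tent_continuous.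
have mCf : measurable_fun (`[0%R, 1%R[%classic : set (measurableTypeR R)) (EFin \o (\1_(closure D) : R -> R)).
  by apply/measurable_EFinP; exact: measurable_indic.
apply: ge0_le_integral => // x _; rewrite lee_fin ?tent_ge0 // indicE.
have [/set_mem cx|_] := boolP (x \in closure D); last exact: tent_ge0.
by rewrite tent_closure.
Qed.

End Tent.

(** * Conditioning on p/q in D *)

Section ConditionalMean.
Local Open Scope complex_scope.
Variable R : realType.
Implicit Types (D : set R).

(** For q > 1 neither 0 nor q is coprime to q, so the ranges 1..q and 0..q-1 give the same sum. *)
Lemma sum_inP D q (G : nat -> R) : (1 < q)%N ->
  \sum_(p < q.+1 | inP D q p) G p =
  \sum_(p < q | coprime p q) (`[< D (p%:R / q%:R) >])%:R * G p.
Proof.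
move=> q_gt1; rewrite big_mkcond big_ord_recr /= /inP /coprime gcdnn -/(coprime _ _).
rewrite (gtn_eqF q_gt1) andbF addr0 [RHS]big_mkcond; apply: eq_bigr => p _ /=.
have [->|p_gt0] := posnP p; first by rewrite gcd0n (gtn_eqF q_gt1).
rewrite (ltnW (ltn_ord p)) /=; case: (gcdn p q == 1%N) => //=.
by case: asboolP; rewrite ?mul1r ?mul0r.
Qed.

Lemma unif_mean_rmean (T : Type) D q (G : nat -> T) (f : T -> R) : (1 < q)%N ->
  unif_mean D q G f =
  rmean q (fun p => (`[< D (p%:R / q%:R) >])%:R * f (G p)) /
  rmean q (fun p => (`[< D (p%:R / q%:R) >])%:R).
Proof.
move=> q_gt1; have t_neq0 : (totient q)%:R != 0 :> R.
  by rewrite pnatr_eq0 -lt0n totient_gt0 ltnW.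
rewrite /unif_mean /rmean (sum_inP D (fun p => f (G p))) // (sum_inP D (fun=> 1)) //.
under [X in _ / X = _]eq_bigr do rewrite mulr1.
by rewrite invf_div mulrA divfK.
Qed.

Lemma rmeanB q (F G : nat -> R) : rmean q (fun p => F p - G p) = rmean q F - rmean q G.
Proof. by rewrite /rmean sumrB mulrBl. Qed.

Lemma rmeanZ q a (F : nat -> R) : rmean q (fun p => a * F p) = a * rmean q F.
Proof. by rewrite /rmean -mulr_sumr mulrA. Qed.

Lemma rmean_norm_le q (F G : nat -> R) : (forall p, coprime p q -> `|F p| <= G p) ->
  `|rmean q F| <= rmean q G.
Proof.
move=> FG; rewrite /rmean normrM normfV normr_nat ler_wpM2r ?invr_ge0 //.
by apply: le_trans (ler_norm_sum _ _ _) _; apply: ler_sum => p; exact: FG.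
Qed.

Lemma twisted1 q : twisted q (fun=> 1 : R).
Proof.
by split=> // [p _|u _]; rewrite ?expr1n //; exists 1; rewrite ?expr1n // => p _; rewrite mul1r.
Qed.

Lemma admissible1 S b (c : nat -> nat -> R) d :
  admissible S b c d -> admissible S b (fun _ _ => 1 : R) 1.
Proof.
move=> adm q q_gt1 Sq; have [_ ann _] := adm q q_gt1 Sq; split => //; first exact: twisted1.
by rewrite mul1r -sum_coprime1 natr_sum.
Qed.

Variable D : set R.
Hypothesis D_per : forall x : R, D x <-> D (x + 1).
Hypothesis D_bnd : lebesgue_measure (boundary D `&` `[0%R, 1%R[) = 0%E.
Hypothesis D_pos : (0 < completed_lebesgue_measure (D `&` `[0%R, 1%R[))%E.

(** The indicator of D is replaced by the tent [h2] with a pointwise error at most w; the mean of w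
    is itself controlled by equidistribution, w being continuous. *)
Lemma conditional_equidistribution S b (c : nat -> nat -> R) d (F : R -> R) :
  admissible S b c d -> `|d| <= 1 -> continuous F -> periodic1 F ->
  cvg_along S (fun q =>
     rmean q (fun p => (`[< D (p%:R / q%:R) >])%:R * (c q p * F (xpt R b q p))) /
     rmean q (fun p => (`[< D (p%:R / q%:R) >])%:R))
  (d * intT F).
Proof.
move=> adm d1 Fc F1 e e_gt0; have adm1 := admissible1 adm.
have [M0 M0_ge0 FM0] := periodic_bounded Fc F1.
have [l l_gt0 lP] := intT_tent_pos D_pos.
pose M := M0 + 1; have M_gt0 : 0 < M by rewrite ltr_wpDl.
(* The denominator will be at least l - 3 eta >= l/2, and the error of the numerator at most (5M +
   1) eta <= e l / 4. *)
pose eta := Num.min (l / 6) (e * l / (4 * (5 * M + 1))).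
have K_gt0 : 0 < 5 * M + 1 by lra.
have eta_gt0 : 0 < eta by rewrite lt_min !divr_gt0 ?mulr_gt0.
have eta_l : eta <= l / 6 by rewrite ge_min lexx.
have eta_e : (5 * M + 1) * eta <= e * l / 4.
  have : eta <= e * l / (4 * (5 * M + 1)) by rewrite ge_min lexx orbT.
  rewrite ler_pdivlMr ?mulr_gt0 //; lra.
have /cvgrPdist_lt /(_ _ eta_gt0) [n0 _ n0P] := intT_tent_gap D_per D_bnd.
have {n0P} := n0P n0 (leqnn n0) => /=; rewrite sub0r normrN.
have DC_per x : (~` D) x <-> (~` D) (x + 1) by split => h Dx; apply: h; [exact: (D_per x).2|exact: (D_per x).1].
pose h2 := tent D n0; pose h1c := tent (~` D) n0; pose w x := h2 x + h1c x - 1.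
rewrite -/h2 -/h1c -/w => w_small.
have h2c : continuous h2 by exact: tent_continuous.
have h2p : periodic1 h2 by exact: tent_periodic.
have wc : continuous w.
  move=> x; apply: cvgB; last exact: cvg_cst.
  by apply: cvgD; exact: tent_continuous.
have wp : periodic1 w by move=> x; rewrite /w h2p /h1c (tent_periodic _ DC_per).
have onec : continuous (fun _ : R => 1 : R) by exact: cst_continuous.
have onep : periodic1 (fun _ : R => 1 : R) by [].
have one_le : `|1 : R| <= 1 by rewrite normr1.
have [N1 N1P] := equidistribution adm d1 h2c Fc h2p F1 eta_gt0.
have [N2 N2P] := equidistribution adm1 one_le h2c onec h2p onep eta_gt0.
have [N3 N3P] := equidistribution adm1 one_le wc onec wp onep eta_gt0.
exists (maxn (maxn N1 2) (maxn N2 N3)) => q.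
rewrite !geq_max => /andP[/andP[q1 q_gt1] /andP[q2 q3]] Sq.
have [[_ c_sqr _] _ _] := adm q q_gt1 Sq.
have e1 := N1P q q1 Sq; have e2 := N2P q q2 Sq; have e3 := N3P q q3 Sq.
move: e2 e3; rewrite intT_cst !mulr1 !mul1r.
have -> : rmean q (fun p => 1 * (h2 (p%:R / q%:R) * 1)) = rmean q (fun p => h2 (p%:R / q%:R)).
  by congr rmean; apply/funext => p; rewrite mul1r mulr1.
have -> : rmean q (fun p => 1 * (w (p%:R / q%:R) * 1)) = rmean q (fun p => w (p%:R / q%:R)).
  by congr rmean; apply/funext => p; rewrite mul1r mulr1.
set H2 := rmean _ _; set W := rmean q _ => e2 e3.
pose ind p : R := (`[< D (p%:R / q%:R) >])%:R.
rewrite -[fun p => (`[< D (p%:R / q%:R) >])%:R]/ind.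
set B := rmean q ind; set A := rmean q _; set A2 := rmean q _ in e1.
have ind_h2 p : 0 <= h2 (p%:R / q%:R) - ind p <= w (p%:R / q%:R).
  rewrite /w /ind; case: asboolP => [Dp|nDp].
    by rewrite /h2 tent_in // subrr lexx /= addrAC subrr add0r tent_ge0.
  by rewrite /h1c (tent_in _ nDp) addrK subr0 lexx tent_ge0.
have FM x : `|F x| <= M by apply: le_trans (FM0 x) _; rewrite lerDl.
have dI_le : `|d * intT F| <= M.
  rewrite normrM -[leRHS]mul1r ler_pM //; exact: intT_norm_le.
have hB : `|H2 - B| <= W.
  rewrite -rmeanB; apply: rmean_norm_le => p _.
  by have /andP[h0 hw] := ind_h2 p; rewrite ger0_norm.
have hA : `|A2 - A| <= M * W.
  rewrite -rmeanZ -rmeanB; apply: rmean_norm_le => p co_pq.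
  have -> : c q p * (h2 (p%:R / q%:R) * F (xpt R b q p)) - ind p * (c q p * F (xpt R b q p)) =
     (h2 (p%:R / q%:R) - ind p) * (c q p * F (xpt R b q p)) by ring.
  have /andP[h0 hw] := ind_h2 p; rewrite normrM ger0_norm // mulrC ler_pM //.
  rewrite normrM -[leRHS]mul1r ler_pM //.
  by case: (sqr1_cases (c_sqr p co_pq)) => ->; rewrite ?normrN normr1.
have lh2 : l <= intT h2 by exact: lP.
have W_ge0 : 0 <= W by apply: le_trans hB.
have W_le : W <= 2 * eta.
  have h := ler_norm (W - intT w); have h' := ler_norm (intT w); lra.
have B_ge : l / 2 <= B.
  have h := ler_norm (H2 - B); have h' := ler_norm (intT h2 - H2).
  rewrite distrC in h'; lra.
have B_gt0 : 0 < B by lra.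
have -> : A / B - d * intT F = (A - d * intT F * B) / B.
  by rewrite mulrBl mulfK // gt_eqF.
rewrite normrM normfV (gtr0_norm B_gt0) ltr_pdivrMr //.
have -> : A - d * intT F * B = - (A2 - A) + (A2 - d * (intT h2 * intT F))
    - d * intT F * (H2 - intT h2) + d * intT F * (H2 - B) by ring.
have key : `|- (A2 - A) + (A2 - d * (intT h2 * intT F))
    - d * intT F * (H2 - intT h2) + d * intT F * (H2 - B)| <=
    M * W + eta + M * eta + M * W.
  apply: le_trans (ler_normD _ _) _; rewrite lerD //; last first.
    by rewrite normrM ler_pM.
  apply: le_trans (ler_normB _ _) _; rewrite lerD //; last first.
    by rewrite normrM ler_pM // ltW.
  by apply: le_trans (ler_normD _ _) _; rewrite normrN lerD // ltW.
apply: le_lt_trans key _.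
have MW : M * W <= 2 * (M * eta) by have := ler_wpM2l (ltW M_gt0) W_le; lra.
have eB : e * (l / 2) <= e * B by rewrite ler_pM2l.
have el : 0 < e * l by rewrite mulr_gt0.
lra.
Qed.

End ConditionalMean.

(** * Absolutely convergent Fourier series *)

Section SeriesContinuity.
Variable R : realType.
Implicit Types (A : R^nat) (f : nat -> R -> R).

Lemma bounded_series_cvg A (K : R) : (forall n, 0 <= A n) ->
  (forall N, \sum_(n < N) A n <= K) -> cvgn (series A).
Proof.
move=> A_ge0 AK; apply: nondecreasing_is_cvgn.
  by apply/nondecreasing_seqP => n; rewrite /series /= big_nat_recr //= lerDl.
by exists K => _ [n _ <-]; rewrite /series /= big_mkord.
Qed.

Lemma series_cvg_dominated f A : (forall n x, `|f n x| <= A n) -> cvgn (series A) ->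
  forall x, cvgn (series (fun n => f n x)).
Proof.
move=> fA Ac x; apply: normed_cvg; apply: (series_le_cvg _ _ _ Ac) => n /=; last exact: fA; first exact: normr_ge0.
exact: le_trans (normr_ge0 _) (fA n 0).
Qed.

(** The Weierstrass M-test: the tails are bounded by those of A, uniformly in x. *)
Lemma series_lim_continuous f A : (forall n x, `|f n x| <= A n) -> cvgn (series A) ->
  (forall n, continuous (f n)) -> continuous (fun x => limn (series (fun n => f n x))).
Proof.
move=> fA Ac fc.
have A_ge0 n : 0 <= A n by apply: le_trans (fA n 0).
have fcv := series_cvg_dominated fA Ac.
have A_le N : series A N <= limn (series A).
  apply: nondecreasing_cvgn_le => //.
  by apply/nondecreasing_seqP => n; rewrite /series /= big_nat_recr //= lerDl.
have tail N x : `|series (fun n => f n x) N - limn (series (fun n => f n x))|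
     <= limn (series A) - series A N.
  rewrite distrC.
  have cvN : (fun m => `|series (fun n => f n x) m - series (fun n => f n x) N|) @ \oo -->
      `|limn (series (fun n => f n x)) - series (fun n => f n x) N|.
    apply: cvg_norm; apply: cvgB; [exact: fcv|exact: cvg_cst].
  rewrite -(cvg_lim (@Rhausdorff R) cvN); apply: limr_le; first by apply/cvg_ex; eexists; exact: cvN.
  near=> m; have Nm : (N <= m)%N by near: m; exact: nbhs_infty_ge.
  rewrite sub_series_geq //; apply: le_trans (ler_norm_sum _ _ _) _.
  apply: le_trans (_ : \sum_(N <= k < m) A k <= _); first by apply: ler_sum => k _.
  by rewrite -sub_series_geq // lerD2r A_le.
have S_cont N : continuous (fun x => series (fun n => f n x) N).
  elim: N => [|N IHN].
    rewrite (_ : (fun x => _) = fun=> 0); first exact: cst_continuous.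
    by apply/funext => x; rewrite /series /= big_geq.
  rewrite (_ : (fun x => _) = fun x => series (fun n => f n x) N + f N x).
    by move=> x; apply: cvgD; [exact: IHN|exact: fc].
  by apply/funext => x; rewrite /series /= big_nat_recr.
move=> x; apply/cvgrPdist_le => e e_gt0.
have e3 : 0 < e / 3 by rewrite divr_gt0.
have /cvgrPdist_lt /(_ _ e3) [N _ /(_ N (leqnn N)) /= NP] : series A @ \oo --> limn (series A) := Ac.
have /cvgrPdist_lt /(_ _ e3) cN := S_cont N x.
have tailN y := tail N y.
near=> y.
have h : `|series (fun n => f n x) N - series (fun n => f n y) N| < e / 3 by near: y.
have hx := tailN x; have hy := tailN y.
have hA := ler_norm (limn (series A) - series A N).
set Lx := limn _ in hx *; set Ly := limn _ in hy *.
have -> : Lx - Ly = (series (fun n => f n x) N - series (fun n => f n y) N)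
   - (series (fun n => f n x) N - Lx) + (series (fun n => f n y) N - Ly) by ring.
apply: le_trans (ler_normD _ _) _; apply: le_trans (lerD (ler_normB _ _) (lexx _)) _.
lra.
Unshelve. all: by end_near. Qed.

End SeriesContinuity.

(** * Symmetric sums over the integers *)

Section SumZ.
Local Open Scope complex_scope.
Variable R : realType.
Local Notation C := R[i].
Local Notation re := (@complex.Re R).
Local Notation im := (@complex.Im R).
Implicit Types (a : int -> C) (B : int -> R).

(** Joins k and -k, with 0 taken once, so that symmetric partial sums are those of an ordinary
    series. *)
Definition fold_pair a (n : nat) : C := if n is 0%N then a 0 else a n%:Z + a (- n%:Z).

Lemma symsum_recr a N : symsum a N.+1 = symsum a N + (a N.+1%:Z + a (- N.+1%:Z)).
Proof.
rewrite /symsum mulnS addSn addSn add0n big_ord_recl big_ord_recr /= addrCA; congr (_ + _).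
  by apply: eq_bigr => k _; congr a; rewrite /bump /=; lia.
by rewrite addrC; congr (a _ + a _); rewrite /bump /=; lia.
Qed.

Lemma symsumE a N : symsum a N = series (fold_pair a) N.+1.
Proof.
elim: N => [|N IHN]; rewrite /series /=.
  by rewrite /symsum big_ord1 big_nat1 /= subrr.
by rewrite symsum_recr IHN big_nat_recr.
Qed.

Lemma re_series (u : nat -> C) N : re (series u N) = series (fun n => re (u n)) N.
Proof. by rewrite /series /= re_sum. Qed.

Lemma im_series (u : nat -> C) N : im (series u N) = series (fun n => im (u n)) N.
Proof. by rewrite /series /= im_sum. Qed.

(** The term 0 is counted twice, which is harmless for a bound. *)
Definition summableZ B := (forall k, 0 <= B k) /\
  exists K, forall N, \sum_(n < N) (B n%:Z + B (- n%:Z)) <= K.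

Lemma summableZ_even B : summableZ B -> summableZ (fun k => B (2 * k)).
Proof.
move=> [B_ge0 [K BK]]; split=> [k|]; first exact: B_ge0.
exists K => N; apply: le_trans (BK (2 * N)%N).
elim: N => [|N IHN]; first by rewrite muln0 !big_ord0.
rewrite mulnS addSn addSn add0n big_ord_recr 2!big_ord_recr /= -addrA lerD //.
have -> : 2 * N%:Z = (2 * N)%N by lia.
have -> : 2 * - N%:Z = - (2 * N)%N%:Z by lia.
by rewrite lerDl addr_ge0.
Qed.

Section Dominated.
Variables (g : int -> R -> C) (B : int -> R).
Hypotheses (Bs : summableZ B) (gB : forall k x, `|re (g k x)| <= B k /\ `|im (g k x)| <= B k).

Lemma fold_pair_bound n x : `|re (fold_pair (g^~ x) n)| <= B n%:Z + B (- n%:Z) /\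
  `|im (fold_pair (g^~ x) n)| <= B n%:Z + B (- n%:Z).
Proof.
case: Bs => B_ge0 _; case: n => [|n] /=.
  by have [h1 h2] := gB 0 x; rewrite !(le_trans h1, le_trans h2) // lerDl.
have [h1 h2] := gB n.+1%:Z x; have [h3 h4] := gB (- n.+1%:Z) x.
by rewrite reD imD !(le_trans (ler_normD _ _)) // lerD.
Qed.

Lemma pair_series_cvg : cvgn (series (fun n : nat => B n%:Z + B (- n%:Z))).
Proof.
case: Bs => B_ge0 [K BK]; apply: bounded_series_cvg BK => n; exact: addr_ge0.
Qed.

Lemma symsum_ccvg x : ccvg (symsum (g^~ x)) (sumZ (g^~ x)).
Proof.
have c1 : cvgn (series (fun n => re (fold_pair (g^~ x) n))).
  apply: (@series_cvg_dominated R (fun n x => re (fold_pair (g^~ x) n)) _ _ pair_series_cvg x).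
  by move=> n y; have [] := fold_pair_bound n y.
have c2 : cvgn (series (fun n => im (fold_pair (g^~ x) n))).
  apply: (@series_cvg_dominated R (fun n x => im (fold_pair (g^~ x) n)) _ _ pair_series_cvg x).
  by move=> n y; have [] := fold_pair_bound n y.
have e1 : (fun N => re (symsum (g^~ x) N)) =
    (fun N => series (fun n => re (fold_pair (g^~ x) n)) N.+1).
  by apply/funext => N; rewrite symsumE re_series.
have e2 : (fun N => im (symsum (g^~ x) N)) =
    (fun N => series (fun n => im (fold_pair (g^~ x) n)) N.+1).
  by apply/funext => N; rewrite symsumE im_series.
split => /=.
  rewrite e1; apply/cvg_ex; exists (limn (series (fun n => re (fold_pair (g^~ x) n)))).
  by rewrite cvg_shiftS.
rewrite e2; apply/cvg_ex; exists (limn (series (fun n => im (fold_pair (g^~ x) n)))).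
by rewrite cvg_shiftS.
Qed.

Lemma sumZ_re x : re (sumZ (g^~ x)) = limn (series (fun n => re (fold_pair (g^~ x) n))).
Proof.
have [c1 _] := symsum_ccvg x; rewrite /sumZ /=; apply: cvg_lim; first exact: Rhausdorff.
have -> : (fun N => re (symsum (g^~ x) N)) =
    (fun N => series (fun n => re (fold_pair (g^~ x) n)) N.+1).
  by apply/funext => N; rewrite symsumE re_series.
rewrite (@cvg_shiftS R).
apply: (@series_cvg_dominated R (fun n x => re (fold_pair (g^~ x) n)) _ _ pair_series_cvg x).
by move=> n y; have [] := fold_pair_bound n y.
Qed.

Lemma sumZ_im x : im (sumZ (g^~ x)) = limn (series (fun n => im (fold_pair (g^~ x) n))).
Proof.
have [_ c1] := symsum_ccvg x; rewrite /sumZ /=; apply: cvg_lim; first exact: Rhausdorff.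
have -> : (fun N => im (symsum (g^~ x) N)) =
    (fun N => series (fun n => im (fold_pair (g^~ x) n)) N.+1).
  by apply/funext => N; rewrite symsumE im_series.
rewrite (@cvg_shiftS R).
apply: (@series_cvg_dominated R (fun n x => im (fold_pair (g^~ x) n)) _ _ pair_series_cvg x).
by move=> n y; have [] := fold_pair_bound n y.
Qed.

Hypothesis gc : forall k, continuous (fun x => re (g k x)) /\ continuous (fun x => im (g k x)).

Lemma sumZ_continuous : continuous (fun x => toR2 (sumZ (g^~ x))).
Proof.
have cr : continuous (fun x => re (sumZ (g^~ x))).
  rewrite (_ : (fun x => _) = fun x => limn (series (fun n => re (fold_pair (g^~ x) n)))); last first.
    by apply/funext => x; exact: sumZ_re.
  apply: (@series_lim_continuous R (fun n x => re (fold_pair (g^~ x) n)) _ _ pair_series_cvg).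
    by move=> n y; have [] := fold_pair_bound n y.
  case=> [|n] /=; first by have [] := gc 0.
  rewrite (_ : (fun x => _) = fun x => re (g n.+1%:Z x) + re (g (- n.+1%:Z) x)); last first.
    by apply/funext => x; rewrite reD.
  by move=> x; apply: cvgD; [exact: (gc _).1|exact: (gc _).1].
have ci : continuous (fun x => im (sumZ (g^~ x))).
  rewrite (_ : (fun x => _) = fun x => limn (series (fun n => im (fold_pair (g^~ x) n)))); last first.
    by apply/funext => x; exact: sumZ_im.
  apply: (@series_lim_continuous R (fun n x => im (fold_pair (g^~ x) n)) _ _ pair_series_cvg).
    by move=> n y; have [] := fold_pair_bound n y.
  case=> [|n] /=; first by have [] := gc 0.
  rewrite (_ : (fun x => _) = fun x => im (g n.+1%:Z x) + im (g (- n.+1%:Z) x)); last first.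
    by apply/funext => x; rewrite imD.
  by move=> x; apply: cvgD; [exact: (gc _).2|exact: (gc _).2].
by move=> x; exact: (cvg_pair (cr x) (ci x)).
Qed.

End Dominated.

End SumZ.

(** * Gauss sums through the Fourier expansion *)

Section FourierSide.
Local Open Scope complex_scope.
Variable R : realType.
Local Notation C := R[i].
Local Notation ee := (@ee R).
Local Notation chi := (@chi R).
Local Notation re := (@complex.Re R).
Local Notation im := (@complex.Im R).

Lemma ccvg_unique (u : nat -> C) l m : ccvg u l -> ccvg u m -> l = m.
Proof.
move=> [l1 l2] [m1 m2]; apply: complex_eqP.
  exact: (cvg_unique (@Rhausdorff R) l1 m1).
exact: (cvg_unique (@Rhausdorff R) l2 m2).
Qed.

Lemma eq_ccvg (u v : nat -> C) l : u =1 v -> ccvg u l -> ccvg v l.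
Proof. by move=> /funext ->. Qed.

Lemma ccvgD (u v : nat -> C) l m : ccvg u l -> ccvg v m -> ccvg (fun n => u n + v n) (l + m).
Proof.
move=> [l1 l2] [m1 m2]; rewrite /ccvg reD imD; split.
  by under eq_fun do rewrite reD; apply: cvgD.
by under eq_fun do rewrite imD; apply: cvgD.
Qed.

Lemma ccvgZ a (u : nat -> C) l : ccvg u l -> ccvg (fun n => a * u n) (a * l).
Proof.
move=> [l1 l2]; rewrite /ccvg reM imM; split.
  by under eq_fun do rewrite reM; apply: cvgB; apply: cvgM => //; exact: cvg_cst.
by under eq_fun do rewrite imM; apply: cvgD; apply: cvgM => //; exact: cvg_cst.
Qed.

Lemma ccvg_sum q (u : 'I_q -> nat -> C) (l : 'I_q -> C) : (forall h, ccvg (u h) (l h)) ->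
  ccvg (fun n => \sum_(h < q) u h n) (\sum_(h < q) l h).
Proof.
elim: q u l => [|q IHq] u l ul.
  rewrite big_ord0; apply: (@eq_ccvg (fun=> 0)) => [n|]; first by rewrite big_ord0.
  by split; exact: cvg_cst.
rewrite big_ord_recr; apply: (@eq_ccvg (fun n => \sum_(h < q) u (widen_ord (leqnSn q) h) n + u ord_max n)).
  by move=> n; rewrite big_ord_recr.
by apply: ccvgD => //; apply: IHq.
Qed.

Lemma ccvg_even (u : nat -> C) l : ccvg u l -> ccvg (fun n => u (2 * n)%N) l.
Proof.
have sub (v : nat -> R) (m : R) : v @ \oo --> m -> (fun n => v (2 * n)%N) @ \oo --> m.
  move=> vm; apply: (@cvg_comp _ _ _ (fun n => (2 * n)%N) v); last exact: vm.
  move=> A [N _ NA]; exists N => // n /= Nn; apply: NA => /=.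
  by rewrite (leq_trans Nn) // leq_pmull.
by move=> [l1 l2]; split; [exact: (sub (fun n => re (u n)) _ l1)|exact: (sub (fun n => im (u n)) _ l2)].
Qed.

(** The cutoff 2N on k = 2j is the cutoff N on j, so [Gplus] is reached along the even cutoffs. *)
Lemma symsum_even (a : int -> C) N : (forall k, odd `|k|%N -> a k = 0) ->
  symsum a (2 * N) = symsum (fun j => a (2 * j)) N.
Proof.
move=> a_odd; elim: N => [|N IHN].
  by rewrite muln0 /symsum !big_ord1 subrr mulr0.
rewrite mulnS addSn addSn add0n 2!symsum_recr IHN [RHS]symsum_recr.
rewrite (a_odd (2 * N).+1%:Z) ?(a_odd (- (2 * N).+1%:Z)) ?addr0;
  try by rewrite ?abszN /= mul2n odd_double.
by congr (_ + (a _ + a _)); lia.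
Qed.

Lemma symsumZ (z : C) (a : int -> C) N : symsum (fun k => z * a k) N = z * symsum a N.
Proof. by rewrite /symsum mulr_sumr. Qed.

Variable phi : R -> C.
Hypothesis phiB : in_B phi.
Local Notation c := (fcoef phi).

Lemma summable_fcoef : summableZ (fun k => cabs (c k)).
Proof.
have cabs_ge0 k : 0 <= cabs (c k) by exact: sqrtr_ge0.
split => //; have [_ _ _ cv _] := phiB.
set A := fun n : nat => n%:R ^+ 2 * _ in cv.
have A_ge0 n : 0 <= A n by rewrite mulr_ge0 ?sqr_ge0 ?addr_ge0.
have A_le N : series A N <= limn (series A).
  apply: nondecreasing_cvgn_le => //.
  by apply/nondecreasing_seqP => n; rewrite /series /= big_nat_recr //= lerDl.
(* The weight n^2 is at least 1 except at n = 0, where it vanishes; that term is added by hand. *)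
exists (cabs (c 0) + cabs (c (- 0)) + limn (series A)) => N.
apply: le_trans (_ : cabs (c 0) + cabs (c (- 0)) + series A N <= _); last by rewrite lerD2l.
rewrite /series /= big_mkord; case: N => [|N]; first by rewrite !big_ord0 addr0 addr_ge0.
rewrite !big_ord_recl /= lerD2l {1}/A expr0n mul0r add0r.
apply: ler_sum => n _; rewrite /A ler_peMl ?addr_ge0 //.
by rewrite expr_ge1 // ler1n.
Qed.

Lemma parts_le_cabs (z : C) : `|re z| <= cabs z /\ `|im z| <= cabs z.
Proof. by apply: parts_norm; rewrite normc_def. Qed.

Lemma cabs_ee (z : C) x : cabs (z * ee x) = cabs z.
Proof.
apply: (@complexI R); have -> (w : C) : (cabs w)%:C = `|w| by rewrite normc_def.
by rewrite normrM ee_norm mulr1 normc_def.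
Qed.

Lemma parts_ee (z : C) x : `|re (z * ee x)| <= cabs z /\ `|im (z * ee x)| <= cabs z.
Proof. by rewrite -(cabs_ee z x); exact: parts_le_cabs. Qed.

Lemma continuous_mul_ee (z : C) (m : int) :
  continuous (fun x : R => re (z * ee (m%:~R * x))) /\ continuous (fun x : R => im (z * ee (m%:~R * x))).
Proof.
have := continuous_tpoly [:: (z, m)].
by rewrite /tpoly; under eq_fun do rewrite big_seq1; under [in X in _ /\ X]eq_fun do rewrite big_seq1.
Qed.

Let gfull (n : int) (x : R) : C := c n * ee ((n * n)%:~R * x).
Let gplus (n : int) (x : R) : C := c (2 * n) * ee ((n * n)%:~R * x).
Let gminus (n : int) (x : R) : C := if odd `|n|%N then c n * ee ((n * n)%:~R * x) else 0.

Let gfull_le k x : `|re (gfull k x)| <= cabs (c k) /\ `|im (gfull k x)| <= cabs (c k).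
Proof. exact: parts_ee. Qed.
Let gplus_le k x : `|re (gplus k x)| <= cabs (c (2 * k)) /\ `|im (gplus k x)| <= cabs (c (2 * k)).
Proof. exact: parts_ee. Qed.
Let gminus_le k x : `|re (gminus k x)| <= cabs (c k) /\ `|im (gminus k x)| <= cabs (c k).
Proof.
rewrite /gminus; case: ifP => _; first exact: parts_ee.
by rewrite /= normr0 sqrtr_ge0.
Qed.

Lemma Gfull_continuous : continuous (fun x => toR2 (Gfull phi x)).
Proof.
apply: (sumZ_continuous summable_fcoef gfull_le) => k; exact: continuous_mul_ee.
Qed.

Lemma Gplus_continuous : continuous (fun x => toR2 (Gplus phi x)).
Proof.
apply: (sumZ_continuous (summableZ_even summable_fcoef) gplus_le) => k.
exact: continuous_mul_ee.
Qed.

Lemma Gminus_continuous : continuous (fun x => toR2 (Gminus phi x)).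
Proof.
apply: (sumZ_continuous summable_fcoef gminus_le) => k; rewrite /gminus.
case: (odd _); first exact: continuous_mul_ee.
by split; exact: cst_continuous.
Qed.

Lemma ee_period (m : int) x : ee (m%:~R * (x + 1)) = ee (m%:~R * x).
Proof. by rewrite mulrDr mulr1 eeD ee_int mulr1. Qed.

Lemma Gfull_periodic : periodic1 (Gfull phi).
Proof. by move=> x; congr sumZ; apply/funext => n; rewrite ee_period. Qed.

Lemma Gplus_periodic : periodic1 (Gplus phi).
Proof. by move=> x; congr sumZ; apply/funext => n; rewrite ee_period. Qed.

Lemma Gminus_periodic : periodic1 (Gminus phi).
Proof. by move=> x; congr sumZ; apply/funext => n; rewrite ee_period. Qed.

(** The Fourier series converges at each of the q points h/q; exchanging the finite sum with the
    limit leaves, for each frequency, a quadratic Gauss sum with a linear term. *)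
Lemma gsum_ccvg (p : int) q :
  ccvg (symsum (fun k => c k * \sum_(h < q) chi q (p * h%:Z ^+ 2 + k * h%:Z))) (gsum phi p q).
Proof.
have [_ _ _ _ inv] := phiB.
have := ccvg_sum (fun h : 'I_q => ccvgZ (chi q (p * h%:Z ^+ 2)) (inv (h%:R / q%:R))).
have -> : \sum_(h < q) chi q (p * h%:Z ^+ 2) * phi (h%:R / q%:R) = gsum phi p q.
  by apply: eq_bigr => h _; rewrite mulrC expr2.
apply: eq_ccvg => N; rewrite /symsum.
under eq_bigr do rewrite mulr_sumr.
rewrite exchange_big; apply: eq_bigr => k _; rewrite mulr_sumr; apply: eq_bigr => h _.
rewrite mulrCA; congr (_ * _); rewrite chiD; congr (_ * _).
by rewrite /chi intrM -pmulrn mulrA.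
Qed.

Lemma gsum_Gfull (p x : int) q (z : C) : (0 < q)%N ->
  (forall k, \sum_(h < q) chi q (p * h%:Z ^+ 2 + k * h%:Z) = z * chi q (x * k ^+ 2)) ->
  gsum phi p q = z * Gfull phi (x%:~R / q%:R).
Proof.
move=> q_gt0 QE; apply: ccvg_unique (gsum_ccvg p q) _.
have := ccvgZ z (symsum_ccvg summable_fcoef gfull_le (x%:~R / q%:R)).
apply: eq_ccvg => N; rewrite -symsumZ; apply: eq_bigr => k _; rewrite QE mulrCA /gfull.
by congr (_ * (_ * _)); rewrite /chi; congr ee; rewrite expr2 !intrM; ring.
Qed.

Lemma gsum_Gplus (p x : int) q (z : C) : (0 < q)%N ->
  (forall k, odd `|k|%N -> \sum_(h < q) chi q (p * h%:Z ^+ 2 + k * h%:Z) = 0) ->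
  (forall j, \sum_(h < q) chi q (p * h%:Z ^+ 2 + 2 * j * h%:Z) = z * chi q (x * j ^+ 2)) ->
  gsum phi p q = z * Gplus phi (x%:~R / q%:R).
Proof.
move=> q_gt0 Q0 QE; apply: ccvg_unique (ccvg_even (gsum_ccvg p q)) _.
have := ccvgZ z (symsum_ccvg (summableZ_even summable_fcoef) gplus_le (x%:~R / q%:R)).
apply: eq_ccvg => N; rewrite -symsumZ symsum_even; last by move=> k /Q0 ->; rewrite mulr0.
apply: eq_bigr => k _; rewrite QE mulrCA /gplus.
by congr (_ * (_ * _)); rewrite /chi; congr ee; rewrite expr2 !intrM; ring.
Qed.

Lemma gsum_Gminus (p x : int) q (z : C) : (0 < q)%N ->
  (forall k, ~~ odd `|k|%N -> \sum_(h < q) chi q (p * h%:Z ^+ 2 + k * h%:Z) = 0) ->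
  (forall k, odd `|k|%N ->
     \sum_(h < q) chi q (p * h%:Z ^+ 2 + k * h%:Z) = z * chi q (x * k ^+ 2)) ->
  gsum phi p q = z * Gminus phi (x%:~R / q%:R).
Proof.
move=> q_gt0 Q0 QE; apply: ccvg_unique (gsum_ccvg p q) _.
have := ccvgZ z (symsum_ccvg summable_fcoef gminus_le (x%:~R / q%:R)).
apply: eq_ccvg => N; rewrite -symsumZ; apply: eq_bigr => k _; rewrite /gminus.
case: ifP => [ko|/negbT ke]; last by rewrite Q0 // !mulr0.
rewrite QE // mulrCA.
by congr (_ * (_ * _)); rewrite /chi; congr ee; rewrite expr2 !intrM; ring.
Qed.

End FourierSide.

(** * Assembly *)

Section Assembly.
Local Open Scope complex_scope.
Variable R : realType.
Local Notation C := R[i].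
Local Notation re := (@complex.Re R).
Local Notation im := (@complex.Im R).
Variables (D : set R) (phi : R -> C).
Hypothesis D_per : forall x : R, D x <-> D (x + 1).
Hypothesis D_bnd : lebesgue_measure (boundary D `&` `[0%R, 1%R[) = 0%E.
Hypothesis D_pos : (0 < completed_lebesgue_measure (D `&` `[0%R, 1%R[))%E.
Hypothesis phiB : in_B phi.
Implicit Types (S : nat -> Prop) (b : nat -> int) (c : nat -> nat -> R).

Definition cond_mean q (H : nat -> R) : R :=
  rmean q (fun p => (`[< D (p%:R / q%:R) >])%:R * H p) /
  rmean q (fun p => (`[< D (p%:R / q%:R) >])%:R).

Definition cond_cvg S (H : nat -> nat -> R) l := cvg_along S (fun q => cond_mean q (H q)) l.

(** Finitely many moduli are ignored; [2 < q] ensures r > 1 when q = 2r. *)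
Lemma eq_cond_cvg S H H' l :
  (forall q, (2 < q)%N -> S q -> forall p, coprime p q -> H q p = H' q p) ->
  cond_cvg S H l -> cond_cvg S H' l.
Proof.
move=> HH' Hl e /Hl[N NP]; exists (maxn 3 N) => q; rewrite geq_max => /andP[q2 qN] Sq.
have -> : cond_mean q (H' q) = cond_mean q (H q); last exact: NP.
congr (_ / _ / _); apply: eq_bigr => p co_pq; by rewrite HH'.
Qed.

Lemma cond_cvgD S H H' l l' : cond_cvg S H l -> cond_cvg S H' l' ->
  cond_cvg S (fun q p => H q p + H' q p) (l + l').
Proof.
move=> Hl Hl' e e_gt0; have e2 : 0 < e / 2 by rewrite divr_gt0.
have [N NP] := Hl _ e2; have [N' NP'] := Hl' _ e2.
exists (maxn N N') => q; rewrite geq_max => /andP[qN qN'] Sq.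
have -> : cond_mean q (fun p => H q p + H' q p) = cond_mean q (H q) + cond_mean q (H' q).
  rewrite /cond_mean -mulrDl -[in RHS]mulrDl -big_split; congr (_ / _ / _).
  by apply: eq_bigr => p _; rewrite mulrDr.
rewrite opprD addrACA; apply: le_lt_trans (ler_normD _ _) _.
by have := NP q qN Sq; have := NP' q qN' Sq; lra.
Qed.

Lemma cond_cvg_term S b c d (F : R -> R) : admissible S b c d -> `|d| <= 1 ->
  continuous F -> periodic1 F ->
  cond_cvg S (fun q p => c q p * F (xpt R b q p)) (d * intT F).
Proof. by move=> adm d1 Fc F1; exact: conditional_equidistribution. Qed.

Lemma conv_cond (T : Type) S (Fq : nat -> nat -> T) (f : T -> R) H l :
  (forall q, (2 < q)%N -> S q -> forall p, coprime p q -> H q p = f (Fq q p)) ->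
  cond_cvg S H l -> cvg_along S (fun q => unif_mean D q (Fq q) f) l.
Proof.
move=> HH /(eq_cond_cvg HH) Hl e /Hl[N NP]; exists (maxn 2 N) => q.
by rewrite geq_max => /andP[q1 qN] Sq; rewrite unif_mean_rmean //; exact: NP.
Qed.

Lemma one_value S b (F : R -> R) : admissible S b (fun _ _ => 1 : R) 1 ->
  continuous F -> periodic1 F -> cond_cvg S (fun q p => F (xpt R b q p)) (intT F).
Proof.
move=> adm Fc F1; have := cond_cvg_term adm _ Fc F1; rewrite normr1 lexx mul1r => /(_ isT).
by apply: eq_cond_cvg => q _ _ p _; rewrite mul1r.
Qed.

Lemma zero_value S b c (F : R -> R) : admissible S b c 0 ->
  continuous F -> periodic1 F -> cond_cvg S (fun q p => c q p * F (xpt R b q p)) 0.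
Proof. by move=> adm Fc F1; have := cond_cvg_term adm _ Fc F1; rewrite normr0 ler01 mul0r; apply. Qed.

Lemma continuous_lincomb (x y : R) (F G : R -> R) : continuous F -> continuous G ->
  continuous (fun t => x * F t + y * G t).
Proof.
move=> Fc Gc t; apply: cvgD; apply: cvgM; [exact: cvg_cst|exact: Fc|exact: cvg_cst|exact: Gc].
Qed.

Lemma continuous_scale (x : R) (F : R -> R) : continuous F -> continuous (fun t => x * F t).
Proof. by move=> Fc t; apply: cvgM; [exact: cvg_cst|exact: Fc]. Qed.

(** H = (F + G)/2 + c (F - G)/2, and the second part has limit 0 because the weight has mean 0. *)
Lemma two_values S b c (F G : R -> R) H : admissible S b c 0 ->
  continuous F -> periodic1 F -> continuous G -> periodic1 G ->
  (forall q, (2 < q)%N -> S q -> forall p, coprime p q ->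
     (c q p = 1 -> H q p = F (xpt R b q p)) /\ (c q p = -1 -> H q p = G (xpt R b q p))) ->
  cond_cvg S H (2%:R^-1 * (intT F + intT G)).
Proof.
move=> adm Fc F1 Gc G1 HE.
pose U t := 2%:R^-1 * F t + 2%:R^-1 * G t; pose V t := 2%:R^-1 * F t + - 2%:R^-1 * G t.
have Uc : continuous U by exact: continuous_lincomb.
have Vc : continuous V by exact: continuous_lincomb.
have U1 : periodic1 U by move=> t; rewrite /U F1 G1.
have V1 : periodic1 V by move=> t; rewrite /V F1 G1.
have -> : 2%:R^-1 * (intT F + intT G) = intT U + 0.
  by rewrite addr0 /U intTD ?intTZ ?mulrDr //; exact: continuous_scale.
apply: eq_cond_cvg (cond_cvgD (one_value (admissible1 adm) Uc U1) (zero_value adm Vc V1)).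
move=> q q2 Sq p co_pq; have [[_ c_sqr _] _ _] := adm q (ltnW q2) Sq.
have [h1 h2] := HE q q2 Sq p co_pq.
by case: (sqr1_cases (c_sqr p co_pq)) => cE; rewrite cE ?(h1 cE) ?(h2 cE) /U /V; lra.
Qed.

(** Expansion of a function of two signs in 1, c1, c2 and c1 c2. Mean 0 for all three nontrivial
    ones makes the pair of signs uniform and independent of x. *)
Lemma four_values S b c1 c2 (F : R -> R -> R -> R) H :
  admissible S b c1 0 -> admissible S b c2 0 -> admissible S b (fun q p => c1 q p * c2 q p) 0 ->
  (forall s t, continuous (F s t)) -> (forall s t, periodic1 (F s t)) ->
  (forall q, (2 < q)%N -> S q -> forall p, coprime p q ->
     H q p = F (c1 q p) (c2 q p) (xpt R b q p)) ->
  cond_cvg S H (4%:R^-1 * (intT (F 1 1) + (intT (F 1 (-1)) + (intT (F (-1) 1) + intT (F (-1) (-1)))))).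
Proof.
move=> adm1 adm2 adm3 Fc F1 HE; pose k : R := 4%:R^-1.
pose L (x y z w : R) t := (x * F 1 1 t + y * F 1 (-1) t) + (z * F (-1) 1 t + w * F (-1) (-1) t).
have Lc x y z w : continuous (L x y z w).
  by move=> t; apply: cvgD; apply: continuous_lincomb; exact: Fc.
have L1 x y z w : periodic1 (L x y z w) by move=> t; rewrite /L !F1.
have -> : 4%:R^-1 * (intT (F 1 1) + (intT (F 1 (-1)) + (intT (F (-1) 1) + intT (F (-1) (-1))))) =
   intT (L k k k k) + 0 + (0 + 0).
  rewrite !addr0 /L intTD ?(intTD (F := fun t => k * _ t)) ?intTZ //;
    try (by apply: continuous_scale); try (by apply: continuous_lincomb).
  by rewrite /k; ring.
apply: eq_cond_cvg (cond_cvgD (cond_cvgD (one_value (admissible1 adm1) (Lc k k k k) (L1 k k k k))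
  (zero_value adm1 (Lc k k (- k) (- k)) (L1 k k (- k) (- k))))
  (cond_cvgD (zero_value adm2 (Lc k (- k) k (- k)) (L1 k (- k) k (- k)))
  (zero_value adm3 (Lc k (- k) (- k) k) (L1 k (- k) (- k) k)))).
move=> q q2 Sq p co_pq; rewrite (HE q q2 Sq p co_pq).
have [[_ c1_sqr _] _ _] := adm1 q (ltnW q2) Sq.
have [[_ c2_sqr _] _ _] := adm2 q (ltnW q2) Sq.
case: (sqr1_cases (c1_sqr p co_pq)) => ->; case: (sqr1_cases (c2_sqr p co_pq)) => ->;
  rewrite /L /k; lra.
Qed.

Lemma test_pair_continuous (f : (R * R) * (R * R) -> R) (s : R * R) (G : R -> R * R) :
  continuous f -> continuous G -> continuous (fun x => f (s, G x)).
Proof.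
move=> fc Gc x; apply: (@continuous_comp R _ R (fun x => (s, G x)) f); last exact: fc.
have sc : continuous (fun _ : R => s) by exact: cst_continuous.
exact: (cvg_pair (sc x) (Gc x)).
Qed.

Lemma test_continuous (f : R * R -> R) (G : R -> R * R) :
  continuous f -> continuous G -> continuous (fun x => f (G x)).
Proof. by move=> fc Gc x; apply: continuous_comp; [exact: Gc|exact: fc]. Qed.

End Assembly.

(** * The classes of moduli *)

Section Cases.
Local Open Scope complex_scope.
Variable R : realType.
Local Notation C := R[i].
Local Notation re := (@complex.Re R).
Local Notation im := (@complex.Im R).
Variable phi : R -> C.
Hypothesis phiB : in_B phi.

Lemma admissible_one (S : nat -> Prop) (b : nat -> int) :
  (forall q, (1 < q)%N -> S q -> (#|[set v : 'Z_q | ((b q)%:~R * v == 0)%R]%SET| <= 2)%N) ->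
  admissible S b (fun _ _ => 1 : R) 1.
Proof.
move=> ann q q_gt1 Sq; split; [exact: twisted1|exact: ann|].
by rewrite mul1r -sum_coprime1 natr_sum.
Qed.

Lemma wsum_neq0_odd p q : odd q -> coprime p q -> wsum R p q != 0.
Proof.
move=> q_odd co_pq; rewrite jacE // mulf_neq0 ?epsq_neq0 //.
apply/eqP => /(congr1 re) /= j0; have := jac_sqr R q_odd co_pq.
by rewrite j0 expr0n => /eqP; rewrite eq_sym oner_eq0.
Qed.

Lemma wsum_neq0_four p q : (0 < q)%N -> (4 %| q)%N -> coprime p q -> wsum R p q != 0.
Proof.
move=> q_gt0 q4 co_pq; have [x1 _] := wsum_four R q_gt0 q4 co_pq.
apply/eqP => w0; move: x1; rewrite w0 /= expr0n => /eqP.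
by rewrite eq_sym oner_eq0.
Qed.

Lemma g1_neq0 p q : (0 < q)%N -> wsum R p q != 0 -> g1 R p%:Z q != 0.
Proof. by move=> q_gt0 w0; rewrite g1_wsum // mulf_neq0 ?csqrt_neq0. Qed.

Lemma g1_jac p q : odd q -> coprime p q ->
  g1 R p%:Z q / (epsq R q * csqrt R q) = (jac R q p)%:C.
Proof.
move=> q_odd co_pq; rewrite [epsq R q * _]mulrC invfM mulrA -/(wsum R p q) jacE //.
by rewrite mulrAC divff ?mul1r ?epsq_neq0.
Qed.

Lemma gsum_odd p q : odd q -> (1 < q)%N -> coprime p q ->
  gsum phi p%:Z q = g1 R p%:Z q * Gfull phi (xpt R bodd q p).
Proof.
move=> q_odd q_gt1 co_pq; apply: (gsum_Gfull phiB); first exact: ltnW.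
by move=> k; rewrite complete_square_odd.
Qed.

(** For frequencies k = 2j the phase -k^2/(4p) is -j^2/p. *)
Definition bfour (q : nat) : int := -1.

Lemma gsum_four p q : (4 %| q)%N -> (1 < q)%N -> coprime p q ->
  gsum phi p%:Z q = g1 R p%:Z q * Gplus phi (xpt R bfour q p).
Proof.
move=> q4 q_gt1 co_pq; have q_gt0 := ltnW q_gt1; apply: (gsum_Gplus phiB) => // [k k_odd|j].
  exact: sum_four_odd.
by rewrite complete_square_even.
Qed.

Definition btwo (q : nat) : int := bodd (q %/ 2).

Lemma gsum_two p r : odd r -> (1 < r)%N -> coprime p (r * 2) ->
  gsum phi p%:Z (r * 2) = 2 * g1 R (2 * p)%N%:Z r * Gminus phi (xpt R btwo (r * 2) p).
Proof.
move=> r_odd r_gt1; rewrite coprimeMr coprimen2 => /andP[co_pr p_odd].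
have q_gt0 : (0 < r * 2)%N by rewrite muln_gt0 ltnW.
rewrite /xpt /btwo mulnK //; apply: (gsum_Gminus phiB) => // k kP.
  exact: sum_twice_odd_even.
exact: sum_twice_odd_odd.
Qed.

Lemma admissible_jac : admissible (fun q => odd q /\ ~ is_square q) bodd (jac R) 0.
Proof.
move=> q q_gt1 [q_odd nsq]; split; [exact: twisted_jac|exact: card_ann_bodd|].
rewrite mul0r; have := @sum_jac_eq0 R q q 1 q_odd nsq (ltnW q_gt1) (dvdnn q).
rewrite coprime1n => H; rewrite -[RHS]H //; last by move=> u; exists u.
by apply: eq_bigr => p _; rewrite mul1n.
Qed.

Lemma mod4_two q : (q %% 4 = 2)%N -> exists2 r, odd r & q = (r * 2)%N.
Proof.
move=> q4; exists (q %/ 4 * 2 + 1)%N; first by rewrite oddD oddM andbF.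
by rewrite {1}(divn_eq q 4) q4 mulnDl -mulnA.
Qed.

Lemma admissible_jac_two : admissible (fun q => (q %% 4 = 2)%N /\ ~ is_square (q %/ 2)) btwo
  (fun q p => jac R (q %/ 2) (2 * p)%N) 0.
Proof.
move=> q q_gt1 [/mod4_two[r r_odd qE] nsq]; rewrite qE mulnK // in nsq *.
have r_gt0 : (0 < r)%N by case: (r) r_odd.
have co_r p : coprime p (r * 2) -> coprime p r /\ coprime (2 * p) r.
  by rewrite coprimeMr => /andP[co_pr _]; rewrite coprimeMl co_pr coprime2n r_odd.
rewrite /btwo mulnK //; split; last 2 first.
- exact: card_ann_twice_odd.
- rewrite mul0r; apply: sum_jac_eq0 => //; first by rewrite muln_gt0 r_gt0.
    by rewrite dvdn_mulr.
    (* A unit u modulo r lifts to u or u + r, whichever is odd. *)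
    move=> u co_ur; exists (u + (~~ odd u) * r)%N; last by rewrite -modnDmr modnMl addn0.
    rewrite coprimeMr coprimen2 oddD oddM r_odd andbT oddb addbN addbb andbT.
    by rewrite coprime_sym /coprime addnC gcdnMDl -/(coprime _ _) coprime_sym.
  by rewrite coprime2n.
split=> [p|p /co_r[_]|u /co_r[co_ur _]]; last 2 first.
- exact: jac_sqr.
- have [k k1 kE] := jacM R r_odd co_ur; exists k => // p /co_r[_ co_2p].
  by rewrite mulnA mulnC kE.
rewrite /jac; congr (re (_ / _)); rewrite -[LHS]wsum_mod // -[RHS]wsum_mod //.
by rewrite -modnMmr modn_dvdm ?dvdn_mulr // modnMmr.
Qed.

Lemma admissible_four (S : nat -> Prop) : (forall q, S q -> (4 %| q)%N) ->
  [/\ admissible S bfour (fun q p => im (wsum R p q)) 0,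
      admissible S bfour (fun q p => re (wsum R p q) * im (wsum R p q)) 0
    & (forall q, S q -> ~ is_square q) ->
      admissible S bfour (fun q p => re (wsum R p q)) 0].
Proof.
move=> S4; split=> [||nsq] q q_gt1 Sq; have q_gt0 := ltnW q_gt1; have q4 := S4 q Sq;
  have [s [t1 t2 t3 _]] := twisted_four R q_gt0 q4; split => //; try exact: card_ann_N1;
  rewrite mul0r.
- by have [] := sum_wsum_four R q_gt0 q4.
- exact: sum_reim_eq0.
- by have [_] := sum_wsum_four R q_gt0 q4; apply; exact: nsq.
Qed.

End Cases.

Unset Implicit Arguments.

Theorem theorem1p1 (R : realType) (D : set R) (phi : R -> R[i]) :
  (forall x : R, D x <-> D (x + 1)) ->
  lebesgue_measure (boundary D `&` `[0%R, 1%R[) = 0%E ->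
  (0 < completed_lebesgue_measure (D `&` `[0%R, 1%R[))%E ->
  in_B phi ->
  (
   (* (1) q = 0 mod 4, q not a square *)
   conv_dist (fun q => (q %% 4 = 0)%N /\ ~ is_square q) D
     (fun q p => (toR2 (g1 R p%:Z q / csqrt R q), toR2 (gsum phi p%:Z q / g1 R p%:Z q)))
     (E_pair (valsX R) (Gplus phi)) /\
   (* (2) q = 0 mod 4, q a square *)
   conv_dist (fun q => (q %% 4 = 0)%N /\ is_square q) D
     (fun q p => (toR2 (g1 R p%:Z q / csqrt R q), toR2 (gsum phi p%:Z q / g1 R p%:Z q)))
     (E_pair (valsZ R) (Gplus phi)) /\
   (* (3) q odd, not a square *)
   conv_dist (fun q => odd q /\ ~ is_square q) D
     (fun q p => (toR2 (g1 R p%:Z q / (epsq R q * csqrt R q)),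
                  toR2 (gsum phi p%:Z q / g1 R p%:Z q)))
     (E_pair (valsY R) (Gfull phi)) /\
   (* (4) q an odd square *)
   conv_dist (fun q => odd q /\ is_square q) D
     (fun q p => toR2 (gsum phi p%:Z q / (epsq R q * csqrt R q)))
     (E_single (Gfull phi)) /\
   (* (5) q = 2 mod 4, q/2 not a square *)
   conv_dist (fun q => (q %% 4 = 2)%N /\ ~ is_square (q %/ 2)) D
     (fun q p => (toR2 (g1 R (2 * p%:Z) (q %/ 2) / (epsq R (q %/ 2) * csqrt R (q %/ 2))),
                  toR2 (gsum phi p%:Z q / (2 * g1 R (2 * p%:Z) (q %/ 2)))))
     (E_pair (valsY R) (Gminus phi)) /\
   (* (6) q = 2 mod 4, q/2 a square *)
   conv_dist (fun q => (q %% 4 = 2)%N /\ is_square (q %/ 2)) D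
     (fun q p => toR2 (gsum phi p%:Z q / (epsq R (q %/ 2) * csqrt R (2 * q))))
     (E_single (Gminus phi))).
Proof.
move=> D_per D_bnd D_pos phiB.
have GfullC := Gfull_continuous phiB; have GplusC := Gplus_continuous phiB.
have GminusC := Gminus_continuous phiB.
have GfullP := Gfull_periodic phi; have GplusP := Gplus_periodic phi.
have GminusP := Gminus_periodic phi.
have dvd4 q : (q %% 4 = 0)%N -> (4 %| q)%N by move/eqP.
have ratio4 q p : (1 < q)%N -> (4 %| q)%N -> coprime p q ->
    gsum phi p%:Z q / g1 R p%:Z q = Gplus phi (xpt R bfour q p).
  move=> q_gt1 q4 co_pq; have q_gt0 := ltnW q_gt1.
  by rewrite (gsum_four phiB) // mulrAC divff ?mul1r // g1_neq0 // wsum_neq0_four.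
split; [|split; [|split; [|split; [|split]]]] => f fc _.
- have [|a2 a3 a1] := @admissible_four R (fun q => (q %% 4 = 0)%N /\ ~ is_square q).
    by move=> q [/dvd4].
  have {}a1 := a1 (fun q h => h.2).
  pose F s t x := f (toR2 (Complex s t), toR2 (Gplus phi x)).
  have Fc s t : continuous (F s t) by exact: test_pair_continuous.
  have FP s t : periodic1 (F s t) by move=> x; rewrite /F GplusP.
  have -> : E_pair (valsX R) (Gplus phi) f = 4%:R^-1 * (intT (F 1 1) + (intT (F 1 (-1)) +
      (intT (F (-1) 1) + intT (F (-1) (-1))))).
    by rewrite /E_pair /valsX !big_cons big_nil addr0.
  (* The term [erefl] makes H equal to F at the two signs and the point; what remains is to
     recognise the random pair in it. *)
  apply: (conv_cond _ (four_values D_per D_bnd D_pos a1 a2 a3 Fc FP (fun _ _ _ _ _ => erefl))).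
  move=> q q2 [/dvd4 q4 _] p co_pq; by rewrite ratio4 ?(ltnW q2) //.
- have [|a2 _ _] := @admissible_four R (fun q => (q %% 4 = 0)%N /\ is_square q).
    by move=> q [/dvd4].
  (* For square q the real part is 1 and one sign remains, that of the imaginary part, whose mean is
     0 for every q divisible by 4. *)
  pose F t x := f (toR2 (Complex 1 t), toR2 (Gplus phi x)).
  have Fc t : continuous (F t) by exact: test_pair_continuous.
  have FP t : periodic1 (F t) by move=> x; rewrite /F GplusP.
  have -> : E_pair (valsZ R) (Gplus phi) f = 2%:R^-1 * (intT (F 1) + intT (F (-1))).
    by rewrite /E_pair /valsZ !big_cons big_nil addr0.
  apply: (conv_cond _ (two_values D_per D_bnd D_pos a2 (Fc 1) (FP 1) (Fc (-1)) (FP (-1)) _));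
    first by move=> q q2 Sq p co_pq; exact: erefl.
  move=> q q2 [/dvd4 q4 [m qE]] p co_pq; rewrite ratio4 ?(ltnW q2) //.
  have m2 : (2 %| m)%N.
    have : (2 %| m * m)%N by rewrite -qE; exact: dvdn_trans q4.
    by rewrite Euclid_dvdM // orbb.
  have m_gt0 : (0 < m)%N by case: (m) qE q2 => // ->.
  have r1 : complex.Re (wsum R p q) = 1.
    rewrite qE; apply: re_wsum_even_square => //.
    by move: co_pq; rewrite qE coprimeMr => /andP[].
  rewrite -/(wsum R p q) /F; move: r1; case: (wsum R p q) => x y /= ->.
  by split=> ->.
- pose F s x := f (toR2 s, toR2 (Gfull phi x)).
  have Fc s : continuous (F s) by exact: test_pair_continuous.
  have FP s : periodic1 (F s) by move=> x; rewrite /F GfullP.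
  have -> : E_pair (valsY R) (Gfull phi) f = 2%:R^-1 * (intT (F 1) + intT (F (-1))).
    by rewrite /E_pair /valsY !big_cons big_nil addr0.
  apply: (conv_cond _ (two_values D_per D_bnd D_pos (admissible_jac R) (Fc 1) (FP 1)
    (Fc (-1)) (FP (-1)) _)); first by move=> q q2 Sq p co_pq; exact: erefl.
  move=> q q2 [q_odd _] p co_pq; have q_gt1 := ltnW q2; have q_gt0 := ltnW q_gt1.
  rewrite (gsum_odd phiB) // mulrAC divff ?g1_neq0 ?wsum_neq0_odd // mul1r.
  rewrite g1_jac //.
  by split=> ->; rewrite ?rmorph1 ?rmorphN1.
- pose F x := f (toR2 (Gfull phi x)).
  have Fc : continuous F by exact: test_continuous.
  have FP : periodic1 F by move=> x; rewrite /F GfullP.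
  (* For an odd square q the Gauss sum is exactly sqrt q: no sign is left, and the constant weight
     suffices. *)
  have adm : admissible (fun q => odd q /\ is_square q) bodd (fun _ _ => 1 : R) 1.
    by apply: admissible_one => q q_gt1 [q_odd _]; exact: card_ann_bodd.
  apply: (conv_cond _ (one_value D_per D_bnd D_pos adm Fc FP)).
  move=> q q2 [q_odd [m qE]] p co_pq; have q_gt1 := ltnW q2; have q_gt0 := ltnW q_gt1.
  have m_odd : odd m by move: q_odd; rewrite qE oddM andbb.
  rewrite (gsum_odd phiB) // g1_wsum //.
  have -> : epsq R q = 1 by rewrite qE epsq_square.
  have -> : wsum R p q = 1.
    by rewrite qE wsum_odd_square //; move: co_pq; rewrite qE coprimeMr => /andP[].
  by rewrite mul1r mulr1 mulrAC divff ?mul1r ?csqrt_neq0.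
- pose F s x := f (toR2 s, toR2 (Gminus phi x)).
  have Fc s : continuous (F s) by exact: test_pair_continuous.
  have FP s : periodic1 (F s) by move=> x; rewrite /F GminusP.
  have -> : E_pair (valsY R) (Gminus phi) f = 2%:R^-1 * (intT (F 1) + intT (F (-1))).
    by rewrite /E_pair /valsY !big_cons big_nil addr0.
  apply: (conv_cond _ (two_values D_per D_bnd D_pos (admissible_jac_two R) (Fc 1) (FP 1)
    (Fc (-1)) (FP (-1)) _)); first by move=> q q2 Sq p co_pq; exact: erefl.
  move=> q q2 [/mod4_two[r r_odd qE] _] p; rewrite qE mulnK // => co_pq.
  have r_gt1 : (1 < r)%N by move: q2; rewrite qE; case: (r) r_odd => [|[|]].
  have r_gt0 := ltnW r_gt1.
  have co_2p : coprime (2 * p) r.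
    by move: co_pq; rewrite coprimeMr coprimeMl coprime2n r_odd => /andP[].
  have g_neq0 : g1 R (2 * p)%N%:Z r != 0 by rewrite g1_neq0 ?wsum_neq0_odd.
  rewrite -PoszM (gsum_two phiB) // mulrAC divff ?mul1r; last by rewrite mulf_neq0 ?pnatr_eq0.
  rewrite g1_jac //.
  by split=> ->; rewrite ?rmorph1 ?rmorphN1.
- pose F x := f (toR2 (Gminus phi x)).
  have Fc : continuous F by exact: test_continuous.
  have FP : periodic1 F by move=> x; rewrite /F GminusP.
  have adm : admissible (fun q => (q %% 4 = 2)%N /\ is_square (q %/ 2)) btwo (fun _ _ => 1 : R) 1.
    apply: admissible_one => q q_gt1 [/mod4_two[r r_odd ->] _].
    by rewrite /btwo mulnK //; exact: card_ann_twice_odd.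
  apply: (conv_cond _ (one_value D_per D_bnd D_pos adm Fc FP)).
  move=> q q2 [/mod4_two[r r_odd qE] +] p; rewrite qE mulnK // => -[m rE] co_pq.
  have r_gt1 : (1 < r)%N by move: q2; rewrite qE; case: (r) r_odd => [|[|]].
  have r_gt0 := ltnW r_gt1.
  have m_odd : odd m by move: r_odd; rewrite rE oddM andbb.
  have co_2p : coprime (2 * p) m.
    move: co_pq; rewrite rE !coprimeMr => /andP[/andP[co_pm _] _].
    by rewrite coprimeMl coprime2n m_odd.
  rewrite (gsum_two phiB) // g1_wsum //.
  have -> : epsq R r = 1 by rewrite rE epsq_square.
  have -> : wsum R (2 * p) r = 1 by rewrite rE wsum_odd_square.
  (* sqrt(2q) = 2 sqrt(q/2), and this 2 matches the factor 2 in [gsum_two]. *)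
  have -> : csqrt R (2 * (r * 2)) = 2 * csqrt R r.
    by rewrite rE (_ : 2 * (m * m * 2) = (2 * m) * (2 * m))%N ?csqrt_square ?natrM //; ring.
  rewrite mul1r mulr1 mulrAC divff ?mul1r // mulf_neq0 ?csqrt_neq0 // pnatr_eq0.
Qed.
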